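(* Let $f\colon\Sigma\to\mathbb{H}^3$ be a weakly complete flat front. If the meromorphic function $\rho=\theta/\omega$ (the ratio of the canonical forms of $f$) is constant, then $f$ is congruent to a horosphere or a hyperbolic cylinder. Here, a surface equidistant from a geodesic is called a hyperbolic cylinder.
   Context: Hyperbolic space. $\mathbb{H}^3=\{aa^*: a\in SL(2,\mathbb{C})\}$ (with $a^*={}^t\bar a$), i.e. the set of $2\times2$ Hermitian matrices $X$ with $\det X=1$, $\mathrm{trace}\,X>0$, with the metric induced from the Lorentzian inner product on Hermitian matrices determined by $\langle X,X\rangle=-\det X$; it is the simply connected Riemannian three-manifold of constant sectional curvature $-1$. Flat fronts. Let $\Sigma$ be an oriented two-manifold. A smooth map $f\colon\Sigma\to\mathbb{H}^3$ is a front if there is a unit vector field $n$ along $f$ (unit normal vector field) with $\langle df,n\rangle=0$ such that $(f,n)\colon\Sigma\to T_1\mathbb{H}^3$ is an immersion into the unit tangent bundle (equivalently, $f$ is the projection of a Legendrian immersion into the unit cotangent bundle). Its parallel fronts are $f_t=(\cosh t)f+(\sinh t)n$, $t\in\mathbb{R}$. A front $f$ is a flat front if for each $p\in\Sigma$ there is $t\in\mathbb{R}$ such that $f_t$ is a flat immersion at $p$. Canonical forms. For a flat front $f$ there exist a unique complex structure on $\Sigma$ and a holomorphic immersion $\mathcal{E}_f\colon\widetilde\Sigma\to SL(2,\mathbb{C})$, where $\widetilde\Sigma$ is the universal covering surface of $\Sigma$, that is Legendrian, i.e. $\mathcal{E}_f^{-1}d\mathcal{E}_f$ is off-diagonal,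 with $f=\mathcal{E}_f\mathcal{E}_f^*$ and $n=\mathcal{E}_f e_3\mathcal{E}_f^*$, $e_3=\begin{pmatrix}1&0\\0&-1\end{pmatrix}$. Write $\mathcal{E}_f^{-1}d\mathcal{E}_f=\begin{pmatrix}0&\theta\\ \omega&0\end{pmatrix}$; the holomorphic one-forms $\omega,\theta$ on $\widetilde\Sigma$ are the canonical forms of $f$, and $\rho=\theta/\omega$ is a meromorphic function on $\widetilde\Sigma$. The quantities $|\omega|^2$, $|\theta|^2$ and $|\rho|$ are well defined on $\Sigma$, and $ds^2_{1,1}=|\omega|^2+|\theta|^2$ is positive definite and is a conformal metric on the Riemann surface $\Sigma$. The flat front $f$ is weakly complete if the metric $ds^2_{1,1}$ is complete.
   Formalization: A hyperbolic cylinder is the set of points at distance r ≥ 0 from a geodesic; r = 0 (the geodesic itself) is allowed because a weakly complete flat front with |ρ| = 1 constant collapses onto the axis. ''Congruent'' means that an isometry maps the image of f onto the surface. *)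

(* Defs.v *)
From HB Require Import structures.
From mathcomp Require Import all_boot all_order all_algebra.
From mathcomp Require Import complex.
From mathcomp Require Import all_classical all_reals all_analysis.
Set Implicit Arguments.
Unset Strict Implicit.
Unset Printing Implicit Defensive.
Import Order.TTheory GRing.Theory Num.Theory numFieldNormedType.Exports.
Local Open Scope classical_set_scope.
Local Open Scope ring_scope.
Local Open Scope complex_scope.

Definition partial (R : realType) (i : 'I_2) (g : 'rV[R]_2 -> R)
    (x : 'rV[R]_2) : R :=
  'D_(delta_mx 0 i) g x.

Fixpoint Ck_on (R : realType) (k : nat) (U : set 'rV[R]_2)
    (g : 'rV[R]_2 -> R) : Prop :=
  (forall x, U x -> {for x, continuous g}) /\
  (if k is k'.+1 then
     forall i : 'I_2, (forall x, U x -> derivable g x (delta_mx 0 i)) /\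
                      Ck_on k' U (partial i g)
   else True).

Definition smooth_on (R : realType) (U : set 'rV[R]_2) (g : 'rV[R]_2 -> R) :=
  forall k, Ck_on k U g.

(* [R[i]^o] is C as a normed space over itself, so [derivable g z 1] is
   complex differentiability. *)
Definition holomorphic_on (R : realType) (U : set R[i]^o)
    (g : R[i]^o -> R[i]^o) :=
  forall z, U z -> derivable g z 1.

Definition toC (R : realType) (x : 'rV[R]_2) : R[i]^o := x 0 0 +i* x 0 1.
Definition toR2 (R : realType) (z : R[i]^o) : 'rV[R]_2 :=
  \row_(i < 2) (if i == 0 then complex.Re z else complex.Im z).

Definition sqmod (R : realType) (z : R[i]) : R :=
  complex.Re z ^+ 2 + complex.Im z ^+ 2.

(* [chinv] is only meaningful on the image of [dom]. *)
Record chart (S V : topologicalType) := Chart {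
  dom : set S;
  chmap :> S -> V;
  chinv : V -> S }.

Definition chart_image (S V : topologicalType) (phi : chart S V) : set V :=
  phi @` dom phi.

Definition is_chart (S V : topologicalType) (phi : chart S V) :=
  [/\ open (dom phi), open (chart_image phi),
      forall p, dom phi p -> chinv phi (phi p) = p,
      forall p, dom phi p -> {for p, continuous phi}
    & forall z, chart_image phi z -> {for z, continuous (chinv phi)}].

(* Atlases are indexed by the points of the space: [A p] is a chart around p.
   In particular tensors at p may be written in the coordinates [A p]. *)
Definition is_atlas (S V : topologicalType) (A : S -> chart S V) :=
  forall p, is_chart (A p) /\ dom (A p) p.

Definition overlap (S V W : topologicalType) (phi : chart S V)
    (psi : chart S W) : set V :=
  phi @` (dom phi `&` dom psi).

Definition transition (S V W : topologicalType) (phi : chart S V)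
    (psi : chart S W) : V -> W :=
  fun x => psi (chinv phi x).

Definition jacobian_mx (R : realType) (g : 'rV[R]_2 -> 'rV[R]_2)
    (x : 'rV[R]_2) : 'M[R]_2 :=
  \matrix_(i < 2, j < 2) partial i (fun y => g y 0 j) x.

Record oriented_surface (R : realType) (S : topologicalType)
    (P : S -> chart S 'rV[R]_2) : Prop := {
  surf_nonempty : [set: S] !=set0;
  surf_connected : connected [set: S];
  surf_hausdorff : hausdorff_space S;
  surf_countable : @second_countable S;
  surf_atlas : is_atlas P;
  surf_smooth : forall p q i,
    smooth_on (overlap (P p) (P q)) (fun x => transition (P p) (P q) x 0 i);
  surf_oriented : forall p q x, overlap (P p) (P q) x ->
    0 < \det (jacobian_mx (transition (P p) (P q)) x) }.

Definition complex_atlas (R : realType) (S : topologicalType)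
    (J : S -> chart S R[i]^o) :=
  is_atlas J /\
  forall p q, holomorphic_on (overlap (J p) (J q)) (transition (J p) (J q)).

Definition complex_structure (R : realType) (S : topologicalType)
    (P : S -> chart S 'rV[R]_2) (J : S -> chart S R[i]^o) :=
  [/\ complex_atlas J,
      forall p q i, smooth_on (overlap (P p) (J q))
        (fun x => toR2 (transition (P p) (J q) x) 0 i)
    & forall p q i, smooth_on (@toR2 R @` overlap (J q) (P p))
        (fun x => transition (J q) (P p) (toC x) 0 i)].

Definition covering_map (T S : topologicalType) (pi : T -> S) :=
  continuous pi /\
  forall x : S, exists U : set S, [/\ open U, U x
    & exists F : set (set T),
      [/\ F !=set0,
          forall V W, F V -> F W -> V `&` W !=set0 -> V = W,
          \bigcup_(V in F) V = pi @^-1` U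
        & forall V, F V -> open V /\ exists s : S -> T,
            [/\ forall y, U y -> V (s y) /\ pi (s y) = y,
                forall z, V z -> s (pi z) = z
              & forall y, U y -> {for y, continuous s}]]].

Definition simply_connected (R : realType) (T : topologicalType) :=
  [/\ [set: T] !=set0,
      forall x y : T, exists c : R -> T,
        [/\ {within `[0, 1], continuous c}, c 0 = x & c 1 = y]
    & forall c : R -> T, {within `[0, 1], continuous c} -> c 0 = c 1 ->
        exists H : R * R -> T,
          [/\ {within `[0, 1] `*` `[0, 1], continuous H},
              forall s, `[0, 1]%classic s -> H (s, 0) = c s,
              forall s, `[0, 1]%classic s -> H (s, 1) = c 0
            & forall t, `[0, 1]%classic t -> H (0, t) = c 0 /\ H (1, t) = c 0]].

Definition universal_covering (R : realType) (S T : topologicalType)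
    (J : S -> chart S R[i]^o) (A : T -> chart T R[i]^o) (pi : T -> S) :=
  [/\ simply_connected R T, complex_atlas A, covering_map pi
    & forall q p,
        holomorphic_on (A q @` (dom (A q) `&` pi @^-1` dom (J p)))
          (fun z => J p (pi (chinv (A q) z)))].

Definition ctr (R : realType) (a : 'M[R[i]]_2) : 'M[R[i]]_2 :=
  (map_mx (@conjc R) a)^T.

Definition H3 (R : realType) : set 'M[R[i]]_2 :=
  [set X | exists2 a : 'M[R[i]]_2, \det a = 1 & X = a *m ctr a].

(* Polarization of <X, X> = - det X, which is real on Hermitian matrices. *)
Definition lor (R : realType) (X Y : 'M[R[i]]_2) : R :=
  - complex.Re (\det (X + Y) - \det X - \det Y) / 2.

Definition cosh (R : realType) (t : R) : R := (expR t + expR (- t)) / 2.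
Definition sinh (R : realType) (t : R) : R := (expR t - expR (- t)) / 2.
Definition arcosh (R : realType) (x : R) : R :=
  ln (x + Num.sqrt (x ^+ 2 - 1)).

(* [geodesic_pt X V t] is the point at time t of the unit speed geodesic
   issued from X with initial velocity V, and
   cosh (hdist X Y) = - <X, Y> on H3. *)
Definition geodesic_pt (R : realType) (X V : 'M[R[i]]_2) (t : R) :=
  (cosh t)%:C *: X + (sinh t)%:C *: V.

Definition hdist (R : realType) (X Y : 'M[R[i]]_2) : R := arcosh (- lor X Y).

Definition unit_tangent (R : realType) (X V : 'M[R[i]]_2) :=
  [/\ ctr V = V, lor X V = 0 & lor V V = 1].

Definition isometry_H3 (R : realType) (Phi : 'M[R[i]]_2 -> 'M[R[i]]_2) :=
  Phi @` @H3 R = @H3 R /\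
  forall X Y, H3 X -> H3 Y -> hdist (Phi X) (Phi Y) = hdist X Y.

(* Sections of H3 by the affine hyperplanes <X, L> = -1, with L on the
   future light cone; rescaling L gives all the horospheres centred at the
   ideal point [L]. *)
Definition horosphere (R : realType) (M : set 'M[R[i]]_2) :=
  exists L : 'M[R[i]]_2, [/\ ctr L = L, \det L = 0, 0 < \tr L
    & M = [set X | H3 X /\ lor X L = -1]].

Definition geodesic (R : realType) (G : set 'M[R[i]]_2) :=
  exists X V, [/\ H3 X, unit_tangent X V & G = range (geodesic_pt X V)].

(* r = 0 is allowed: the parallel family of a hyperbolic cylinder contains
   the front that collapses onto the axis, for which |rho| = 1. *)
Definition hyperbolic_cylinder (R : realType) (M : set 'M[R[i]]_2) :=
  exists (G : set 'M[R[i]]_2) (r : R), [/\ geodesic G, 0 <= r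
    & M = [set X | H3 X /\ inf (hdist X @` G) = r]].

Definition partial_mx (R : realType) (i : 'I_2) (F : 'rV[R]_2 -> 'M[R[i]]_2)
    (x : 'rV[R]_2) : 'M[R[i]]_2 :=
  \matrix_(a < 2, b < 2)
    (partial i (fun y => complex.Re (F y a b)) x
     +i* partial i (fun y => complex.Im (F y a b)) x).

Definition diff_mx (R : realType) (F : 'rV[R]_2 -> 'M[R[i]]_2)
    (x v : 'rV[R]_2) : 'M[R[i]]_2 :=
  \sum_(i < 2) (v 0 i)%:C *: partial_mx i F x.

Definition smooth_map (R : realType) (S : topologicalType)
    (P : S -> chart S 'rV[R]_2) (f : S -> 'M[R[i]]_2) :=
  forall p a b,
    smooth_on (chart_image (P p)) (fun x => complex.Re (f (chinv (P p) x) a b))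
    /\
    smooth_on (chart_image (P p)) (fun x => complex.Im (f (chinv (P p) x) a b)).

(* The differential of f at p, in the coordinates [P p]. *)
Definition dmap (R : realType) (S : topologicalType)
    (P : S -> chart S 'rV[R]_2) (f : S -> 'M[R[i]]_2) (p : S) (v : 'rV[R]_2) :=
  diff_mx (fun x => f (chinv (P p) x)) (P p p) v.

Record front (R : realType) (S : topologicalType)
    (P : S -> chart S 'rV[R]_2) (f n : S -> 'M[R[i]]_2) : Prop := {
  front_smooth : smooth_map P f;
  front_H3 : forall p, H3 (f p);
  front_normal_smooth : smooth_map P n;
  front_unit : forall p, unit_tangent (f p) (n p);
  front_normal : forall p v, lor (dmap P f p v) (n p) = 0;
  front_immersion : forall p v,
    dmap P f p v = 0 -> dmap P n p v = 0 -> v = 0 }.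

Definition christoffel (R : realType) (g : 'rV[R]_2 -> 'M[R]_2)
    (k i j : 'I_2) (x : 'rV[R]_2) : R :=
  2^-1 * \sum_(l < 2) invmx (g x) k l *
    (partial i (fun y => g y j l) x + partial j (fun y => g y i l) x
     - partial l (fun y => g y i j) x).

(* Sign convention: R(d_i, d_j) d_k = sum_l (curvature_tensor g l k i j) d_l. *)
Definition curvature_tensor (R : realType) (g : 'rV[R]_2 -> 'M[R]_2)
    (l k i j : 'I_2) (x : 'rV[R]_2) : R :=
  partial i (christoffel g l j k) x - partial j (christoffel g l i k) x
  + \sum_(m < 2) (christoffel g l i m x * christoffel g m j k x
                  - christoffel g l j m x * christoffel g m i k x).

Definition gauss_curvature (R : realType) (g : 'rV[R]_2 -> 'M[R]_2)
    (x : 'rV[R]_2) : R :=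
  (\sum_(l < 2) g x 0 l * curvature_tensor g l 1 0 1 x) / \det (g x).

Definition first_form (R : realType) (F : 'rV[R]_2 -> 'M[R[i]]_2)
    (x : 'rV[R]_2) : 'M[R]_2 :=
  \matrix_(i < 2, j < 2) lor (partial_mx i F x) (partial_mx j F x).

Definition flat_immersion_at (R : realType) (S : topologicalType)
    (P : S -> chart S 'rV[R]_2) (f : S -> 'M[R[i]]_2) (p : S) :=
  (forall v, dmap P f p v = 0 -> v = 0) /\
  gauss_curvature (first_form (fun x => f (chinv (P p) x))) (P p p) = 0.

(* [geodesic_pt (f q) (n q) t] is f_t = (cosh t) f + (sinh t) n. *)
Definition flat_front (R : realType) (S : topologicalType)
    (P : S -> chart S 'rV[R]_2) (f n : S -> 'M[R[i]]_2) :=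
  front P f n /\
  forall p, exists t : R,
    flat_immersion_at P (fun q => geodesic_pt (f q) (n q) t) p.

(* The coefficients of dE and of E^-1 dE with respect to dz, where z is the
   coordinate [A q] at q. *)
Definition dholo (R : realType) (T : topologicalType)
    (A : T -> chart T R[i]^o) (E : T -> 'M[R[i]]_2) (q : T) : 'M[R[i]]_2 :=
  \matrix_(a < 2, b < 2)
    ('D_1 ((fun z => E (chinv (A q) z) a b) : R[i]^o -> R[i]^o) (A q q) : R[i]).

Definition maurer_cartan (R : realType) (T : topologicalType)
    (A : T -> chart T R[i]^o) (E : T -> 'M[R[i]]_2) (q : T) : 'M[R[i]]_2 :=
  invmx (E q) *m dholo A E q.

Definition e3 (R : realType) : 'M[R[i]]_2 :=
  \matrix_(a < 2, b < 2) (if a == b then (if a == 0 then 1 else -1) else 0).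

Record legendrian_lift (R : realType) (S T : topologicalType)
    (A : T -> chart T R[i]^o) (pi : T -> S) (f n : S -> 'M[R[i]]_2)
    (E : T -> 'M[R[i]]_2) : Prop := {
  lift_SL2 : forall q, \det (E q) = 1;
  lift_holomorphic : forall q a b,
    holomorphic_on (chart_image (A q)) (fun z => E (chinv (A q) z) a b);
  lift_immersion : forall q, dholo A E q != 0;
  lift_legendrian : forall q (a : 'I_2), maurer_cartan A E q a a = 0;
  lift_front : forall q, f (pi q) = E q *m ctr (E q);
  lift_normal : forall q, n (pi q) = E q *m e3 R *m ctr (E q) }.

Definition omega (R : realType) (T : topologicalType)
    (A : T -> chart T R[i]^o) (E : T -> 'M[R[i]]_2) (q : T) : R[i] :=
  maurer_cartan A E q 1 0.
Definition theta (R : realType) (T : topologicalType)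
    (A : T -> chart T R[i]^o) (E : T -> 'M[R[i]]_2) (q : T) : R[i] :=
  maurer_cartan A E q 0 1.

(* A meromorphic function, with values in C + {oo} ([None] is oo); omega and
   theta have no common zero since E is an immersion. *)
Definition rho (R : realType) (T : topologicalType)
    (A : T -> chart T R[i]^o) (E : T -> 'M[R[i]]_2) (q : T) : option R[i] :=
  if omega A E q == 0 then None else Some (theta A E q / omega A E q).

(* Curves need not be regular, so C^1 curves give the same distance as
   piecewise C^1 ones. *)
Definition C1_curve (R : realType) (S : topologicalType)
    (J : S -> chart S R[i]^o) (c : R -> S) :=
  continuous c /\
  forall p t, dom (J p) (c t) ->
    let x (s : R) : R := complex.Re (J p (c s)) in
    let y (s : R) : R := complex.Im (J p (c s)) in
    [/\ derivable x t 1, {for t, continuous (derive1 x)},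
        derivable y t 1 & {for t, continuous (derive1 y)}].

(* A conformal metric on (S, J) is encoded by h : S -> R, with
   ds^2 = (h p) |dz|^2 at p, z being the coordinate [J p]. *)
Definition speed (R : realType) (S : topologicalType)
    (J : S -> chart S R[i]^o) (h : S -> R) (c : R -> S) (t : R) : R :=
  let x (s : R) : R := complex.Re (J (c t) (c s)) in
  let y (s : R) : R := complex.Im (J (c t) (c s)) in
  Num.sqrt (h (c t) * (derive1 x t ^+ 2 + derive1 y t ^+ 2)).

Definition curve_length (R : realType) (S : topologicalType)
    (J : S -> chart S R[i]^o) (h : S -> R) (c : R -> S) : \bar R :=
  (\int[@lebesgue_measure R]_(t in `[0%R, 1%R]) (speed J h c t)%:E)%E.

Definition conf_dist (R : realType) (S : topologicalType)
    (J : S -> chart S R[i]^o) (h : S -> R) (p q : S) : \bar R :=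
  ereal_inf [set curve_length J h c |
               c in [set c | [/\ C1_curve J c, c 0 = p & c 1 = q]]].

Definition complete_conformal (R : realType) (S : topologicalType)
    (J : S -> chart S R[i]^o) (h : S -> R) :=
  forall u : nat -> S,
    (forall e : R, 0 < e -> exists N : nat, forall k l : nat,
       (N <= k)%N -> (N <= l)%N -> (conf_dist J h (u k) (u l) < e%:E)%E) ->
    exists p : S, forall e : R, 0 < e -> exists N : nat, forall k : nat,
       (N <= k)%N -> (conf_dist J h (u k) p < e%:E)%E.

(* h |dz|^2 is the metric on S whose pull-back by pi is
   |omega|^2 + |theta|^2. *)
Definition is_ds11 (R : realType) (S T : topologicalType)
    (J : S -> chart S R[i]^o) (A : T -> chart T R[i]^o) (pi : T -> S)
    (E : T -> 'M[R[i]]_2) (h : S -> R) :=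
  forall q, sqmod (omega A E q) + sqmod (theta A E q) =
    h (pi q) * sqmod ('D_1 ((fun z => J (pi q) (pi (chinv (A q) z)))
                              : R[i]^o -> R[i]^o) (A q q)).

Definition weakly_complete (R : realType) (S T : topologicalType)
    (J : S -> chart S R[i]^o) (A : T -> chart T R[i]^o) (pi : T -> S)
    (E : T -> 'M[R[i]]_2) :=
  exists2 h : S -> R, is_ds11 J A pi E h & complete_conformal J h.

(* Main.v *)
Require Import Defs.
From HB Require Import structures.
From mathcomp Require Import all_boot all_order all_algebra.
From mathcomp Require Import complex ring lra.
From mathcomp Require Import all_classical all_reals all_analysis.
From mathcomp Require Import measurable_realfun.
Import Order.TTheory GRing.Theory Num.Theory numFieldNormedType.Exports.
Local Open Scope classical_set_scope.
Local Open Scope ring_scope.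
Local Open Scope complex_scope.
Set Implicit Arguments.
Unset Strict Implicit.
Unset Printing Implicit Defensive.
Import Normc.

(* If theta / omega is constant then E^-1 dE = eta M for a constant matrix M,
   and a constant conjugation brings M to the nilpotent form (0 0; 1 0) or to
   diag(s, -s). Up to a constant left factor, E is then (1 0; g 1) with
   dg = eta, or diag(w, 1/w) with dw = s eta w. In both cases f is an explicit
   function of G = g, resp. G = w^2, and G is a polynomial in the entries of f
   and n, hence a smooth function on S itself, holomorphic for J. Since
   ds^2_{1,1} is the pull-back by G of a multiple of |dv|^2 on C, resp. of
   |dv|^2 / |v|^2 on C \ {0}, completeness lets segments be lifted through G, so
   that G is onto C, resp. C \ {0}. The explicit formulas identify the image of
   f with a horosphere, resp. with the surface equidistant from the geodesic
   {diag(e^t, e^-t)}.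

   Complex differentiability is only assumed pointwise. Continuity of the
   derivative of G, needed to invert it locally, comes from the smoothness of
   f and n instead of Goursat's theorem. *)

(** Completeness concerns the metric on S, while E lives on T. This is why the developing coordinate
    has to descend: segments of C are lifted through a map defined on S. When |rho| = 1 the front
    collapses onto the axis and f forgets the argument of v, which only n remembers; hence n enters
    G in the cylindrical case. Two notions of nearness on S meet, and they are not assumed to agree:
    [conf_dist], in which the endpoints of partial lifts converge, and the topology, in which G is
    inverted locally. A curve of small length is therefore followed through G, where its Euclidean
    displacement is controlled, and uniqueness of lifts puts it on the sheet of the limit point.
    Differentiability takes three forms: [cdiff], pointwise and complex, for functions read on T;
    [sdiff], strict and only real-linear, for functions on S; [vdiff], along curves. The projection
    pi relates the first two and forces the differential of G to be complex linear. *)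

Section Modulus.
Variable R : realType.
Implicit Types (x y z : R[i]) (P : set R[i]^o).

Lemma sqr_normc_sqmod z : normc z ^+ 2 = sqmod z.
Proof. by case: z => a b; rewrite /sqmod sqr_sqrtr// addr_ge0// sqr_ge0. Qed.

Lemma sqrt_sqmod z : Num.sqrt (sqmod z) = normc z.
Proof. by case: z. Qed.

Lemma normc_ge0 z : 0 <= normc z.
Proof. by rewrite -sqrt_sqmod sqrtr_ge0. Qed.

Lemma normrE z : `|z| = (normc z)%:C.
Proof. by case: z. Qed.

Lemma normc_gt0 z : z != 0 -> 0 < normc z.
Proof. by move=> z0; rewrite lt0r normc_ge0 andbT; apply: contra z0 => /eqP/eq0_normc->. Qed.

Lemma normc_triangle x y : normc (x + y) <= normc x + normc y.
Proof. exact: le_normcD. Qed.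

Lemma normc_opp z : normc (- z) = normc z.
Proof. exact: normcN. Qed.

Lemma normc_distC x y : normc (x - y) = normc (y - x).
Proof. by rewrite -normc_opp opprB. Qed.

Lemma normc_conj z : normc (conjc z) = normc z.
Proof. by case: z => a b /=; rewrite sqrrN. Qed.

Lemma conjcM x y : conjc (x * y) = conjc x * conjc y.
Proof. exact: rmorphM. Qed.

Lemma conjcD x y : conjc (x + y) = conjc x + conjc y.
Proof. exact: rmorphD. Qed.

Lemma conjcB x y : conjc (x - y) = conjc x - conjc y.
Proof. exact: rmorphB. Qed.

Lemma conjcN x : conjc (- x) = - conjc x.
Proof. exact: rmorphN. Qed.

Lemma realcN (r : R) : (- r)%:C = - r%:C.
Proof. exact: rmorphN. Qed.

Lemma realcD (r s : R) : (r + s)%:C = r%:C + s%:C.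
Proof. exact: rmorphD. Qed.

Lemma realcB (r s : R) : (r - s)%:C = r%:C - s%:C.
Proof. exact: rmorphB. Qed.

Lemma realcM (r s : R) : (r * s)%:C = r%:C * s%:C.
Proof. exact: rmorphM. Qed.

Lemma normc_real (r : R) : normc r%:C = `|r|.
Proof. by rewrite /= expr0n addr0 sqrtr_sqr. Qed.

Lemma normc2 : normc 2 = 2 :> R.
Proof.
have -> : 2 = (2 : R)%:C by rewrite rmorphMn.
by rewrite normc_real ger0_norm.
Qed.

Lemma norm_Re_le z : `|complex.Re z| <= normc z.
Proof. by case: z => a b /=; rewrite -sqrtr_sqr ler_wsqrtr// lerDl sqr_ge0. Qed.

Lemma norm_Im_le z : `|complex.Im z| <= normc z.
Proof. by case: z => a b /=; rewrite -sqrtr_sqr ler_wsqrtr// lerDr sqr_ge0. Qed.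

Lemma normc_le_ReIm z : normc z <= `|complex.Re z| + `|complex.Im z|.
Proof.
have -> : z = (complex.Re z)%:C + (complex.Im z)%:C * 'i by case: z => a b; simpc.
apply: le_trans (normc_triangle _ _) _.
by rewrite normcM !normc_real /=; simpc; rewrite expr0n /= expr1n add0r sqrtr1 mulr1.
Qed.

Lemma normc_le_dist x y : `|normc x - normc y| <= normc (x - y).
Proof.
have h (a b : R[i]) : normc a <= normc b + normc (a - b).
  by have := normc_triangle b (a - b); rewrite addrC subrK.
by have := h x y; have := h y x; rewrite (normc_distC y) ler_norml; lra.
Qed.

(** [R[i]^o] is normed over itself, so its balls have radii in [R[i]]. A positive element of [R[i]]
    has zero imaginary part, hence real radii suffice. *)
Lemma nbhs_normcP (z : R[i]^o) P :
  nbhs z P <-> exists2 d : R, 0 < d & forall y, normc (y - z) < d -> P y.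
Proof.
split=> [/nbhs_ballP[e /= e0 H]|[d d0 H]].
  have eE : e = (complex.Re e)%:C.
    by move: e0; case: (e) => a b; rewrite ltcE /= => /andP[/eqP -> _].
  exists (complex.Re e); first by move: e0; rewrite {1}eE ltcR.
  move=> y hy; apply: H; rewrite -ball_normE /ball_ /= normrE eE ltcR.
  by rewrite normc_distC.
apply/nbhs_ballP; exists d%:C => /=; first by rewrite ltcR.
move=> y; rewrite -ball_normE /ball_ /= normrE ltcR normc_distC; exact: H.
Qed.

Lemma near_normc (z : R[i]^o) (d : R) : 0 < d ->
  nbhs z [set y | normc (y - z) < d].
Proof. by move=> d0; apply/nbhs_normcP; exists d. Qed.

Lemma continuous_normcP (T : topologicalType) (g : T -> R[i]^o) (t : T) :
  {for t, continuous g} <->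
  forall e : R, 0 < e -> \forall s \near t, normc (g s - g t) < e.
Proof.
split=> [cg e e0|H].
  exact: (cg _ (near_normc (g t) e0)).
move=> P /nbhs_normcP[d d0 Hd].
by apply: filterS (H d d0) => s; exact: Hd.
Qed.

Lemma eps_normc_eq0 z (k : R) : 0 < k ->
  (forall e : R, 0 < e -> normc z <= e * k) -> z = 0.
Proof.
move=> k0 H; apply: contrapT => /eqP z0; have nz := normc_gt0 z0.
have := H (normc z / (2 * k)); rewrite divr_gt0 ?mulr_gt0// => /(_ isT).
have -> : normc z / (2 * k) * k = normc z / 2 by field; rewrite gt_eqF.
lra.
Qed.

End Modulus.

(** * Strict differentiability *)

Section StrictDifferentiability.
Variable R : realType.
Implicit Types (g : R[i] -> R[i]) (a b z w : R[i]).

(* The real-linear differential is written in Wirtinger form u |-> a u + b u^*. *)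
Definition sdiff g z0 a b := forall e : R, 0 < e -> exists2 d : R, 0 < d &
  forall z w, normc (z - z0) < d -> normc (w - z0) < d ->
    normc (g z - g w - (a * (z - w) + b * conjc (z - w))) <= e * normc (z - w).

Definition strict_at g z0 := exists a b, sdiff g z0 a b.

Lemma wirtinger_le a b z :
  normc (a * z + b * conjc z) <= (normc a + normc b) * normc z.
Proof.
apply: le_trans (normc_triangle _ _) _.
by rewrite !normcM normc_conj mulrDl.
Qed.

Lemma sdiff_near_eq g1 g2 (z0 : R[i]^o) a b :
  (\forall z \near z0, g1 z = g2 z) -> sdiff g1 z0 a b -> sdiff g2 z0 a b.
Proof.
move=> /nbhs_normcP[d1 d10 H1] H e e0; have [d2 d20 H2] := H e e0.
exists (Num.min d1 d2); first by rewrite lt_min d10.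
move=> z w; rewrite !lt_min => /andP[z1 z2] /andP[w1 w2].
by rewrite -H1// -H1//; apply: H2.
Qed.

Lemma strict_near_eq g1 g2 (z0 : R[i]^o) :
  (\forall z \near z0, g1 z = g2 z) -> strict_at g1 z0 -> strict_at g2 z0.
Proof. by move=> H [a [b h]]; exists a, b; apply: sdiff_near_eq H h. Qed.

Lemma sdiff_lipschitz g z0 a b : sdiff g z0 a b ->
  exists2 d : R, 0 < d & forall z w, normc (z - z0) < d -> normc (w - z0) < d ->
    normc (g z - g w) <= (normc a + normc b + 1) * normc (z - w).
Proof.
move=> H; have [d d0 Hd] := H 1 ltr01; exists d => // z w hz hw.
have := Hd _ _ hz hw; have := wirtinger_le a b (z - w).
set l := a * _ + _; have := normc_triangle (g z - g w - l) l.
by rewrite subrK !mulrDl !mul1r; lra.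
Qed.

Lemma sdiff_near g z0 a b : sdiff g z0 a b -> forall e : R, 0 < e ->
  exists2 d : R, 0 < d & forall z, normc (z - z0) < d -> normc (g z - g z0) < e.
Proof.
move=> /sdiff_lipschitz[d d0 H] e e0.
set K := normc a + normc b + 1 in H.
have K0 : 0 < K by rewrite /K; have := normc_ge0 a; have := normc_ge0 b; lra.
exists (Num.min d (e / K)); first by rewrite lt_min d0 divr_gt0.
move=> z; rewrite lt_min => /andP[z1]; rewrite ltr_pdivlMr// => z2.
by apply: le_lt_trans (H _ _ z1 _) _; rewrite ?subrr ?normc0// mulrC.
Qed.

Lemma strict_cst k z0 : strict_at (fun=> k) z0.
Proof.
exists 0, 0 => e e0; exists 1 => // z w _ _.
by rewrite subrr !mul0r addr0 subrr normc0 mulr_ge0 ?normc_ge0// ltW.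
Qed.

Lemma strictD g1 g2 z0 : strict_at g1 z0 -> strict_at g2 z0 ->
  strict_at (fun z => g1 z + g2 z) z0.
Proof.
move=> [a1 [b1 H1]] [a2 [b2 H2]]; exists (a1 + a2), (b1 + b2) => e e0.
have e20 : 0 < e / 2 by rewrite divr_gt0.
have [d1 d10 K1] := H1 _ e20; have [d2 d20 K2] := H2 _ e20.
exists (Num.min d1 d2); first by rewrite lt_min d10.
move=> z w; rewrite !lt_min => /andP[z1 z2] /andP[w1 w2].
have := K1 _ _ z1 w1; have := K2 _ _ z2 w2.
set u1 := g1 z - _ - _; set u2 := g2 z - _ - _.
have := normc_triangle u1 u2.
have -> : u1 + u2 = g1 z + g2 z - (g1 w + g2 w)
   - ((a1 + a2) * (z - w) + (b1 + b2) * conjc (z - w)) by rewrite /u1 /u2; ring.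
lra.
Qed.

Lemma strictM g1 g2 z0 : strict_at g1 z0 -> strict_at g2 z0 ->
  strict_at (fun z => g1 z * g2 z) z0.
Proof.
move=> [a1 [b1 H1]] [a2 [b2 H2]].
exists (g1 z0 * a2 + g2 z0 * a1), (g1 z0 * b2 + g2 z0 * b1) => e e0.
set N1 := normc (g1 z0); set N2 := normc (g2 z0).
set M := normc a1 + normc b1; set M2 := normc a2 + normc b2 + 1.
have nge := @normc_ge0 R.
have N10 : 0 <= N1 := nge _. have N20 : 0 <= N2 := nge _.
have M0 : 0 <= M by rewrite addr_ge0.
have M20 : 0 < M2 by rewrite /M2; have := nge a2; have := nge b2; lra.
pose k := N1 + N2 + M + M2 + 1; have k0 : 0 < k by rewrite /k; lra.
(* The bound 1 keeps |g2 w| below N2 + 1. The other bound serves the four error terms below, whose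
   coefficients add up to exactly k, so that together they stay below e/2. *)
pose e1 := Num.min 1 (e / (2 * k)).
have e10 : 0 < e1 by rewrite lt_min ltr01 divr_gt0// mulr_gt0.
have [d1 d10 K1] := H1 _ e10; have [d2 d20 K2] := H2 _ e10.
have [d3 d30 K3] := sdiff_near H1 e10; have [d4 d40 K4] := sdiff_near H2 e10.
have [d5 d50 K5] := sdiff_lipschitz H2.
exists (Num.min d1 (Num.min d2 (Num.min d3 (Num.min d4 d5)))).
  by rewrite !lt_min d10 d20 d30 d40 d50.
move=> z w; rewrite !lt_min.
move=> /andP[z1 /andP[z2 /andP[z3 /andP[z4 z5]]]].
move=> /andP[w1 /andP[w2 /andP[w3 /andP[w4 w5]]]].
have := K1 _ _ z1 w1; have := K2 _ _ z2 w2; have := K3 _ z3; have := K4 _ w4.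
have := K5 _ _ z5 w5; have := wirtinger_le a1 b1 (z - w).
rewrite -/M -/M2.
set l1 := a1 * _ + _; set u1 := g1 z - g1 w - _; set u2 := g2 z - g2 w - _.
set v := normc (z - w).
move=> hl1 hg2 h4 h3 h2 h1.
have -> : g1 z * g2 z - g1 w * g2 w - ((g1 z0 * a2 + g2 z0 * a1) * (z - w) +
  (g1 z0 * b2 + g2 z0 * b1) * conjc (z - w)) =
  (g1 z0 * u2 + (g1 z - g1 z0) * (g2 z - g2 w)) + (g2 w * u1 + (g2 w - g2 z0) * l1).
  by rewrite /u1 /u2 /l1; ring.
apply: le_trans (normc_triangle _ _) _.
have v0 : 0 <= v := nge _.
have T1 : normc (g1 z0 * u2 + (g1 z - g1 z0) * (g2 z - g2 w))
    <= e1 * (N1 + M2) * v.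
  apply: le_trans (normc_triangle _ _) _; rewrite !normcM -/N1.
  have A1 := ler_wpM2l N10 h2.
  have A2 := ler_pM (nge _) (nge _) (ltW h3) hg2.
  by apply: le_trans (lerD A1 A2) _; rewrite le_eqVlt; apply/orP; left; apply/eqP; ring.
have T2 : normc (g2 w * u1 + (g2 w - g2 z0) * l1) <= e1 * (N2 + 1 + M) * v.
  apply: le_trans (normc_triangle _ _) _; rewrite !normcM.
  have B : normc (g2 w) <= N2 + 1.
    have := normc_triangle (g2 w - g2 z0) (g2 z0); rewrite subrK -/N2.
    have : e1 <= 1 by rewrite ge_min lexx.
    by move: h4; lra.
  have A1 := ler_pM (nge _) (nge _) B h1.
  have A2 := ler_pM (nge _) (nge _) (ltW h4) hl1.
  by apply: le_trans (lerD A1 A2) _; rewrite le_eqVlt; apply/orP; left; apply/eqP; ring.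
apply: le_trans (lerD T1 T2) _; rewrite -mulrDl -mulrDr ler_wpM2r//.
apply: (@le_trans _ _ (e1 * k)); first by rewrite ler_wpM2l ?(ltW e10)// /k; lra.
apply: (@le_trans _ _ (e / (2 * k) * k)).
  by rewrite ler_wpM2r ?(ltW k0)// ge_min lexx orbT.
have -> : e / (2 * k) * k = e / 2 by field; rewrite gt_eqF.
lra.
Qed.

Lemma strict_comp g1 g2 z0 : strict_at g1 (g2 z0) -> strict_at g2 z0 ->
  strict_at (fun z => g1 (g2 z)) z0.
Proof.
move=> [a1 [b1 H1]] [a2 [b2 H2]].
(* The chain rule in Wirtinger form: substitute u = a2 v + b2 conj v into a1 u + b1 conj u. *)
exists (a1 * a2 + b1 * conjc b2), (a1 * b2 + b1 * conjc a2) => e e0.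
have nge := @normc_ge0 R.
have [dL dL0 KL] := sdiff_lipschitz H2.
set M := normc a1 + normc b1; set K := normc a2 + normc b2 + 1.
have M0 : 0 <= M by rewrite addr_ge0.
have K0 : 0 < K by rewrite /K; have := nge a2; have := nge b2; lra.
have e10 : 0 < e / (2 * K) by rewrite divr_gt0// mulr_gt0.
have e20 : 0 < e / (2 * (M + 1)) by rewrite divr_gt0// mulr_gt0//; lra.
have [d1 d10 K1] := H1 _ e10; have [d2 d20 K2] := H2 _ e20.
have [d3 d30 K3] := sdiff_near H2 d10.
exists (Num.min dL (Num.min d2 d3)); first by rewrite !lt_min dL0 d20 d30.
move=> z w; rewrite !lt_min => /andP[zL /andP[z2 z3]] /andP[wL /andP[w2 w3]].
have := K1 _ _ (K3 _ z3) (K3 _ w3); have := K2 _ _ z2 w2; have := KL _ _ zL wL.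
set v := normc (z - w); set u2 := g2 z - g2 w - _; set u1 := g1 _ - _ - _.
move=> hL h2 h1.
have -> : g1 (g2 z) - g1 (g2 w) - ((a1 * a2 + b1 * conjc b2) * (z - w) +
   (a1 * b2 + b1 * conjc a2) * conjc (z - w)) = u1 + (a1 * u2 + b1 * conjc u2).
  by rewrite /u1 /u2 !(rmorphB, rmorphD, rmorphM) /= !conjcK; ring.
apply: le_trans (normc_triangle _ _) _.
have := wirtinger_le a1 b1 u2; rewrite -/M => hM.
have A1 : e / (2 * K) * normc (g2 z - g2 w) <= e / 2 * v.
  have -> : e / 2 * v = e / (2 * K) * (K * v) by field; rewrite gt_eqF.
  by rewrite ler_wpM2l// ltW.
have A2 : M * normc u2 <= e / 2 * v.
  apply: (@le_trans _ _ ((M + 1) * (e / (2 * (M + 1)) * v))).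
    by apply: ler_pM => //; lra.
  have -> : (M + 1) * (e / (2 * (M + 1)) * v) = e / 2 * v.
    by field; rewrite gt_eqF//; lra.
  by [].
lra.
Qed.

(** The mean value theorem replaces the increment by a value of the derivative, which is within e of
    p. Both endpoints are free, as strict differentiability requires. *)
Lemma mean_value_strict (phi : R -> R) (c d p e s t : R) :
  (forall r, `|r - c| < d -> derivable phi r 1 /\ `|'D_1 phi r - p| <= e) ->
  `|s - c| < d -> `|t - c| < d -> `|phi s - phi t - p * (s - t)| <= e * `|s - t|.
Proof.
move=> H; wlog st : s t / t <= s.
  move=> W hs ht; have [ts|/ltW st] := leP t s; first exact: W.
  have := W t s st ht hs; rewrite (distrC t s).
  have -> : phi s - phi t - p * (s - t) = - (phi t - phi s - p * (t - s)) by ring.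
  by rewrite normrN.
move=> hs ht.
have near r : t <= r <= s -> `|r - c| < d.
  move: hs ht; rewrite !ltr_norml => /andP[? ?] /andP[? ?] /andP[? ?].
  by apply/andP; split; lra.
have drv r : r \in `]t, s[%R -> is_derive r 1 phi ('D_1 phi r).
  rewrite in_itv /= => /andP[h1 h2]; apply: DeriveDef => //.
  by have [] := H r (near r _); rewrite // !ltW.
have cont : {within `[t, s], continuous phi}.
  apply: continuous_in_subspaceT => r; rewrite inE /= in_itv /= => hr.
  have [h _] := H r (near r hr).
  by apply: differentiable_continuous; apply/derivable1_diffP.
have [r rI ->] := MVT_segment st drv cont.
have [_ h] : derivable phi r 1 /\ `|'D_1 phi r - p| <= e.
  by apply: H; apply: near; move: rI; rewrite in_itv.
by rewrite -mulrBl normrM ler_wpM2r.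
Qed.

Lemma nbhs_rowP (x0 : 'rV[R]_2) (P : set 'rV[R]_2) : nbhs x0 P ->
  exists2 d : R, 0 < d & forall x : 'rV[R]_2, (forall i, `|x 0 i - x0 0 i| < d) -> P x.
Proof.
move=> /nbhs_ballP[d d0 H]; exists d => // x hx; apply: H.
by split=> // i j; rewrite /ball /= (ord1 i) distrC; apply: hx.
Qed.

Lemma ord2P (Q : 'I_2 -> Prop) : Q 0 -> Q 1 -> forall i, Q i.
Proof.
move=> h0 h1 [[|[|//]]] hi.
- by rewrite (_ : Ordinal hi = 0)//; apply: val_inj.
- by rewrite (_ : Ordinal hi = 1)//; apply: val_inj.
Qed.

Lemma toR2_0 z : toR2 z 0 0 = complex.Re z. Proof. by rewrite mxE. Qed.
Lemma toR2_1 z : toR2 z 0 1 = complex.Im z. Proof. by rewrite mxE. Qed.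

Lemma toR2K : cancel (@toR2 R) (@toC R).
Proof. by case=> x y; rewrite /toC toR2_0 toR2_1. Qed.

Lemma toCK : cancel (@toC R) (@toR2 R).
Proof. by move=> x; apply/rowP; apply: ord2P; rewrite mxE. Qed.

(** The increment from w to z is split along a vertical and a horizontal segment, with
    [mean_value_strict] applied on each. Both stay in a coordinate square around x0 on which the
    partial derivatives differ by at most e/2 from their values at x0. *)
Lemma C1_strict (g : 'rV[R]_2 -> R) (x0 : 'rV[R]_2) :
  (forall i, (\forall x \near x0, derivable g x (delta_mx 0 i)) /\
             {for x0, continuous (partial i g)}) ->
  strict_at (fun z => (g (toR2 z))%:C) (toC x0).
Proof.
move=> H; set p := partial 0 g x0; set q := partial 1 g x0.
(* The Wirtinger derivatives of g with respect to z and to conj z. *)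
exists ((p -i* q) / 2), ((p +i* q) / 2) => e e0.
have e20 : 0 < e / 2 by rewrite divr_gt0.
have nb i : \forall x \near x0, derivable g x (delta_mx 0 i) /\
    `|partial i g x - partial i g x0| <= e / 2.
  have [h1 /cvgr_dist_le/(_ _ e20) h2] := H i.
  by near=> x; split; [near: x|rewrite distrC; near: x].
have [d0 d00 K0] := nbhs_rowP (nb 0); have [d1 d10 K1] := nbhs_rowP (nb 1).
exists (Num.min d0 d1); first by rewrite lt_min d00.
move=> z w.
have -> : (g (toR2 z))%:C - (g (toR2 w))%:C -
   ((p -i* q) / 2 * (z - w) + (p +i* q) / 2 * conjc (z - w))
   = (g (toR2 z) - g (toR2 w) - (p * (complex.Re z - complex.Re w)
        + q * (complex.Im z - complex.Im w)))%:C.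
  have -> : (p -i* q) / 2 * (z - w) + (p +i* q) / 2 * conjc (z - w) =
      ((p -i* q) * (z - w) + (p +i* q) * conjc (z - w)) / 2 by field.
  have -> : (p -i* q) * (z - w) + (p +i* q) * conjc (z - w) =
      (p * (complex.Re z - complex.Re w) + q * (complex.Im z - complex.Im w))%:C * 2.
    apply/eqP; rewrite mulr_natr mulr2n; case: z w => x y [x' y'].
    by rewrite eq_complex /=; apply/andP; split; apply/eqP; ring.
  by rewrite mulfK ?pnatr_eq0// -!rmorphB.
rewrite normc_real.
have [hz0 hz1] := (norm_Re_le (z - toC x0), norm_Im_le (z - toC x0)).
have [hw0 hw1] := (norm_Re_le (w - toC x0), norm_Im_le (w - toC x0)).
have [hv0 hv1] := (norm_Re_le (z - w), norm_Im_le (z - w)).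
move=> hz hw.
have {hz0} hz0 := le_lt_trans hz0 hz; have {hz1} hz1 := le_lt_trans hz1 hz.
have {hw0} hw0 := le_lt_trans hw0 hw; have {hw1} hw1 := le_lt_trans hw1 hw.
move: hv0 hv1; clear hz hw.
case: z hz0 hz1 => x1 y1; case: w hw0 hw1 => x2 y2; rewrite /toC /=.
rewrite !lt_min => /andP[X20 X21] /andP[Y20 Y21] /andP[X10 X11] /andP[Y10 Y11].
set v := Num.sqrt _ => hv0 hv1.
pose phi0 (t : R) := g (toR2 (t +i* y1)); pose phi1 (t : R) := g (toR2 (x2 +i* t)).
have row0 (h t y : R) : h *: delta_mx 0 0 + toR2 (t +i* y) = toR2 ((h *: (1:R^o) + t) +i* y).
  by apply/rowP; apply: ord2P; rewrite !mxE /= /GRing.scale /= ?mulr1 ?mulr0 ?add0r.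
have row1 (h t x : R) : h *: delta_mx 0 1 + toR2 (x +i* t) = toR2 (x +i* (h *: (1:R^o) + t)).
  by apply/rowP; apply: ord2P; rewrite !mxE /= /GRing.scale /= ?mulr1 ?mulr0 ?add0r.
have E0 t : (fun h : R => h^-1 *: ((phi0 \o shift t) (h *: (1:R^o)) - phi0 t)) =
   (fun h : R => h^-1 *: ((g \o shift (toR2 (t +i* y1))) (h *: delta_mx 0 0) - g (toR2 (t +i* y1)))).
  by apply/funext => h; rewrite /= /phi0 row0.
have E1 t : (fun h : R => h^-1 *: ((phi1 \o shift t) (h *: (1:R^o)) - phi1 t)) =
   (fun h : R => h^-1 *: ((g \o shift (toR2 (x2 +i* t))) (h *: delta_mx 0 1) - g (toR2 (x2 +i* t)))).
  by apply/funext => h; rewrite /= /phi1 row1.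
have M0 : `|phi0 x1 - phi0 x2 - p * (x1 - x2)| <= e / 2 * `|x1 - x2|.
  apply: (@mean_value_strict phi0 (x0 0 0) d0) => // t ht.
  have [] := K0 (toR2 (t +i* y1)).
    by apply: ord2P; rewrite ?toR2_0 ?toR2_1.
  by rewrite /derivable /partial /derive E0.
have M1 : `|phi1 y1 - phi1 y2 - q * (y1 - y2)| <= e / 2 * `|y1 - y2|.
  apply: (@mean_value_strict phi1 (x0 0 1) d1) => // t ht.
  have [] := K1 (toR2 (x2 +i* t)).
    by apply: ord2P; rewrite ?toR2_0 ?toR2_1.
  by rewrite /derivable /partial /derive E1.
have -> : g (toR2 (x1 +i* y1)) - g (toR2 (x2 +i* y2)) - (p * (x1 - x2) + q * (y1 - y2))
   = (phi0 x1 - phi0 x2 - p * (x1 - x2)) + (phi1 y1 - phi1 y2 - q * (y1 - y2)).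
  by rewrite /phi0 /phi1; ring.
apply: le_trans (ler_normD _ _) _.
have := ler_wpM2l (ltW e20) hv0; have := ler_wpM2l (ltW e20) hv1.
by move: M0 M1; rewrite -/v; lra.
Unshelve. all: by end_near.
Qed.

End StrictDifferentiability.

(** * Complex derivatives *)

(** Trades the limit of difference quotients for an estimate of the remainder. A general field K
    covers both derivatives over C and derivatives of real functions. *)
Lemma is_derive_nearP (K : numFieldType) (f : K^o -> K^o) (x c : K^o) :
  is_derive x 1 f c <-> forall e : K, 0 < e ->
    \forall y \near x, `|f y - f x - c * (y - x)| <= e * `|y - x|.
Proof.
split=> [[df <-] e e0|H].
  apply/nbhs0P; move/derivable_nbhsP : df => /eqaddoP /(_ e e0).
  apply: filterS => y; rewrite !fctE /cst /= [x + y]addrC addrK => h; move: h.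
  by rewrite /GRing.scale /= mulr1 opprD addrA [y * _]mulrC.
suff h : (fun h => h^-1 *: ((f \o shift x) (h *: (1 : K^o)) - f x)) @ 0^' --> c.
  by apply: DeriveDef; [apply/cvg_ex; exists c|exact: cvg_lim h].
apply/cvgrPdist_le => e e0.
have /nbhs0P h := H e e0.
near=> t.
have t0 : t != 0 by near: t; exact: nbhs_dnbhs_neq.
have : `|f (x + t) - f x - c * (x + t - x)| <= e * `|x + t - x|.
  by near: t; exact: nbhs_dnbhs.
rewrite [x + t]addrC addrK => ht.
rewrite /= /GRing.scale /= mulr1.
have -> : c - t^-1 * (f (t + x) - f x) = - (f (t + x) - f x - c * t) / t.
  by field.
by rewrite normrM normrN normfV ler_pdivrMr ?normr_gt0.
Unshelve. all: by end_near.
Qed.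

Section ComplexDerivative.
Variable R : realType.
Implicit Types (g : R[i] -> R[i]) (a b z w : R[i]).

(** Complex differentiability with real moduli. Unlike in [sdiff], one of the two points is fixed at
    z0, so nothing is said about the derivative at nearby points. *)
Definition cdiff g (z0 : R[i]^o) a := forall e : R, 0 < e ->
  \forall z \near z0, normc (g z - g z0 - a * (z - z0)) <= e * normc (z - z0).

Lemma derivable_cdiff (g : R[i]^o -> R[i]^o) (z : R[i]^o) :
  derivable g z 1 -> cdiff g z ('D_1 g z).
Proof.
move=> /derivableP/is_derive_nearP H e e0.
have := H e%:C; rewrite ltcR => /(_ e0); apply: filterS => y.
by rewrite !normrE -rmorphM lecR.
Qed.

Lemma cdiff_near_eq g1 g2 (z0 : R[i]^o) a :
  (\forall z \near z0, g1 z = g2 z) -> cdiff g1 z0 a -> cdiff g2 z0 a.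
Proof.
move=> E H e e0; have E0 := nbhs_singleton E.
have {}H := H e e0; near=> z.
have <- : g1 z = g2 z by near: z.
by rewrite -E0; near: z.
Unshelve. all: by end_near.
Qed.

Lemma cdiff_ext g1 g2 (z0 : R[i]^o) a : g1 =1 g2 -> cdiff g1 z0 a -> cdiff g2 z0 a.
Proof. by move/funext ->. Qed.

Lemma cdiff_cst k (z0 : R[i]^o) : cdiff (fun=> k) z0 0.
Proof.
move=> e e0. near=> z.
by rewrite subrr mul0r subrr normc0 mulr_ge0 ?normc_ge0// ltW.
Unshelve. all: by end_near.
Qed.

Lemma cdiff_bound g (z0 : R[i]^o) a : cdiff g z0 a -> \forall z \near z0,
  normc (g z - g z0) <= (normc a + 1) * normc (z - z0).
Proof.
move=> /(_ 1 ltr01); apply: filterS => z.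
set u := g z - g z0 - _; have := normc_triangle u (a * (z - z0)).
by rewrite /u subrK normcM mulrDl; lra.
Qed.

Lemma cdiff_continuous g (z0 : R[i]^o) a : cdiff g z0 a ->
  {for z0, continuous (g : R[i]^o -> R[i]^o)}.
Proof.
move=> /cdiff_bound H; apply/continuous_normcP => e e0.
have K0 : 0 < normc a + 1 by have := normc_ge0 a; lra.
have := near_normc z0 (divr_gt0 e0 K0).
move=> K; near=> z.
have h1 : normc (g z - g z0) <= (normc a + 1) * normc (z - z0) by near: z.
have : normc (z - z0) < e / (normc a + 1) by near: z.
by rewrite ltr_pdivlMr// mulrC; exact: le_lt_trans.
Unshelve. all: by end_near.
Qed.

Lemma cdiffD g1 g2 (z0 : R[i]^o) a1 a2 : cdiff g1 z0 a1 -> cdiff g2 z0 a2 ->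
  cdiff (fun z => g1 z + g2 z) z0 (a1 + a2).
Proof.
move=> H1 H2 e e0; have e20 : 0 < e / 2 by rewrite divr_gt0.
have {}H1 := H1 _ e20; have {}H2 := H2 _ e20; near=> z.
have h1 : normc (g1 z - g1 z0 - a1 * (z - z0)) <= e / 2 * normc (z - z0) by near: z.
have h2 : normc (g2 z - g2 z0 - a2 * (z - z0)) <= e / 2 * normc (z - z0) by near: z.
move: h1 h2; set u1 := g1 z - _ - _; set u2 := g2 z - _ - _.
have := normc_triangle u1 u2.
have -> : u1 + u2 = g1 z + g2 z - (g1 z0 + g2 z0) - (a1 + a2) * (z - z0).
  by rewrite /u1 /u2; ring.
lra.
Unshelve. all: by end_near.
Qed.

Lemma cdiffM g1 g2 (z0 : R[i]^o) a1 a2 : cdiff g1 z0 a1 -> cdiff g2 z0 a2 ->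
  cdiff (fun z => g1 z * g2 z) z0 (g1 z0 * a2 + g2 z0 * a1).
Proof.
move=> H1 H2 e e0; have nge := @normc_ge0 R.
set N1 := normc (g1 z0); set N2 := normc (g2 z0); set M := normc a1 + 1.
have N10 : 0 <= N1 := nge _. have N20 : 0 <= N2 := nge _.
have M0 : 0 < M by rewrite /M; have := nge a1; lra.
pose k := N1 + N2 + M; have k0 : 0 < k by rewrite /k; lra.
have e10 : 0 < e / k by rewrite divr_gt0.
have /continuous_normcP/(_ _ e10) C2 := cdiff_continuous H2.
have B1 := cdiff_bound H1.
have {}H1 := H1 _ e10; have {}H2 := H2 _ e10.
near=> z.
have h1 : normc (g1 z - g1 z0 - a1 * (z - z0)) <= e / k * normc (z - z0) by near: z.
have h2 : normc (g2 z - g2 z0 - a2 * (z - z0)) <= e / k * normc (z - z0) by near: z.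
have h3 : normc (g1 z - g1 z0) <= M * normc (z - z0) by near: z.
have h4 : normc (g2 z - g2 z0) <= e / k by apply: ltW; near: z.
have -> : g1 z * g2 z - g1 z0 * g2 z0 - (g1 z0 * a2 + g2 z0 * a1) * (z - z0) =
  (g1 z0 * (g2 z - g2 z0 - a2 * (z - z0)) + g2 z0 * (g1 z - g1 z0 - a1 * (z - z0)))
  + (g1 z - g1 z0) * (g2 z - g2 z0) by ring.
apply: le_trans (normc_triangle _ _) _.
apply: le_trans (lerD (normc_triangle _ _) (lexx _)) _.
rewrite !normcM -/N1 -/N2.
have := ler_wpM2l N10 h2; have := ler_wpM2l N20 h1.
have := ler_pM (nge _) (nge _) h3 h4.
set v := normc (z - z0).
have -> : e * v = N1 * (e / k * v) + N2 * (e / k * v) + M * v * (e / k).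
  have {1}-> : e = e / k * k by field; rewrite gt_eqF.
  by rewrite {2}/k; ring.
lra.
Unshelve. all: by end_near.
Qed.

Lemma cdiff_comp g1 g2 (z0 : R[i]^o) a1 a2 : cdiff g1 (g2 z0) a1 -> cdiff g2 z0 a2 ->
  cdiff (fun z => g1 (g2 z)) z0 (a1 * a2).
Proof.
move=> H1 H2 e e0; have nge := @normc_ge0 R.
set M := normc a1 + 1; set K := normc a2 + 1.
have M0 : 0 < M by rewrite /M; have := nge a1; lra.
have K0 : 0 < K by rewrite /K; have := nge a2; lra.
have e10 : 0 < e / (2 * K) by rewrite divr_gt0// mulr_gt0.
have e20 : 0 < e / (2 * M) by rewrite divr_gt0// mulr_gt0.
have C2 := cdiff_continuous H2 (H1 _ e10).
have B2 := cdiff_bound H2; have {}H2 := H2 _ e20.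
near=> z.
have h1 : normc (g1 (g2 z) - g1 (g2 z0) - a1 * (g2 z - g2 z0))
    <= e / (2 * K) * normc (g2 z - g2 z0) by near: z.
have h2 : normc (g2 z - g2 z0 - a2 * (z - z0)) <= e / (2 * M) * normc (z - z0).
  by near: z.
have h3 : normc (g2 z - g2 z0) <= K * normc (z - z0) by near: z.
have -> : g1 (g2 z) - g1 (g2 z0) - a1 * a2 * (z - z0) =
  (g1 (g2 z) - g1 (g2 z0) - a1 * (g2 z - g2 z0))
  + a1 * (g2 z - g2 z0 - a2 * (z - z0)) by ring.
apply: le_trans (normc_triangle _ _) _; rewrite normcM.
set v := normc (z - z0) in h2 h3 *.
have A1 := ler_wpM2l (ltW e10) h3.
have A1' : e / (2 * K) * (K * v) = e / 2 * v by field; rewrite gt_eqF.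
have h0 : normc a1 <= M by rewrite /M; lra.
have A2 := ler_pM (nge _) (nge _) h0 h2.
have A2' : M * (e / (2 * M) * v) = e / 2 * v by field; rewrite gt_eqF.
lra.
Unshelve. all: by end_near.
Qed.

Lemma cdiff_sum (I : Type) (r : seq I) (P : pred I) (g : I -> R[i] -> R[i])
    (a : I -> R[i]) (z0 : R[i]^o) : (forall i, cdiff (g i) z0 (a i)) ->
  cdiff (fun z => \sum_(i <- r | P i) g i z) z0 (\sum_(i <- r | P i) a i).
Proof.
move=> H; elim: r => [|i r IH].
  apply: (@cdiff_ext (fun=> 0)); last by rewrite big_nil; exact: cdiff_cst.
  by move=> z; rewrite big_nil.
rewrite big_cons; have [Pi|nPi] := boolP (P i).
  apply: (@cdiff_ext (fun z => g i z + \sum_(i <- r | P i) g i z)).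
    by move=> z; rewrite big_cons Pi.
  exact: cdiffD.
apply: (@cdiff_ext (fun z => \sum_(i <- r | P i) g i z)) => //.
by move=> z; rewrite big_cons (negbTE nPi).
Qed.

Lemma cdiff_mulmx (m n p q : nat) (A : 'M[R[i]]_(m, n)) (B : 'M[R[i]]_(p, q))
    (M : R[i] -> 'M[R[i]]_(n, p)) (M' : 'M[R[i]]_(n, p)) (z0 : R[i]^o) :
  (forall i j, cdiff (fun z => M z i j) z0 (M' i j)) ->
  forall i j, cdiff (fun z => (A *m M z *m B) i j) z0 ((A *m M' *m B) i j).
Proof.
move=> H i j.
have cZ k g a : cdiff g z0 a -> cdiff (fun z => k * g z) z0 (k * a).
  move=> h; have := cdiffM (cdiff_cst k z0) h.
  by rewrite mulr0 addr0.
rewrite mxE (eq_bigr (fun l => B l j * \sum_k A i k * M' k l)); last first.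
  by move=> l _; rewrite mxE mulrC.
apply: (@cdiff_ext (fun z => \sum_l B l j * \sum_k A i k * M z k l)).
  move=> z; rewrite mxE; apply: eq_bigr => l _.
  by rewrite mxE mulrC.
by apply: cdiff_sum => l; apply: (cZ); apply: cdiff_sum => k; apply: (cZ).
Qed.

(* Testing the differential on u and 'i u separates the two Wirtinger parts. *)
Lemma sdiff_cdiff g p (z0 : R[i]^o) a b c d :
  sdiff g (p z0) a b -> cdiff p z0 c -> cdiff (fun z => g (p z)) z0 d ->
  a * c = d /\ b * conjc c = 0.
Proof.
move=> Hg Hp Hgp; have nge := @normc_ge0 R.
(* The increment of g o p along t u is expanded twice, directly and through p. The two linear parts
   differ by at most a constant times e t, for every e. *)
have key u : normc u = 1 -> a * (c * u) + b * conjc (c * u) - d * u = 0.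
  move=> u1.
  pose M := normc a + normc b; have M0 : 0 <= M by rewrite addr_ge0.
  pose K := normc c + 1; have K0 : 0 < K by rewrite /K; have := nge c; lra.
  apply: (@eps_normc_eq0 _ _ (K + M + 1)); first lra.
  move=> e e0; have [dl dl0 Hd] := Hg e e0.
  have /nbhs_normcP[d1 d10 N1] := Hp _ e0.
  have /nbhs_normcP[d2 d20 N2] := Hgp _ e0.
  have /nbhs_normcP[d3 d30 N3] := cdiff_bound Hp.
  have /continuous_normcP/(_ _ dl0)/nbhs_normcP[d4 d40 N4] := cdiff_continuous Hp.
  pose t := Num.min d1 (Num.min d2 (Num.min d3 d4)) / 2.
  have t0 : 0 < t by rewrite divr_gt0// !lt_min d10 d20 d30.
  have : t < Num.min d1 (Num.min d2 (Num.min d3 d4)).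
    by rewrite /t ltr_pdivrMr// ltr_pMr ?ltr1n// !lt_min d10 d20 d30.
  rewrite !lt_min => /andP[t1 /andP[t2 /andP[t3 t4]]].
  clearbody t; have tu : normc (z0 + t%:C * u - z0) = t.
    by rewrite addrC addKr normcM u1 mulr1 normc_real gtr0_norm.
  move: N1 N2 N3 N4 => /(_ (z0 + t%:C * u)) + /(_ (z0 + t%:C * u)) +
     /(_ (z0 + t%:C * u)) + /(_ (z0 + t%:C * u)).
  rewrite tu => /(_ t1) n1 /(_ t2) n2 /(_ t3) n3 /(_ t4) n4.
  have := Hd _ (p z0) n4; rewrite subrr normc0 => /(_ dl0) n0.
  set z1 := z0 + _ in n0 n1 n2 n3 n4.
  set E1 := p z1 - p z0 - _ in n1; set E2 := g (p z1) - _ - _ in n2.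
  set E0 := g _ - _ - _ in n0.
  have E : t%:C * (a * (c * u) + b * conjc (c * u) - d * u) =
      E2 - E0 - (a * E1 + b * conjc E1).
    rewrite /E2 /E0 /E1.
    have -> : z1 - z0 = t%:C * u by rewrite /z1 addrC addKr.
    by rewrite !(conjcB, conjcM) conjc_real; ring.
  have : t * normc (a * (c * u) + b * conjc (c * u) - d * u) <= t * (e * (K + M + 1)).
    rewrite -{1}(gtr0_norm t0) -normc_real -normcM E.
    have := normc_triangle (E2 - E0) (- (a * E1 + b * conjc E1)).
    have := normc_triangle E2 (- E0); rewrite !normc_opp.
    have := wirtinger_le a b E1; rewrite -/M.
    have := ler_wpM2l M0 n1.
    have := ler_wpM2l (ltW e0) n3; rewrite -/K.
    have -> : t * (e * (K + M + 1)) = e * (K * t) + M * (e * t) + e * t by ring.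
    lra.
  by rewrite ler_pM2l.
have := key 1 (normc1 R); rewrite !mulr1 => k1.
have ni : normc 'i%C = 1 :> R by rewrite /= expr0n expr1n add0r sqrtr1.
have := key 'i%C ni; rewrite conjcM.
have -> : conjc 'i%C = - 'i%C :> R[i] by simpc.
move=> ki.
have i0 : 'i%C != 0 :> R[i] by rewrite eq_complex /= oner_eq0 andbF.
have {ki} : 'i%C * (a * c - b * conjc c - d) = 0 by rewrite -[RHS]ki; ring.
move=> /eqP; rewrite mulf_eq0 (negbTE i0) /= => /eqP ki.
have n2 : 2 != 0 :> R[i] by rewrite pnatr_eq0.
split; apply: (mulfI n2).
  apply/eqP; rewrite -subr_eq0; apply/eqP.
  have -> : 2 * (a * c) - 2 * d = (a * c + b * conjc c - d) + (a * c - b * conjc c - d).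
    by ring.
  by rewrite k1 ki addr0.
have -> : 2 * (b * conjc c) = (a * c + b * conjc c - d) - (a * c - b * conjc c - d).
  by ring.
by rewrite k1 ki subr0 mulr0.
Qed.

Lemma real_derive_nearP (f : R -> R) (x c : R) :
  is_derive x (1:R) f c <-> forall e : R, 0 < e ->
    \forall y \near x, `|f y - f x - c * (y - x)| <= e * `|y - x|.
Proof. exact: (@is_derive_nearP R f x c). Qed.

Definition vdiff (Z : R -> R[i]) (t : R) (c : R[i]) := forall e : R, 0 < e ->
  \forall s \near t, normc (Z s - Z t - c * (s - t)%:C) <= e * `|s - t|.

Lemma vdiffP (Z : R -> R[i]) (t : R) (c : R[i]) : vdiff Z t c <->
  is_derive t (1:R) (fun s => complex.Re (Z s)) (complex.Re c) /\
  is_derive t (1:R) (fun s => complex.Im (Z s)) (complex.Im c).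
Proof.
have E s : Z s - Z t - c * (s - t)%:C =
   (complex.Re (Z s) - complex.Re (Z t) - complex.Re c * (s - t)) +i*
   (complex.Im (Z s) - complex.Im (Z t) - complex.Im c * (s - t)).
  by case: (Z s) (Z t) c => a b [a' b'] [a'' b'']; simpc.
split=> [H|[/real_derive_nearP H1 /real_derive_nearP H2] e e0].
  split; apply/real_derive_nearP => e e0; apply: filterS (H e e0) => s; rewrite E.
    by apply: le_trans; exact: (norm_Re_le (_ +i* _)).
  by apply: le_trans; exact: (norm_Im_le (_ +i* _)).
have e20 : 0 < e / 2 by rewrite divr_gt0.
apply: filterS2 (H1 _ e20) (H2 _ e20) => s h1 h2; rewrite E.
apply: le_trans (normc_le_ReIm _) _.
by rewrite [X in X + _]/= [X in _ + X]/=; lra.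
Qed.

(** On the segment from z0 to z, the real and imaginary parts of g are real functions with zero
    derivative, so the mean value theorem equates their values at the two ends. *)
Lemma cdiff0_constant (g : R[i] -> R[i]) (z0 : R[i]) (d : R) :
  (forall z, normc (z - z0) < d -> cdiff g z 0) ->
  forall z, normc (z - z0) < d -> g z = g z0.
Proof.
move=> H z hz; set u := z - z0 in hz.
pose Z (t : R) := g (z0 + t%:C * u).
have VZ (t : R) : 0 <= t <= 1 -> vdiff Z t 0.
  move=> /andP[t0 t1] e e0.
  have hd : normc (z0 + t%:C * u - z0) < d.
    rewrite addrC addKr normcM normc_real ger0_norm//.
    by apply: le_lt_trans hz; rewrite ler_piMl// normc_ge0.
  have K0 : 0 < normc u + 1 by have := normc_ge0 u; lra.
  have := H _ hd (e / (normc u + 1)); rewrite divr_gt0// => /(_ isT).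
  move=> /nbhs_normcP[dl dl0 Hd].
  have dk : 0 < dl / (normc u + 1) by rewrite divr_gt0.
  near=> s; rewrite mul0r subr0.
  have st : `|s - t| < dl / (normc u + 1).
    by rewrite distrC; near: s; apply: nbhsx_ballx.
  have E : z0 + s%:C * u - (z0 + t%:C * u) = (s - t)%:C * u by rewrite rmorphB; ring.
  have B : normc (z0 + s%:C * u - (z0 + t%:C * u)) <= `|s - t| * (normc u + 1).
    by rewrite E normcM normc_real ler_wpM2l// lerDl.
  have := Hd (z0 + s%:C * u).
  rewrite mul0r subr0 => /(_ _)/le_trans; apply.
    by apply: le_lt_trans B _; rewrite -ltr_pdivlMr.
  have -> : e * `|s - t| = e / (normc u + 1) * (`|s - t| * (normc u + 1)).
    by field; rewrite gt_eqF.
  by rewrite ler_wpM2l// divr_ge0// ltW.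
have cst (phi : R -> R) : (forall t : R, 0 <= t <= 1 -> is_derive t (1:R) phi 0) ->
    phi 1 = phi 0.
  move=> D; have drv (t : R) : t \in `]0, 1[%R -> is_derive t (1:R) phi 0.
    by rewrite in_itv /= => /andP[? ?]; apply: D; rewrite !ltW.
  have cont : {within `[0, 1], continuous phi}.
    apply: continuous_in_subspaceT => r; rewrite inE /= in_itv /= => hr.
    have [h _] := D r hr.
    by apply: differentiable_continuous; apply/derivable1_diffP.
  have [t _] := MVT_segment ler01 drv cont.
  by rewrite mul0r => /eqP; rewrite subr_eq0 => /eqP.
have R1 := cst _ (fun t ht => proj1 ((vdiffP Z t 0).1 (VZ t ht))).
have R2 := cst _ (fun t ht => proj2 ((vdiffP Z t 0).1 (VZ t ht))).
have : Z 1 = Z 0 by move: R1 R2; case: (Z 1) (Z 0) => a b [a' b'] /= -> ->.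
by rewrite /Z mul1r mul0r addr0 addrC subrK.
Unshelve. all: by end_near.
Qed.

End ComplexDerivative.

(** * Local inverses *)

Section LocalInverse.
Variable R : realType.

Lemma continuous_toC (v : 'rV[R]_2) : {for v, continuous (@toC R)}.
Proof.
apply/continuous_normcP => e e0; have e20 : 0 < e / 2 by rewrite divr_gt0.
near=> w; apply: le_lt_trans (normc_le_ReIm _) _; rewrite /toC /=.
have [_ h] : ball v (e / 2) w by near: w; apply: nbhsx_ballx.
by have := h 0 0; have := h 0 1; rewrite /ball /= ![`|v _ _ - _|]distrC; lra.
Unshelve. all: by end_near.
Qed.

Lemma continuous_normc (z : R[i]^o) : {for z, continuous (@normc R : R[i]^o -> R)}.
Proof.
move=> P /nbhs_ballP[e e0 H]; apply/nbhs_normcP; exists e => // w hw.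
apply: H; rewrite /ball /= distrC; exact: le_lt_trans (normc_le_dist _ _) hw.
Qed.

(* A minimum z1 of |g - y| over a square with y <> g z1 could be lowered by
   moving z1 by - t (g z1 - y) / a. *)
Lemma sdiff_local_inverse (g : R[i] -> R[i]) (z0 a : R[i]) (d0 : R) :
  a != 0 -> 0 < d0 -> sdiff g z0 a 0 ->
  exists r k : R, exists f : R[i] -> R[i], [/\ 0 < r, 0 < k, f (g z0) = z0,
    (forall y, normc (y - g z0) < r -> normc (f y - z0) < d0 /\ g (f y) = y)
  & forall y y', normc (y - g z0) < r -> normc (y' - g z0) < r ->
      normc (f y - f y') <= k * normc (y - y')].
Proof.
move=> a0 d00 Hg; have na := normc_gt0 a0; have nge := @normc_ge0 R.
(* With accuracy |a|/2 the linear part dominates the error, and g is bi-Lipschitz near z0. *)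
have e0 : 0 < normc a / 2 by rewrite divr_gt0.
have [d1 d10 Hd] := Hg _ e0.
have {}Hd z w : normc (z - z0) < d1 -> normc (w - z0) < d1 ->
    normc (g z - g w - a * (z - w)) <= normc a / 2 * normc (z - w).
  by move=> hz hw; have := Hd z w hz hw; rewrite mul0r addr0.
have lower z w : normc (z - z0) < d1 -> normc (w - z0) < d1 ->
    normc a / 2 * normc (z - w) <= normc (g z - g w).
  move=> hz hw; have := Hd z w hz hw; set u := g z - g w.
  have := normc_triangle (- (u - a * (z - w))) u; rewrite normc_opp.
  have -> : - (u - a * (z - w)) + u = a * (z - w) by ring.
  by rewrite normcM; lra.
have upper z w : normc (z - z0) < d1 -> normc (w - z0) < d1 ->
    normc (g z - g w) <= 2 * normc a * normc (z - w).
  move=> hz hw; have := Hd z w hz hw; set u := g z - g w.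
  have := normc_triangle (u - a * (z - w)) (a * (z - w)); rewrite subrK normcM.
  have := mulr_ge0 (ltW na) (nge (z - w)); lra.
have [rho rho0 /andP[rho1 rho2]] : exists2 rho : R, 0 < rho & (2 * rho < d1) && (2 * rho < d0).
  exists (Num.min d1 d0 / 4); first by rewrite divr_gt0// lt_min d10.
  have -> : 2 * (Num.min d1 d0 / 4) = Num.min d1 d0 / 2 by field.
  rewrite -lt_min ltr_pdivrMr// ltr_pMr ?ltr1n//.
  by rewrite lt_min d10.
(* At distance at least rho from z0, [lower] gives |g - g z0| >= 2 r, so |g - y| > r there, whereas
   |g z0 - y| < r. A minimum of |g - y| over the square thus lies in the open disc of radius rho. *)
pose r := normc a * rho / 4; have r0 : 0 < r by rewrite divr_gt0// mulr_gt0.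
have sol y : normc (y - g z0) < r -> exists z, normc (z - z0) < rho /\ g z = y.
  move=> hy.
  pose Q : set 'rV[R]_2 := [set v | forall i, `[toR2 z0 0 i - rho, toR2 z0 0 i + rho]%classic (v 0 i)].
  have cQ : compact Q.
    by apply: (@rV_compact _ _ (fun i => `[toR2 z0 0 i - rho, toR2 z0 0 i + rho]%classic)) => i;
       exact: segment_compact.
  have QP v : Q v <-> `|complex.Re (toC v) - complex.Re z0| <= rho /\
                      `|complex.Im (toC v) - complex.Im z0| <= rho.
    rewrite /toC /= -toR2_0 -toR2_1; split=> [h|[h1 h2]].
      by have := h 0; have := h 1; rewrite /= !in_itv /= !ler_norml => /andP[? ?] /andP[? ?];
        split; apply/andP; split; lra.
    by apply: ord2P; rewrite /= in_itv /=; move: h1 h2; rewrite !ler_norml => /andP[? ?] /andP[? ?];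
      apply/andP; split; lra.
  have Qd v : Q v -> normc (toC v - z0) < d1.
    move=> /QP[h1 h2]; apply: le_lt_trans rho1; apply: le_trans (normc_le_ReIm _) _.
    by move: h1 h2; rewrite /toC; case: (z0) => x0 y0 /=; lra.
  pose F (v : 'rV[R]_2) : R := normc (g (toC v) - y).
  have cF : {within Q, continuous F}.
    apply: continuous_in_subspaceT => v; rewrite inE => Qv.
    have cg : {for toC v, continuous (fun z : R[i]^o => (g z - y) : R[i]^o)}.
      apply/continuous_normcP => e e1.
      have dv : 0 < d1 - normc (toC v - z0) by rewrite subr_gt0 Qd.
      have K0 : 0 < 2 * normc a by rewrite mulr_gt0.
      near=> z.
      have hz : normc (z - toC v) < d1 - normc (toC v - z0) by near: z; apply: near_normc.
      have hz' : normc (z - toC v) < e / (2 * normc a).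
        by near: z; apply: near_normc; rewrite divr_gt0.
      have -> : g z - y - (g (toC v) - y) = g z - g (toC v) by ring.
      apply: le_lt_trans (upper _ _ _ (Qd _ Qv)) _; last first.
        by rewrite mulrC -ltr_pdivlMr.
      have := normc_triangle (z - toC v) (toC v - z0); rewrite addrA subrK.
      by move: hz; lra.
    apply: (@continuous_comp 'rV[R]_2 R[i]^o R (fun v => (g (toC v) - y) : R[i]^o)
      (@normc R : R[i]^o -> R)).
      exact: (@continuous_comp 'rV[R]_2 R[i]^o R[i]^o (@toC R)
        (fun z : R[i]^o => (g z - y) : R[i]^o) v (@continuous_toC v) cg).
    exact: continuous_normc.
  have Q0 : Q !=set0.
    exists (toR2 z0); apply/QP; rewrite toR2K !subrr normr0.
    by split; exact: ltW.
  have [v1 ] := EVT_min_rV Q0 cQ cF; rewrite inE => Qv1 minF.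
  have Fmin z : `|complex.Re (z - z0)| <= rho -> `|complex.Im (z - z0)| <= rho ->
      normc (g (toC v1) - y) <= normc (g z - y).
    move=> h1 h2; have := minF (toR2 z); rewrite /F toR2K; apply.
    rewrite inE; apply/QP; rewrite toR2K.
    by move: h1 h2; case: (z) (z0) => ? ? [].
  set z1 := toC v1 in Fmin; have z1d : normc (z1 - z0) < d1 by exact: Qd.
  have z0d : normc (z0 - z0) < d1 by rewrite subrr normc0.
  have Fz0 := Fmin z0; rewrite subrr /= normr0 ltW// in Fz0.
  have {}Fz0 := Fz0 isT isT.
  have z1rho : normc (z1 - z0) < rho.
    rewrite ltNge; apply/negP => h.
    have := lower _ _ z1d z0d; have := normc_triangle (g z1 - y) (y - g z0).
    rewrite addrA subrK; have := ler_wpM2l (ltW e0) h.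
    by rewrite normc_distC in hy; move: hy Fz0; rewrite /r (normc_distC y); lra.
  exists z1; split => //.
  apply: contrapT => /eqP; rewrite -subr_eq0 => u0.
  set u := g z1 - y in u0; have nu := normc_gt0 u0.
  pose q := normc u / normc a; have q0 : 0 < q by rewrite divr_gt0.
  (* The second bound keeps z2 in the disc of radius rho. Moving to z2 replaces u by (1 - t) u up to
     an error of t |u| / 2, so the modulus drops strictly. *)
  pose t := Num.min 1 ((rho - normc (z1 - z0)) / q).
  have t0 : 0 < t by rewrite lt_min ltr01 divr_gt0// subr_gt0.
  have t1 : t <= 1 by rewrite ge_min lexx.
  have tq : t * q <= rho - normc (z1 - z0).
    by rewrite -ler_pdivlMr// ge_min lexx orbT.
  clearbody t.
  pose z2 := z1 - t%:C * u / a.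
  have n21 : normc (z2 - z1) = t * q.
    have -> : z2 - z1 = - (t%:C * u / a) by rewrite /z2; ring.
    by rewrite normc_opp !normcM normcV normc_real gtr0_norm// mulrA.
  have z2rho : normc (z2 - z0) <= rho.
    have := normc_triangle (z2 - z1) (z1 - z0); rewrite addrA subrK n21; lra.
  have z2d : normc (z2 - z0) < d1 by lra.
  have := Fmin z2 (le_trans (norm_Re_le _) z2rho) (le_trans (norm_Im_le _) z2rho).
  have := Hd _ _ z2d z1d; rewrite n21.
  have -> : g z2 - g z1 - a * (z2 - z1) = (g z2 - y) - (1 - t)%:C * u.
    rewrite /z2 /u rmorphB; field; exact: a0.
  have := normc_triangle (g z2 - y - (1 - t)%:C * u) ((1 - t)%:C * u).
  rewrite subrK normcM normc_real ger0_norm ?subr_ge0// -/u.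
  have -> : normc a / 2 * (t * q) = t * normc u / 2 by rewrite /q; field; rewrite gt_eqF.
  have := mulr_gt0 t0 nu; rewrite mulrBl mul1r; lra.
have [f fP] : {f : R[i] -> R[i] & forall y, normc (y - g z0) < r ->
    normc (f y - z0) < rho /\ g (f y) = y}.
  apply: (@choice _ _ (fun y z => normc (y - g z0) < r -> normc (z - z0) < rho /\ g z = y)).
  move=> y; have [/sol[z hz]|hy] := pselect (normc (y - g z0) < r); first by exists z.
  by exists z0.
have fd y : normc (y - g z0) < r -> normc (f y - z0) < d1.
  by move=> /fP[h _]; lra.
exists r, (2 / normc a), f; split => //.
- by rewrite divr_gt0.
- have h0 : normc (g z0 - g z0) < r by rewrite subrr normc0.
  have z0d : normc (z0 - z0) < d1 by rewrite subrr normc0.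
  have := lower _ _ (fd _ h0) z0d; rewrite (fP _ h0).2 subrr normc0 => h.
  have : normc (f (g z0) - z0) = 0.
    apply/eqP; rewrite eq_le nge andbT.
    by rewrite -(ler_pM2l e0) mulr0.
  by move=> /eq0_normc/eqP; rewrite subr_eq0 => /eqP.
- by move=> y hy; have [h ->] := fP _ hy; split=> //; lra.
- move=> y y' hy hy'; have := lower _ _ (fd _ hy) (fd _ hy').
  rewrite (fP _ hy).2 (fP _ hy').2 => h.
  by rewrite mulrAC ler_pdivlMr//; lra.
Unshelve. all: by end_near.
Qed.

End LocalInverse.

(** * Curves in C *)

Section CurvesInC.
Variable R : realType.
Implicit Types (Z dZ : R -> R[i]^o).

Lemma continuous_Re (z : R[i]^o) : {for z, continuous (@complex.Re R : R[i]^o -> R)}.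
Proof.
move=> P /nbhs_ballP[e e0 H]; apply/nbhs_normcP; exists e => // w hw.
by apply: H; rewrite /ball /= distrC -raddfB; apply: le_lt_trans (norm_Re_le _) hw.
Qed.

Lemma continuous_Im (z : R[i]^o) : {for z, continuous (@complex.Im R : R[i]^o -> R)}.
Proof.
move=> P /nbhs_ballP[e e0 H]; apply/nbhs_normcP; exists e => // w hw.
by apply: H; rewrite /ball /= distrC -raddfB; apply: le_lt_trans (norm_Im_le _) hw.
Qed.

Lemma cvg_ReIm (T : topologicalType) (g : T -> R[i]^o) (t : T) :
  {for t, continuous (fun s => complex.Re (g s))} ->
  {for t, continuous (fun s => complex.Im (g s))} -> {for t, continuous g}.
Proof.
move=> h1 h2; apply/continuous_normcP => e e0.
have e20 : 0 < e / 2 by rewrite divr_gt0.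
move/cvgr_dist_lt: h1 => /(_ _ e20) h1; move/cvgr_dist_lt: h2 => /(_ _ e20) h2.
near=> s; apply: le_lt_trans (normc_le_ReIm _) _; rewrite !raddfB.
have H1 : `|complex.Re (g t) - complex.Re (g s)| < e / 2 by near: s.
have H2 : `|complex.Im (g t) - complex.Im (g s)| < e / 2 by near: s.
by rewrite !(distrC (_ (g s))); lra.
Unshelve. all: by end_near.
Qed.

Lemma continuous_mulc (T : topologicalType) (g1 g2 : T -> R[i]^o) (t : T) :
  {for t, continuous g1} -> {for t, continuous g2} ->
  {for t, continuous (fun s => (g1 s * g2 s) : R[i]^o)}.
Proof. exact: (@continuousM R[i] T g1 g2 t). Qed.

Lemma vdiff_continuous Z t c : vdiff Z t c -> {for t, continuous Z}.
Proof.
by move=> /vdiffP[[h1 _] [h2 _]]; apply: cvg_ReIm;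
  apply: differentiable_continuous; apply/derivable1_diffP.
Qed.

Lemma vdiff_mull (k : R[i]) Z t c : vdiff Z t c ->
  vdiff (fun s => k * Z s) t (k * c).
Proof.
move=> H e e0; have K0 : 0 < normc k + 1 by have := normc_ge0 k; lra.
have := H _ (divr_gt0 e0 K0); apply: filterS => s.
have -> : k * Z s - k * Z t - k * c * (s - t)%:C = k * (Z s - Z t - c * (s - t)%:C).
  by ring.
rewrite normcM => h.
have hk : normc k <= normc k + 1 by lra.
apply: le_trans (ler_pM (normc_ge0 _) (normc_ge0 _) hk h) _.
rewrite mulrA le_eqVlt; apply/orP; left; apply/eqP; field.
by rewrite gt_eqF.
Qed.

Lemma near_eq_continuous (T U : topologicalType) (f g : T -> U) (t : T) :
  (\forall s \near t, f s = g s) -> {for t, continuous g} -> {for t, continuous f}.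
Proof.
move=> E cg P; have Et := nbhs_singleton E; rewrite /prop_for Et => /cg gP.
by apply: filterS2 E gP => s /= ->.
Qed.

Lemma vdiff_unique (Z : R -> R[i]) t d d' : vdiff Z t d -> vdiff Z t d' -> d = d'.
Proof.
move=> /vdiffP[[_ r1] [_ i1]] /vdiffP[[_ r2] [_ i2]].
move: r1 i1; rewrite r2 i2.
by case: d d' {r2 i2} => x y [x' y'] /= -> ->.
Qed.

Lemma derive1_vdiff (Z : R -> R[i]) t d : vdiff Z t d ->
  derive1 (fun s => complex.Re (Z s)) t = complex.Re d /\
  derive1 (fun s => complex.Im (Z s)) t = complex.Im d.
Proof. by move=> /vdiffP[[_ r1] [_ i1]]; rewrite !derive1E. Qed.

(** Otherwise there is a last time t0 at which Z is at distance at least r from Z 1. After t0 the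
    curve stays where w dominates k |Z'|, so this final piece alone contributes at least k r to the
    integral of w. *)
Lemma small_length_stays_close Z dZ (w : R -> R) (k r : R) :
  (forall t, vdiff Z t (dZ t)) -> continuous dZ -> continuous w ->
  (forall t, 0 <= w t) -> 0 < k -> 0 < r ->
  (forall t, 0 <= t <= 1 -> normc (Z t - Z 1) < r -> k * normc (dZ t) <= w t) ->
  (\int[@lebesgue_measure R]_(t in `[0%R, 1%R]) (w t)%:E < (k * r)%:E)%E ->
  forall t, 0 <= t <= 1 -> normc (Z t - Z 1) < r.
Proof.
move=> DZ cdZ cw w0 k0 r0 kw len t t01; rewrite ltNge; apply/negP => far.
have cZ : continuous Z by move=> s; apply: vdiff_continuous (DZ s).
pose phi (s : R) : R := normc (Z s - Z 1).
have cphi : continuous phi.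
  move=> s; apply: (@continuous_comp _ _ _ (fun s => (Z s - Z 1) : R[i]^o) (@normc R : R[i]^o -> R)).
    by apply: (@continuousB R[i]) => //; [exact: cZ|exact: cst_continuous].
  exact: continuous_normc.
pose B := [set s : R | 0 <= s <= 1 /\ r <= phi s].
have cB : compact B.
  apply: (@subclosed_compact _ B `[0, 1]%classic).
  - have -> : B = `[0, 1]%classic `&` (phi @^-1` [set y | r <= y]).
      by apply/seteqP; split => s /=; rewrite in_itv.
    apply: closedI; first exact: interval_closed.
    apply: closed_comp; last exact: closed_ge.
    by move=> s _; exact: cphi.
  - exact: segment_compact.
  - by move=> s [] /=; rewrite in_itv.
have B0 : B !=set0 by exists t.
have cid : {within B, continuous (@idfun R)}.
  by apply: continuous_subspaceT => s; exact: cvg_id.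
have [t0] := compact_EVT_max B0 cB cid.
rewrite inE => -[/andP[t00 t01'] ft0] maxB.
have after s : t0 < s -> s <= 1 -> phi s < r.
  move=> h1 h2; rewrite ltNge; apply/negP => h3.
  have := maxB s; rewrite inE /= => /(_ _)/le_lt_trans/(_ h1); rewrite ltxx.
  by move=> H; apply/notF/H; split=> //; rewrite h2 andbT ltW// (le_lt_trans t00).
have t0lt1 : t0 < 1.
  rewrite lt_neqAle t01' andbT; apply/eqP => E; move: ft0.
  by rewrite E /phi subrr normc0 leNgt r0.
set v := Z 1 - Z t0.
have nv : r <= normc v by rewrite /v normc_distC.
have nv0 : 0 < normc v by apply: lt_le_trans nv.
(* A linear functional in place of the arc length: Re (u Z') is at most k |Z'|, and integrates over
   [t0, 1] to Re (u v) = k |v|. *)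
pose u : R[i] := (k / normc v)%:C * conjc v.
have nu : normc u = k.
  rewrite /u normcM normc_conj normc_real ger0_norm ?divr_ge0 ?(ltW k0) ?(ltW nv0)//.
  by field; rewrite gt_eqF.
have uv : complex.Re (u * v) = k * normc v.
  have -> : u * v = (k / normc v * normc v ^+ 2)%:C.
    rewrite /u -mulrA [conjc v * v]mulrC -sqr_normc normrE.
    by rewrite -rmorphXn -rmorphM.
  by rewrite /=; field; rewrite gt_eqF.
pose F (s : R) : R := complex.Re (u * Z s); pose f (s : R) : R := complex.Re (u * dZ s).
have cf : continuous f.
  move=> s; apply: (@continuous_comp _ _ _ (fun s => (u * dZ s) : R[i]^o) (@complex.Re R : R[i]^o -> R)).
    by apply: continuous_mulc; [exact: cst_continuous|exact: cdZ].
  exact: continuous_Re.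
have dF s : is_derive s (1 : R) F (f s).
  by have /vdiffP[] := vdiff_mull u (DZ s).
have cF : continuous F.
  by move=> s; have [h _] := dF s; apply: differentiable_continuous; apply/derivable1_diffP.
have dFoo : derivable_oo_LRcontinuous F t0 1.
  split.
  - by move=> s _; have [] := dF s.
  - by apply: cvg_at_right_filter; exact: cF.
  - by apply: cvg_at_left_filter; exact: cF.
have FE : {in `]t0, 1[, F^`()%classic =1 f}.
  by move=> s _; rewrite derive1E; have [_ ->] := dF s.
have cfin : {within `[t0, 1], continuous f} by exact: continuous_subspaceT.
have := continuous_FTC2 t0lt1 cfin dFoo FE.
have intf : (@lebesgue_measure R).-integrable `[t0, 1] (EFin \o f).
  by apply: continuous_compact_integrable => //; exact: segment_compact.
have intw : (@lebesgue_measure R).-integrable `[t0, 1] (EFin \o w).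
  by apply: continuous_compact_integrable; [exact: segment_compact|exact: continuous_subspaceT].
(* At t0 the distance is at least r and [kw] does not apply; the integrands are therefore compared
   on the half-open interval. *)
have sub : `]t0, 1]%classic `<=` `[t0, 1]%classic.
  by apply: subset_itv; rewrite bnd_simp.
have intf' : (@lebesgue_measure R).-integrable `]t0, 1] (EFin \o f).
  by apply: integrableS intf.
have intw' : (@lebesgue_measure R).-integrable `]t0, 1] (EFin \o w).
  by apply: integrableS intw.
rewrite -integral_itv_obnd_cbnd; last by have [] := integrableP _ _ _ intf'.
move=> E.
have le1 : (\int[@lebesgue_measure R]_(s in `]t0, 1%R]) (f s)%:E <=
            \int[@lebesgue_measure R]_(s in `]t0, 1%R]) (w s)%:E)%E.
  apply: le_integral => // s; rewrite inE /= in_itv /= => /andP[h1 h2].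
  rewrite lee_fin; apply: le_trans (kw s _ (after s h1 h2)); last first.
    by rewrite h2 andbT ltW// (le_lt_trans t00).
  apply: le_trans (ler_norm _) _; apply: le_trans (norm_Re_le _) _.
  by rewrite normcM nu.
have le2 : (\int[@lebesgue_measure R]_(s in `]t0, 1%R]) (w s)%:E <=
            \int[@lebesgue_measure R]_(s in `[0%R, 1%R]) (w s)%:E)%E.
  apply: ge0_subset_integral => //.
  - apply/measurable_EFinP; apply: measurable_funS (continuous_measurable_fun cw) => //.
  - by move=> s _; rewrite lee_fin.
  - by apply: subset_itv; rewrite bnd_simp.
have := le_lt_trans (le_trans le1 le2) len; rewrite E -EFinB lte_fin /F.
have -> : complex.Re (u * Z 1) - complex.Re (u * Z t0) = k * normc v.
  by rewrite -uv /v mulrBr raddfB.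
by rewrite ltr_pM2l// ltNge nv.
Qed.

End CurvesInC.

(** * Lifting segments *)

Section LocalBiholomorphism.
Variables (R : realType) (S : topologicalType) (J : S -> chart S R[i]^o).
(** [a p x] is the derivative of G at x in the coordinate [J p]. The last hypothesis says that h
    |dz|^2 is the pull-back by G of the metric lam^2 |dv|^2. *)
Variables (h : S -> R) (G : S -> R[i]^o) (a : S -> S -> R[i]^o) (lam : R[i]^o -> R).
Hypothesis haus : hausdorff_space S.
Hypothesis atlasJ : is_atlas J.
Hypothesis a_neq0 : forall p x, dom (J p) x -> a p x != 0.
Hypothesis G_sdiff : forall p x, dom (J p) x ->
  sdiff (fun z => G (chinv (J p) z)) (J p x) (a p x) 0.
Hypothesis lam_gt0 : forall p, 0 < lam (G p).
Hypothesis lam_cont : forall p, {for G p, continuous lam}.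
Hypothesis hE : forall p, h p = lam (G p) ^+ 2 * sqmod (a p p).

Lemma near_dom p x : dom (J p) x -> \forall y \near x, dom (J p) y.
Proof. by move=> px; have [[oD _ _ _ _] _] := atlasJ p; apply: open_nbhs_nbhs. Qed.

Lemma chart_cont p x : dom (J p) x -> {for x, continuous (J p)}.
Proof. by move=> px; have [[_ _ _ cJ _] _] := atlasJ p; apply: cJ. Qed.

Lemma chartK p x : dom (J p) x -> chinv (J p) (J p x) = x.
Proof. by move=> px; have [[_ _ K _ _] _] := atlasJ p; apply: K. Qed.

Lemma near_chart_sdiff p x (e : R) : dom (J p) x -> 0 < e ->
  exists2 U : set S, nbhs x U & forall y y', U y -> U y' ->
    normc (G y - G y' - a p x * (J p y - J p y')) <= e * normc (J p y - J p y').
Proof.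
move=> px e0; have [d d0 Hd] := G_sdiff px e0.
exists (dom (J p) `&` [set y | normc (J p y - J p x) < d]).
  apply: filterI; first exact: near_dom.
  by have /continuous_normcP/(_ _ d0) := chart_cont px.
move=> y y' [py hy] [py' hy']; have := Hd _ _ hy hy'.
by rewrite !chartK// mul0r addr0.
Qed.

Lemma G_cont : continuous G.
Proof.
move=> p; have [_ pp] := atlasJ p.
apply/continuous_normcP => e e0.
have [d d0 Hd] := sdiff_near (G_sdiff pp) e0.
have /continuous_normcP/(_ _ d0) cJ := chart_cont pp.
have dJ := near_dom pp.
near=> y; have py : dom (J p) y by near: y.
by have := Hd (J p y); rewrite !chartK//; apply; near: y.
Unshelve. all: by end_near.
Qed.

(** Strictness at x controls the derivative nearby: a small increment k based at y is expanded once
    with [a p x], both of its ends being near x, and once with [a p y]. Comparing the two bounds the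
    difference of the derivatives. *)
Lemma a_cont p x : dom (J p) x -> {for x, continuous (a p)}.
Proof.
move=> px; apply/continuous_normcP => e e0.
have e40 : 0 < e / 4 by rewrite divr_gt0.
have [d d0 Hd] := G_sdiff px e40.
have /continuous_normcP/(_ _ d0) cJ := chart_cont px.
have dJ := near_dom px.
near=> y; have py : dom (J p) y by near: y.
have hy : normc (J p y - J p x) < d by near: y.
have [d' d'0 Hd'] := G_sdiff py e40.
pose k := Num.min d' (d - normc (J p y - J p x)) / 2.
have k0 : 0 < k by rewrite divr_gt0// lt_min d'0 subr_gt0.
have : k < Num.min d' (d - normc (J p y - J p x)).
  by rewrite ltr_pdivrMr// ltr_pMr ?ltr1n// lt_min d'0 subr_gt0.
rewrite lt_min => /andP[k1 k2]; clearbody k.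
set z := J p y in hy k2 Hd'.
have nk : normc (z + k%:C - z) = k by rewrite addrC addKr normc_real gtr0_norm.
have w1 : normc (z + k%:C - z) < d' by rewrite nk.
have w0 : normc (z - z) < d' by rewrite subrr normc0.
have w2 : normc (z + k%:C - J p x) < d.
  have := normc_triangle (z + k%:C - z) (z - J p x); rewrite addrA subrK nk.
  by move: k2; lra.
have := Hd _ _ w2 hy; have := Hd' _ _ w1 w0; rewrite nk !mul0r !addr0.
have -> : z + k%:C - z = k%:C by ring.
set D := _ - G _ => h1 h2.
have := normc_triangle (D - a p x * k%:C) (- (D - a p y * k%:C)).
rewrite normc_opp.
have -> : D - a p x * k%:C - (D - a p y * k%:C) = (a p y - a p x) * k%:C by ring.
rewrite normcM normc_real gtr0_norm// => h3.
have : normc (a p y - a p x) * k <= e / 2 * k by lra.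
by rewrite ler_pM2r//; lra.
Unshelve. all: by end_near.
Qed.

Lemma G_locally_injective (p : S) : exists2 U : set S, nbhs p U &
  forall x y, U x -> U y -> G x = G y -> x = y.
Proof.
have [_ pp] := atlasJ p; have na := normc_gt0 (a_neq0 pp).
have e0 : 0 < normc (a p p) / 2 by rewrite divr_gt0.
have [U Up HU] := near_chart_sdiff pp e0.
exists (U `&` dom (J p)); first by apply: filterI => //; exact: near_dom.
move=> x y [Ux px] [Uy py] E; have := HU _ _ Ux Uy.
rewrite E subrr sub0r normc_opp normcM => H.
have : normc (J p x - J p y) = 0.
  apply/eqP; rewrite eq_le normc_ge0 andbT.
  have : normc (a p p) / 2 * normc (J p x - J p y) <= 0 by lra.
  by rewrite pmulr_rle0.
move=> /eq0_normc/eqP; rewrite subr_eq0 => /eqP E'.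
by rewrite -(chartK px) E' chartK.
Qed.

(** The Lipschitz bound of the inverse in the chart makes psi continuous on the whole disc and not
    only at its centre, as is needed to follow a segment through it. *)
Lemma G_local_inverse p : exists (r : R) (psi : R[i]^o -> S),
  [/\ 0 < r, psi (G p) = p & forall y, normc (y - G p) < r ->
        G (psi y) = y /\ {for y, continuous psi}].
Proof.
have [[_ oI _ _ ci] pp] := atlasJ p.
have : nbhs (J p p) (chart_image (J p)) by apply: open_nbhs_nbhs; split=> //; exists p.
move=> /nbhs_normcP[d0 d00 Hd0].
have [r [k [f [r0 k0 fz0 fP fL]]]] := sdiff_local_inverse (a_neq0 pp) d00 (G_sdiff pp).
rewrite (chartK pp) in fz0 fP fL.
exists r, (fun y => chinv (J p) (f y)); split=> // [|y hy].
  by rewrite fz0 chartK.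
have [h1 h2] := fP y hy; split=> //.
apply: (@continuous_comp _ _ _ (f : R[i]^o -> R[i]^o)).
  apply/continuous_normcP => e e0.
  have r1 : 0 < r - normc (y - G p) by rewrite subr_gt0.
  near=> z.
  have z1 : normc (z - y) < r - normc (y - G p) by near: z; apply: near_normc.
  have z2 : normc (z - y) < e / k by near: z; apply: near_normc; rewrite divr_gt0.
  apply: le_lt_trans (fL _ _ _ hy) _; last by rewrite mulrC -ltr_pdivlMr.
  have := normc_triangle (z - y) (y - G p); rewrite addrA subrK.
  by move: z1; lra.
by apply: ci; apply: Hd0.
Unshelve. all: by end_near.
Qed.

(** The times of coincidence form an open set since G is locally injective, a closed one since S is
    Hausdorff, and the interval is connected. *)
Lemma lift_unique (c c' : R -> S) (s0 s1 t1 : R) :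
  (forall t, s0 <= t <= s1 -> [/\ {for t, continuous c}, {for t, continuous c'}
     & G (c t) = G (c' t)]) ->
  s0 <= t1 <= s1 -> c t1 = c' t1 -> forall t, s0 <= t <= s1 -> c t = c' t.
Proof.
move=> H t1I E1 t tI.
pose B := [set t | s0 <= t <= s1 /\ c t = c' t].
suff : B = `[s0, s1]%classic.
  move=> EB; have : `[s0, s1]%classic t by rewrite /= in_itv.
  by rewrite -EB => -[].
apply: (@segment_connected R s0 s1); first by exists t1.
  (* Equality of the projections is known on [s0, s1] only, and neighbourhoods of the endpoints
     leave it. The implication makes sense on the whole line, and its interior is open there. *)
  exists [set t | G (c t) = G (c' t) -> c t = c' t]^°; first exact: open_interior.
  apply/seteqP; split => [s [sI Es]|s [/=]].
    split; first by rewrite /= in_itv.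
    have [cc cc' _] := H s sI.
    have [U Up inj] := G_locally_injective (c s).
    have U1 := cc _ Up; rewrite Es in Up; have U2 := cc' _ Up.
    rewrite /interior; near=> s'; apply: inj; near: s'; [exact: U1|exact: U2].
  rewrite in_itv /= => sI /interior_subset E; split=> //.
  by apply: E; have [] := H s sI.
exists (closure B); first exact: closed_closure.
apply/seteqP; split => [s Bs|s [/=]].
  split; last exact: subset_closure.
  by case: Bs => sI _; rewrite /= in_itv.
rewrite in_itv /= => sI clB; split=> //.
have [cc cc' _] := H s sI.
apply: haus => U V /cc cU /cc' cV.
have cUV : nbhs s (c @^-1` U `&` c' @^-1` V) by exact: filterI.
have [s' [[_ Es'] [s'U s'V]]] := clB _ cUV.
by exists (c s'); split=> //; rewrite Es'.
Unshelve. all: by end_near.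
Qed.

(** A converse of the chain rule. As the derivative of G is nonzero, the increments of G o c first
    bound those of the coordinate by K |s - t|; the expansion of G then yields their linear part. *)
Lemma curve_chart_vdiff (c : R -> S) t p (g : R[i]) :
  {for t, continuous c} -> dom (J p) (c t) -> vdiff (fun s => G (c s)) t g ->
  vdiff (fun s => J p (c s)) t (g / a p (c t)).
Proof.
move=> cc pc Dg e e0; set al := a p (c t).
have al0 : al != 0 := a_neq0 pc; have na := normc_gt0 al0.
pose K := 2 / normc al * (normc g + 1).
have K0 : 0 < K by rewrite mulr_gt0 ?divr_gt0//; have := normc_ge0 g; lra.
(* The bound 1 controls the increment of G o c, |al|/2 gives the Lipschitz constant K of the
   coordinate, and the last bound absorbs the total error eta (K + 1) |s - t| after division by
   al. *)
pose eta := Num.min 1 (Num.min (normc al / 2) (e * normc al / (K + 1))).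
have eta0 : 0 < eta.
  by rewrite !lt_min ltr01 !divr_gt0 ?mulr_gt0//=; lra.
have /and3P[eta1 eta2 eta3] : [&& eta <= 1, eta <= normc al / 2 & eta <= e * normc al / (K + 1)].
  by rewrite /eta !ge_min !lexx !orbT.
have [U Uc HU] := near_chart_sdiff pc eta0.
have cU := cc _ Uc; have {}Dg := Dg _ eta0.
near=> s.
have Us : U (c s) by near: s.
have Ut : U (c t) by exact: nbhs_singleton Uc.
have Hs := HU _ _ Us Ut.
have Ds : normc (G (c s) - G (c t) - g * (s - t)%:C) <= eta * `|s - t| by near: s.
set u := J p (c s) - J p (c t) in Hs *; set v := G (c s) - G (c t) in Hs Ds.
rewrite -/al in Hs.
have nu0 := normc_ge0 u; have st0 := normr_ge0 (s - t).
have hv : normc v <= (normc g + 1) * `|s - t|.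
  have := normc_triangle (v - g * (s - t)%:C) (g * (s - t)%:C).
  rewrite subrK normcM normc_real; have := ler_wpM2r st0 eta1; lra.
have hu : normc u <= K * `|s - t|.
  have := normc_triangle (- (v - al * u)) v; rewrite normc_opp.
  have -> : - (v - al * u) + v = al * u by ring.
  rewrite normcM => h1; have h2 := ler_wpM2r nu0 eta2.
  have h3 : normc al / 2 * normc u <= (normc g + 1) * `|s - t| by lra.
  rewrite /K -(ler_pM2l (_ : 0 < normc al / 2)) ?divr_gt0//.
  have -> // : normc al / 2 * (2 / normc al * (normc g + 1) * `|s - t|)
     = (normc g + 1) * `|s - t|.
  by field; rewrite gt_eqF.
have -> : u - g / al * (s - t)%:C =
   (- (v - al * u) + (v - g * (s - t)%:C)) / al by field; exact: al0.
rewrite normcM normcV ler_pdivrMr//.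
apply: le_trans (normc_triangle _ _) _; rewrite normc_opp.
apply: (@le_trans _ _ (eta * (K + 1) * `|s - t|)).
  have := ler_wpM2l (ltW eta0) hu; lra.
rewrite [e * _ * _]mulrAC ler_wpM2r//.
by rewrite -ler_pdivlMr//; lra.
Unshelve. all: by end_near.
Qed.

Lemma curve_G_vdiff (c : R -> S) t p (d : R[i]) :
  {for t, continuous c} -> dom (J p) (c t) -> vdiff (fun s => J p (c s)) t d ->
  vdiff (fun s => G (c s)) t (a p (c t) * d).
Proof.
move=> cc pc DZ e e0; set al := a p (c t).
pose K := normc d + 1 + normc al; have K0 : 0 < K.
  by have := normc_ge0 d; have := normc_ge0 al; rewrite /K; lra.
pose eta := Num.min 1 (e / K).
have eta0 : 0 < eta by rewrite lt_min ltr01 divr_gt0.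
have /andP[eta1 eta2] : (eta <= 1) && (eta <= e / K).
  by rewrite /eta !ge_min !lexx !orbT.
have [U Uc HU] := near_chart_sdiff pc eta0.
have cU := cc _ Uc; have {}DZ := DZ _ eta0.
near=> s.
have Us : U (c s) by near: s.
have Ut : U (c t) by exact: nbhs_singleton Uc.
have Hs := HU _ _ Us Ut.
have Ds : normc (J p (c s) - J p (c t) - d * (s - t)%:C) <= eta * `|s - t| by near: s.
set u := J p (c s) - J p (c t) in Hs Ds; set v := G (c s) - G (c t) in Hs *.
rewrite -/al in Hs.
have st0 := normr_ge0 (s - t).
have hu : normc u <= (normc d + 1) * `|s - t|.
  have := normc_triangle (u - d * (s - t)%:C) (d * (s - t)%:C).
  rewrite subrK normcM normc_real; have := ler_wpM2r st0 eta1; lra.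
have -> : v - al * d * (s - t)%:C = (v - al * u) + al * (u - d * (s - t)%:C) by ring.
apply: le_trans (normc_triangle _ _) _; rewrite normcM.
apply: (@le_trans _ _ (eta * K * `|s - t|)).
  have := ler_wpM2l (ltW eta0) hu; have := ler_wpM2l (normc_ge0 al) Ds.
  by rewrite /K; lra.
by rewrite ler_wpM2r// -ler_pdivlMr.
Unshelve. all: by end_near.
Qed.

Lemma C1_curve_of_lift (c : R -> S) (g : R -> R[i]^o) : continuous c ->
  continuous g -> (forall t, vdiff (fun s => G (c s)) t (g t)) -> C1_curve J c.
Proof.
move=> cc cg Dg; split=> // p t pc /=.
have D s : dom (J p) (c s) -> vdiff (fun s => J p (c s)) s (g s / a p (c s)).
  by move=> ps; apply: curve_chart_vdiff => //; exact: cc.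
have nd : \forall s \near t, dom (J p) (c s) by exact: cc _ (near_dom pc).
have ca : {for t, continuous (fun s => (g s / a p (c s)) : R[i]^o)}.
  apply: continuous_mulc; first exact: cg.
  apply: (@continuousV R[i]); first exact: a_neq0.
  apply: (@continuous_comp _ _ _ c (a p)); first exact: cc.
  exact: a_cont.
have [[dx _] [dy _]] := (vdiffP _ _ _).1 (D t pc); split; [exact: dx| |exact: dy|].
  apply: (@near_eq_continuous _ _ _ (fun s => complex.Re (g s / a p (c s)))).
    by near=> s; apply: (derive1_vdiff (D s _)).1; near: s.
  apply: (@continuous_comp _ _ _ (fun s => (g s / a p (c s)) : R[i]^o) (@complex.Re R : R[i]^o -> R)) => //.
  exact: continuous_Re.
apply: (@near_eq_continuous _ _ _ (fun s => complex.Im (g s / a p (c s)))).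
  by near=> s; apply: (derive1_vdiff (D s _)).2; near: s.
apply: (@continuous_comp _ _ _ (fun s => (g s / a p (c s)) : R[i]^o) (@complex.Im R : R[i]^o -> R)) => //.
exact: continuous_Im.
Unshelve. all: by end_near.
Qed.

Lemma lift_of_C1_curve (c : R -> S) : C1_curve J c ->
  exists2 g : R -> R[i]^o, continuous g & forall t, vdiff (fun s => G (c s)) t (g t).
Proof.
move=> [cc C1].
pose dZ p (t : R) : R[i]^o := derive1 (fun s => complex.Re (J p (c s))) t +i*
                       derive1 (fun s => complex.Im (J p (c s))) t.
have DZ p t : dom (J p) (c t) -> vdiff (fun s => J p (c s)) t (dZ p t).
  move=> pc; have [dx _ dy _] := C1 p t pc; apply/vdiffP; rewrite /dZ !derive1E /=.
  by split; apply: DeriveDef; [exact: dx| |exact: dy|].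
have DG p t : dom (J p) (c t) -> vdiff (fun s => G (c s)) t (a p (c t) * dZ p t).
  by move=> pc; apply: curve_G_vdiff (DZ _ _ pc) => //; exact: cc.
have dd t : dom (J (c t)) (c t) by have [] := atlasJ (c t).
exists (fun t => a (c t) (c t) * dZ (c t) t); last by move=> t; apply: DG.
move=> t; have nd : \forall s \near t, dom (J (c t)) (c s) by exact: cc _ (near_dom (dd t)).
(* The derivative was written in a chart that moves with the point. Near t it agrees with the
   expression in the fixed chart at c t, by uniqueness of derivatives, and the latter is visibly
   continuous. *)
apply: (@near_eq_continuous _ _ _ (fun s => (a (c t) (c s) * dZ (c t) s) : R[i]^o)).
  near=> s; have ds : dom (J (c t)) (c s) by near: s.
  exact: vdiff_unique (DG _ _ (dd s)) (DG _ _ ds).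
apply: continuous_mulc.
  apply: (@continuous_comp _ _ _ c (a (c t))); first exact: cc.
  exact: a_cont.
have [_ h1 _ h2] := C1 (c t) t (dd t).
by apply: cvg_ReIm; [exact: h1|exact: h2].
Unshelve. all: by end_near.
Qed.

(** The factor |a| in h cancels against its inverse in the velocity of the coordinate. *)
Lemma speedE (c : R -> S) t (g : R[i]) : {for t, continuous c} ->
  vdiff (fun s => G (c s)) t g -> speed J h c t = lam (G (c t)) * normc g.
Proof.
move=> cc Dg; have [_ dd] := atlasJ (c t).
have D := curve_chart_vdiff cc dd Dg; have na := normc_gt0 (a_neq0 dd).
rewrite /speed hE (derive1_vdiff D).1 (derive1_vdiff D).2 -/(sqmod _).
rewrite -!sqr_normc_sqmod normcM normcV -!exprMn sqrtr_sqr ger0_norm.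
  by field; rewrite gt_eqF.
by rewrite !mulr_ge0 ?invr_ge0 ?normc_ge0// ltW.
Qed.

Lemma continuous_lift_speed (c : R -> S) (g : R -> R[i]^o) : continuous c ->
  continuous g -> continuous (fun t => lam (G (c t)) * normc (g t)).
Proof.
move=> cc cg t; apply: (@continuousM R _ (fun t => lam (G (c t))) (fun t => normc (g t))).
  apply: (@continuous_comp _ _ _ (fun s => G (c s)) lam); last exact: lam_cont.
  by apply: (@continuous_comp _ _ _ c G); [exact: cc|exact: G_cont].
by apply: (@continuous_comp _ _ _ g (@normc R : R[i]^o -> R)); [exact: cg|exact: continuous_normc].
Qed.

Lemma conf_dist_le (c : R -> S) (g : R -> R[i]^o) (C : R) : continuous c ->
  continuous g -> (forall t, vdiff (fun s => G (c s)) t (g t)) ->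
  (forall t, 0 <= t <= 1 -> lam (G (c t)) * normc (g t) <= C) ->
  (conf_dist J h (c 0%R) (c 1%R) <= C%:E)%E.
Proof.
move=> cc cg Dg HC; apply: (@le_trans _ _ (curve_length J h c)).
  apply: ereal_inf_lbound; exists c => //; split=> //.
  exact: C1_curve_of_lift Dg.
have -> : C%:E = (\int[@lebesgue_measure R]_(t in `[0%R, 1%R]) (cst C%:E t))%E.
  by rewrite integral_cst//= lebesgue_measure_itv /= lte_fin ltr01 -EFinB subr0 mule1.
rewrite /curve_length.
have E t : speed J h c t = lam (G (c t)) * normc (g t) by apply: speedE; [exact: cc|].
apply: ge0_le_integral => //.
- by move=> t _; rewrite lee_fin E mulr_ge0 ?normc_ge0// ltW.
- apply/measurable_EFinP; rewrite (_ : speed J h c = fun t => lam (G (c t)) * normc (g t)); last first.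
    exact/funext.
  by apply: measurable_funS (continuous_measurable_fun (continuous_lift_speed cc cg)).
- by move=> t; rewrite /= in_itv /= lee_fin E; exact: HC.
Qed.

Lemma short_curve_close (c : R -> S) (k r : R) : C1_curve J c -> 0 < k -> 0 < r ->
  (forall x, normc (G x - G (c 1)) < r -> k <= lam (G x)) ->
  (curve_length J h c < (k * r)%:E)%E ->
  forall t, 0 <= t <= 1 -> normc (G (c t) - G (c 1)) < r.
Proof.
move=> C1c k0 r0 hk hl; have [cc _] := C1c; have [g cg Dg] := lift_of_C1_curve C1c.
have E t : speed J h c t = lam (G (c t)) * normc (g t) by apply: speedE; [exact: cc|].
apply: (@small_length_stays_close _ _ g (speed J h c) k r) => //.
- by rewrite (_ : speed J h c = fun t => lam (G (c t)) * normc (g t));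
    [exact: continuous_lift_speed|exact/funext].
- by move=> t; rewrite E mulr_ge0 ?normc_ge0// ltW.
- by move=> t _ ht; rewrite E ler_wpM2r ?normc_ge0// hk.
Qed.

(** * Continuation of a lift to the end of a segment, by completeness *)

Section SegmentLifting.
Variables (v0 v1 : R[i]) (p0 : S) (C : R).
Let seg (s : R) : R[i]^o := v0 + s%:C * (v1 - v0).
Hypothesis Gp0 : G p0 = v0.
Hypothesis lam_le : forall s, 0 <= s <= 1 -> lam (seg s) <= C.
Hypothesis completeJ : complete_conformal J h.

(** Lifts are defined on all of R and are continuous from both sides even at 0 and t, so that they
    can be composed with a reparametrisation with values in [0, t]. Outside [0, t] their values are
    arbitrary. *)
Definition segment_lift (t : R) (c : R -> S) := c 0 = p0 /\
  forall s, 0 <= s <= t -> {for s, continuous c} /\ G (c s) = seg s.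

Lemma segment_lift_unique t t' c c' : 0 <= t <= t' ->
  segment_lift t c -> segment_lift t' c' -> forall s, 0 <= s <= t -> c s = c' s.
Proof.
move=> /andP[t0 tt'] [c0 Hc] [c0' Hc']; apply: (@lift_unique _ _ _ _ 0) => //.
- move=> s /andP[s0 st].
  have [|h1 h2] := Hc s; first by rewrite s0.
  have [|h1' h2'] := Hc' s; first by rewrite s0 (le_trans st).
  by split=> //; rewrite h2.
- by rewrite lexx.
- by rewrite c0.
Qed.

Lemma seg_vdiff (sig : R -> R) (t d : R) : is_derive t (1 : R) sig d ->
  vdiff (fun s => seg (sig s)) t (d%:C * (v1 - v0)).
Proof.
move=> /real_derive_nearP H e e0; set u := v1 - v0.
have K0 : 0 < normc u + 1 by have := normc_ge0 u; lra.
have := H _ (divr_gt0 e0 K0); apply: filterS => s hs.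
have -> : seg (sig s) - seg (sig t) - d%:C * u * (s - t)%:C =
   (sig s - sig t - d * (s - t))%:C * u.
  by rewrite /seg -/u !(rmorphB, rmorphM) /=; ring.
rewrite normcM normc_real.
have hu : normc u <= normc u + 1 by lra.
apply: le_trans (ler_pM (normr_ge0 _) (normc_ge0 _) hs hu) _.
by rewrite le_eqVlt; apply/orP; left; apply/eqP; field; rewrite gt_eqF.
Qed.

(* sin^2 gives a reparametrization of [s1, s2] that is C^1 on the whole line. *)
Lemma segment_lift_dist t c s1 s2 : 0 <= t <= 1 -> segment_lift t c ->
  0 <= s1 <= t -> 0 <= s2 <= t ->
  (conf_dist J h (c s1) (c s2) <= (C * normc (v1 - v0) * pi * `|s2 - s1|)%:E)%E.
Proof.
move=> /andP[t0 t1] [_ Hc] /andP[s10 s1t] /andP[s20 s2t].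
pose sig (x : R) : R := s1 + (s2 - s1) * sin (pi / 2 * x) ^+ 2.
pose dsig (x : R) : R := (s2 - s1) * (pi * sin (pi / 2 * x) * cos (pi / 2 * x)).
have Dsig x : is_derive x (1 : R) sig (dsig x).
  have D1 : is_derive x (1 : R) (fun y : R => sin (pi / 2 * y)) (pi / 2 * cos (pi / 2 * x)).
    apply: (@is_derive_eq _ _ _ _ _ _ _ _ (is_derive1_comp (is_derive_sin _) _)).
    by rewrite /GRing.scale /= mulr1 mulrC.
  by apply: is_derive_eq; rewrite /dsig /GRing.scale /=; field.
have sin2 x : 0 <= sin (pi / 2 * x : R) ^+ 2 <= 1.
  rewrite sqr_ge0 /=; have := cos2Dsin2 (pi / 2 * x).
  by have := sqr_ge0 (cos (pi / 2 * x)); lra.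
have sigI x : 0 <= sig x <= t.
  have /andP[q0 q1] := sin2 x; rewrite /sig; set q := sin _ ^+ 2 in q0 q1 *.
  have -> : s1 + (s2 - s1) * q = (1 - q) * s1 + q * s2 by ring.
  apply/andP; split; first by rewrite addr_ge0// mulr_ge0// subr_ge0.
  have -> : t = (1 - q) * t + q * t by ring.
  by apply: lerD; apply: ler_wpM2l => //; rewrite subr_ge0.
have csig : continuous sig.
  by move=> x; have [d _] := Dsig x; apply: differentiable_continuous; apply/derivable1_diffP.
have cdsig : continuous dsig.
  move=> x; have clin : {for x, continuous (fun y : R => pi / 2 * y)}.
    exact: mulrl_continuous.
  have cs : {for x, continuous (fun y : R => sin (pi / 2 * y))}.
    by apply: (@continuous_comp _ _ _ (fun y : R => pi / 2 * y) sin) => //; exact: continuous_sin.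
  have cco : {for x, continuous (fun y : R => cos (pi / 2 * y))}.
    by apply: (@continuous_comp _ _ _ (fun y : R => pi / 2 * y) cos) => //; exact: continuous_cos.
  have cstc (k : R) : {for x, continuous (fun=> k : R)} by exact: cst_continuous.
  have c1 := @continuousM R R (fun=> pi) _ x (cstc _) cs.
  have c2 := @continuousM R R _ _ x c1 cco.
  exact: (@continuousM R R (fun=> s2 - s1) _ x (cstc _) c2).
have [E0 E1] : sig 0 = s1 /\ sig 1 = s2.
  by rewrite /sig mulr0 sin0 expr0n mulr0 addr0 mulr1 sin_pihalf expr1n mulr1 addrC subrK.
rewrite -{1}E0 -{1}E1.
have ccs : continuous (c \o sig).
  move=> x; apply: continuous_comp; first exact: csig.
  by have [] := Hc _ (sigI x).
have Gcs x : G (c (sig x)) = seg (sig x) by have [] := Hc _ (sigI x).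
have cdv : continuous (fun x => ((dsig x)%:C * (v1 - v0)) : R[i]^o).
  move=> x; apply: (@continuous_mulc _ _ (fun x => (dsig x)%:C) (fun=> v1 - v0)); last exact: cst_continuous.
  by apply: cvg_ReIm; [exact: cdsig|exact: cst_continuous].
have Dv x : vdiff (fun s => G (c (sig s))) x ((dsig x)%:C * (v1 - v0)).
  rewrite (_ : (fun s => _) = fun s => seg (sig s)); last exact/funext.
  exact: seg_vdiff.
apply: (conf_dist_le ccs cdv Dv) => x _.
have /andP[x0 xt] := sigI x.
have lC : lam (seg (sig x)) <= C by apply: lam_le; rewrite x0 (le_trans xt).
have l0 : 0 < lam (seg (sig x)) by rewrite -Gcs.
rewrite /= Gcs normcM normc_real.
have hd : `|dsig x| <= pi * `|s2 - s1|.
  rewrite normrM mulrC ler_wpM2r// !normrM (ger0_norm (pi_ge0 R)) -mulrA ler_piMr ?pi_ge0//.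
  by rewrite mulr_ile1// ?ler_norml ?sin_geN1 ?sin_le1 ?cos_geN1 ?cos_le1.
apply: le_trans (ler_pM (ltW l0) _ lC (ler_wpM2r (normc_ge0 _) hd)) _.
  by rewrite mulr_ge0// normc_ge0.
by rewrite le_eqVlt; apply/orP; left; apply/eqP; ring.
Qed.

Lemma seg_dist s s' : normc (seg s - seg s') = `|s - s'| * normc (v1 - v0).
Proof.
have -> : seg s - seg s' = (s - s')%:C * (v1 - v0) by rewrite /seg rmorphB; ring.
by rewrite normcM normc_real.
Qed.

Lemma seg_cont : continuous seg.
Proof.
by move=> s; apply: vdiff_continuous; apply: (@seg_vdiff id).
Qed.

Lemma segment_lift_extend t0 t1 c (psi : R[i]^o -> S) : 0 <= t0 ->
  segment_lift t0 c -> psi (seg t0) = c t0 ->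
  (forall s, t0 <= s <= t1 ->
     {for seg s, continuous psi} /\ G (psi (seg s)) = seg s) ->
  segment_lift t1 (fun s => if s <= t0 then c s else psi (seg s)).
Proof.
move=> t00 [c0 Hc] E Hpsi; split=> [|s /andP[s0 s1]]; first by rewrite t00.
have cpsi : t0 <= s -> {for s, continuous (psi \o seg)}.
  move=> t0s; apply: continuous_comp; first exact: seg_cont.
  by have [] := Hpsi s; rewrite ?t0s.
have [st|st|st] := ltgtP s t0.
- have [|cc Gs] := Hc s; first by rewrite s0 ltW.
  split=> //; apply: near_eq_continuous cc.
  by near=> s'; rewrite ifT//; apply: ltW; near: s'; exact: lt_nbhsl.
- have [|_ Gs] := Hpsi s; first by rewrite (ltW st).
  split=> //; apply: near_eq_continuous (cpsi (ltW st)).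
  near=> s'; rewrite ifF//; apply/negbTE; rewrite -ltNge.
  by near: s'; exact: lt_nbhsr.
- subst s; have [|cc Gs] := Hc t0; first by rewrite t00 lexx.
  split=> // P; rewrite /prop_for lexx => cP.
  have h1 : nbhs t0 (c @^-1` P) by exact: cc.
  have h2 : nbhs t0 ((psi \o seg) @^-1` P).
    by apply: (cpsi (lexx _)); rewrite /= E.
  by apply: filterS2 h1 h2 => s' h1 h2 /=; case: ifP.
Unshelve. all: by end_near.
Qed.

(** Both gam and psi o G o gam lift the curve G o gam, and they agree at time 1, hence also at time
    0. This turns a short curve ending at p into the information that its starting point lies on the
    sheet of psi. *)
Lemma curve_in_sheet (gam : R -> S) (psi : R[i]^o -> S) : continuous gam ->
  psi (G (gam 1)) = gam 1 ->
  (forall t, 0 <= t <= 1 -> {for G (gam t), continuous psi} /\ G (psi (G (gam t))) = G (gam t)) ->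
  psi (G (gam 0)) = gam 0.
Proof.
move=> cg E H.
apply: (@lift_unique (fun t => psi (G (gam t))) gam 0 1 1); rewrite ?lexx ?ler01//.
move=> t tI; have [cpsi Gpsi] := H t tI; split=> //; last exact: cg.
apply: (@continuous_comp _ _ _ (fun t => G (gam t)) psi) => //.
by apply: (@continuous_comp _ _ _ gam G); [exact: cg|exact: G_cont].
Qed.

(** Let T be the supremum of the times up to which the segment lifts. The endpoints of lifts up to
    times tending to T form a Cauchy sequence, with a limit p. A short curve to p puts a late
    endpoint on the sheet of the local inverse at p, and following this inverse prolongs the lift
    beyond T unless the end of the segment is reached. *)
Lemma segment_lifting : exists p, G p = v1.
Proof.
pose A := [set t : R | 0 <= t <= 1 /\ exists c, segment_lift t c].
have seg0 : seg 0 = v0 by rewrite /seg mul0r addr0.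
have seg1 : seg 1 = v1 by rewrite /seg mul1r addrC subrK.
have A0 : A 0.
  split; first by rewrite lexx ler01.
  exists (fun=> p0); split=> // s /andP[s0 s1].
  have -> : s = 0 by apply/eqP; rewrite eq_le s1.
  by split; [exact: cst_continuous|rewrite Gp0 seg0].
have ubA : ubound A 1 by move=> t [/andP[]].
have supA : has_sup A by split; [exists 0|exists 1].
pose T := sup A.
have leT t : A t -> t <= T by move=> At; apply: ub_le_sup => //; exists 1.
have [u uP] : {u : nat -> R & forall k, A (u k) /\ T - k.+1%:R^-1 < u k}.
  apply: (@choice _ _ (fun k t => A t /\ T - k.+1%:R^-1 < t)) => k.
  have k0 : 0 < (k.+1%:R^-1 : R) by rewrite invr_gt0.
  by have [t At ht] := sup_adherent k0 supA; exists t.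
have [c cP] : {c : nat -> R -> S & forall k, segment_lift (u k) (c k)}.
  by apply: (@choice _ _ (fun k c => segment_lift (u k) c)) => k; have [[]] := uP k.
have u01 k : 0 <= u k <= 1 by have [[]] := uP k.
have uT k : u k <= T by apply: leT; have [] := uP k.
have C0 : 0 < C.
  apply: (@lt_le_trans _ _ (lam (seg 0))); last by apply: lam_le; rewrite lexx ler01.
  by rewrite seg0 -Gp0.
pose n := normc (v1 - v0); have n0 : 0 <= n by exact: normc_ge0.
(* The summand 1 keeps K positive when the segment is reduced to a point. *)
pose K := C * n * pi + 1.
have K0 : 0 < K by rewrite ltr_wpDl// !mulr_ge0 ?(ltW C0)// pi_ge0.
have K1 : C * n * pi <= K by rewrite /K lerDl.
have archi (x : R) : 0 < x -> exists N : nat, forall k, (N <= k)%N -> k.+1%:R^-1 < x.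
  move=> x0; exists (Num.truncn x^-1) => k Nk.
  rewrite invf_plt ?posrE//; apply: (lt_le_trans (truncnS_gt _)).
  by rewrite ler_nat.
(* Both orders of the two endpoints are estimated at once, in place of a symmetry statement for
   [conf_dist]. *)
have dist k l : u k <= u l ->
    c k (u k) = c l (u k) /\
    (conf_dist J h (c k (u k)) (c l (u l)) <= (K * `|u l - u k|)%:E)%E /\
    (conf_dist J h (c l (u l)) (c k (u k)) <= (K * `|u l - u k|)%:E)%E.
  move=> ukl; have /andP[k0 k1] := u01 k; have /andP[l0 l1] := u01 l.
  have E : c k (u k) = c l (u k).
    by apply: (segment_lift_unique _ (cP k) (cP l)); rewrite ?k0 ?ukl ?lexx.
  split=> //; rewrite E.
  have I1 : 0 <= u k <= u l by rewrite k0. have I2 : 0 <= u l <= u l by rewrite l0 lexx.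
  split.
    apply: le_trans (segment_lift_dist (u01 l) (cP l) I1 I2) _.
    by rewrite lee_fin ler_wpM2r.
  apply: le_trans (segment_lift_dist (u01 l) (cP l) I2 I1) _.
  by rewrite lee_fin distrC ler_wpM2r.
have cauchy (e : R) : 0 < e -> exists N : nat, forall k l : nat, (N <= k)%N -> (N <= l)%N ->
    (conf_dist J h (c k (u k)) (c l (u l)) < e%:E)%E.
  move=> e0; have [N HN] := archi (e / K) (divr_gt0 e0 K0); exists N => k l Nk Nl.
  have small : K * `|u l - u k| < e.
    rewrite mulrC -ltr_pdivlMr//.
    have := HN k Nk; have := HN l Nl; have [_] := uP k; have [_] := uP l.
    have := uT k; have := uT l; rewrite ltr_norml.
    move: (e / K) (k.+1%:R^-1) (l.+1%:R^-1) => q qk ql ? ? ? ? ? ?.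
    by apply/andP; split; lra.
  have [kl|/ltW lk] := leP (u k) (u l).
    by have [_ [h1 _]] := dist k l kl; apply: le_lt_trans h1 _; rewrite lte_fin.
  have [_ [_ h1]] := dist l k lk; apply: le_lt_trans h1 _.
  by rewrite lte_fin distrC.
have [p pP] := completeJ cauchy.
have [r [psi [r0 psip psiP]]] := G_local_inverse p.
pose k0 := lam (G p) / 2; have k00 : 0 < k0 by rewrite divr_gt0.
have [r1 r10 lamr1] : exists2 r1 : R, 0 < r1 & forall y, normc (y - G p) < r1 -> k0 <= lam y.
  have lp : nbhs (lam (G p)) [set y | k0 <= y].
    apply: (filterS _ (nbhsx_ballx (lam (G p)) _ k00)) => y.
    by rewrite /ball /= ltr_norml /k0 => /andP[? ?]; lra.
  have h2 : nbhs (G p) [set y | k0 <= lam y] by exact: lam_cont lp.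
  by move/nbhs_normcP: h2 => [d d0 H]; exists d.
(* The bound r1 keeps lam above k0 along the short curve; r/2 leaves half of the disc of psi for the
   prolongation. *)
pose rr := Num.min (r / 2) r1.
have rr0 : 0 < rr by rewrite lt_min r10 divr_gt0.
have [N HN] := pP _ (mulr_gt0 k00 rr0).
(* Advancing by 2 del moves the point of the segment by less than r/2, so it stays in the disc of
   psi. As u k > T - del for the chosen k, the time u k + 2 del exceeds T. *)
pose del := r / (4 * (n + 1)).
have n10 : 0 < n + 1 by lra.
have del0 : 0 < del by rewrite divr_gt0// mulr_gt0.
have deln : 2 * del * n < r / 2.
  have -> : r / 2 = 2 * del * (n + 1) by rewrite /del; field; rewrite gt_eqF.
  have d20 : 0 < 2 * del by rewrite mulr_gt0.
  by rewrite (ltr_pM2l d20) ltrDl ltr01.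
have [N' HN'] := archi del del0.
pose k := maxn N N'.
have /HN/ereal_inf_lt[_ [gam [C1g g0 g1] <-] len] : (N <= k)%N by rewrite leq_maxl.
have close : forall t, 0 <= t <= 1 -> normc (G (gam t) - G p) < rr.
  rewrite -g1; apply: (short_curve_close C1g k00 rr0) => //.
  by move=> x; rewrite g1 lt_min => /andP[_]; exact: lamr1.
have close2 t : 0 <= t <= 1 -> normc (G (gam t) - G p) < r / 2.
  by move=> /close; rewrite lt_min => /andP[].
have sheet : psi (G (gam 0)) = gam 0.
  apply: curve_in_sheet; first by case: C1g.
    by rewrite g1.
  move=> t /close2 ht; have [|h1 h2] := psiP (G (gam t)); first by move: ht; lra.
  by split.
have Guk : G (c k (u k)) = seg (u k).
  by have [_ /(_ (u k))[]] := cP k; rewrite ?lexx ?andbT//; have /andP[] := u01 k.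
rewrite g0 Guk in sheet.
have hk : normc (seg (u k) - G p) < r / 2.
  by rewrite -Guk -g0; apply: close2; rewrite lexx ler01.
pose t' := Num.min 1 (u k + 2 * del).
have t'1 : t' <= 1 by rewrite ge_min lexx.
have t'2 : t' <= u k + 2 * del by rewrite ge_min lexx orbT.
have ext : segment_lift t' (fun s => if s <= u k then c k s else psi (seg s)).
  apply: segment_lift_extend; [by have /andP[] := u01 k|exact: cP|exact: sheet|].
  move=> s /andP[s1 s2]; have [|h1 h2] := psiP (seg s); last by split.
  have := normc_triangle (seg s - seg (u k)) (seg (u k) - G p); rewrite addrA subrK.
  rewrite seg_dist -/n ger0_norm ?subr_ge0// => hs.
  have : (s - u k) * n <= 2 * del * n by rewrite ler_wpM2r//; lra.
  by move: hk hs deln; lra.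
have t'0 : 0 <= t'.
  by rewrite le_min ler01; have /andP[] := u01 k; lra.
have At' : A t' by split; [rewrite t'0|exists (fun s => if s <= u k then c k s else psi (seg s))].
have t'T := leT _ At'.
have h1 : k.+1%:R^-1 < del by apply: HN'; rewrite leq_maxr.
have [_ h2] := uP k.
have [le1|gt1] := leP 1 (u k + 2 * del); last first.
  have E : t' = u k + 2 * del by rewrite /t' minElt ltNge (ltW gt1).
  exfalso; rewrite E in t'T.
  by move: h1 h2 t'T; move: (k.+1%:R^-1) => q; lra.
have E : t' = 1 by rewrite /t'; apply/min_idPl.
have [_ /(_ 1)[]] := ext; first by rewrite E ler01 lexx.
by move=> _ h3; exists (if 1 <= u k then c k 1 else psi (seg 1)); rewrite h3.
Qed.

End SegmentLifting.

End LocalBiholomorphism.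

(** * Developing maps *)

Section SmoothInComplexCharts.
Variables (R : realType) (S : topologicalType).
Variables (P : S -> chart S 'rV[R]_2) (J : S -> chart S R[i]^o).
Hypothesis atlasP : is_atlas P.
Hypothesis csJ : complex_structure P J.

Lemma smooth_strict (U : set 'rV[R]_2) (g : 'rV[R]_2 -> R) (x0 : 'rV[R]_2) :
  smooth_on U g -> nbhs x0 U -> strict_at (fun z => (g (toR2 z))%:C) (toC x0).
Proof.
move=> /(_ 1%N)[_ H] Ux0; apply: C1_strict => i; have [d [c _]] := H i.
by split; [apply: filterS Ux0|apply: c; exact: nbhs_singleton Ux0].
Qed.

Lemma near_overlap p x : dom (J p) x ->
  \forall z \near J p x, chart_image (J p) z /\ dom (P x) (chinv (J p) z).
Proof.
move=> px; have [[/(_ p)[[_ oI K _ ci] _] _] _ _] := csJ.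
have [[oP _ _ _ _] Px] := atlasP x.
have I : chart_image (J p) (J p x) by exists x.
have h1 : nbhs (J p x) (chart_image (J p)) by exact: open_nbhs_nbhs.
have h2 : nbhs (J p x) (chinv (J p) @^-1` dom (P x)).
  by apply: ci => //; rewrite K//; exact: open_nbhs_nbhs.
exact: filterI h1 h2.
Qed.

(** Smoothness is given in the real charts. Near x the entry is its expression in [P x] composed
    with the transition from [J p] to [P x]; both are C^1, hence strictly differentiable. *)
Lemma smooth_map_strict (f : S -> 'M[R[i]]_2) p x i j : smooth_map P f ->
  dom (J p) x -> strict_at (fun z => f (chinv (J p) z) i j) (J p x).
Proof.
move=> sf px; have nov := near_overlap px.
have [[/(_ p)[[_ _ K _ _] _] _] _ sJP] := csJ.
have [[_ oI KP _ _] Px] := atlasP x.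
pose tau k (y : 'rV[R]_2) := transition (J p) (P x) (toC y) 0 k.
have stau k : strict_at (fun z => (tau k (toR2 z))%:C) (J p x).
  rewrite -(toR2K (J p x)); apply: smooth_strict (sJP x p k) _.
  have h1 : nbhs (toR2 (J p x)) (toC (R:=R) @^-1`
      [set z | chart_image (J p) z /\ dom (P x) (chinv (J p) z)]).
    by apply: continuous_toC; rewrite toR2K.
  apply: filterS h1 => y [[q pq Eq] Pq].
  exists (toC y); last exact: toCK.
  by exists q => //; split=> //; rewrite -Eq K in Pq.
(* [strict_comp] composes maps from C to C, so the two real coordinates of the transition are
   assembled into one complex function. *)
pose Tz (z : R[i]) : R[i] := (tau 0 (toR2 z))%:C + 'i%C * (tau 1 (toR2 z))%:C.
have TzE z : Tz z = toC (P x (chinv (J p) z)).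
  by rewrite /Tz /tau toR2K /toC; simpc.
have sTz : strict_at Tz (J p x).
  by apply: strictD => //; apply: strictM => //; exact: strict_cst.
have sphi (phi : 'rV[R]_2 -> R) : smooth_on (chart_image (P x)) phi ->
    strict_at (fun z => (phi (P x (chinv (J p) z)))%:C) (J p x).
  move=> sphi.
  have -> : (fun z => (phi (P x (chinv (J p) z)))%:C) = fun z => (phi (toR2 (Tz z)))%:C.
    by apply/funext => z; rewrite TzE toCK.
  apply: (@strict_comp _ (fun z => (phi (toR2 z))%:C)) => //.
  rewrite TzE K//; apply: smooth_strict sphi _.
  by apply: open_nbhs_nbhs; split=> //; exists x.
have [s1 s2] := sf x i j.
have := strictD (sphi _ s1) (strictM (strict_cst 'i%C (J p x)) (sphi _ s2)).
apply: strict_near_eq; apply: filterS nov => z [_ Pz].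
by rewrite KP// -complexE.
Qed.

End SmoothInComplexCharts.

Lemma strict_mulmx (R : realType) (m n p q : nat) (A : 'M[R[i]]_(m, n))
    (B : 'M[R[i]]_(p, q)) (M : R[i] -> 'M[R[i]]_(n, p)) z0 :
  (forall i j, strict_at (fun z => M z i j) z0) ->
  forall i j, strict_at (fun z => (A *m M z *m B) i j) z0.
Proof.
move=> H i j.
have sum (I : Type) (r : seq I) (g : I -> R[i] -> R[i]) :
    (forall i, strict_at (g i) z0) -> strict_at (fun z => \sum_(i <- r) g i z) z0.
  move=> Hg; elim: r => [|k r IH].
    have -> : (fun z => \sum_(i <- [::]) g i z) = fun=> 0.
      by apply/funext => z; rewrite big_nil.
    exact: strict_cst.
  have -> : (fun z => \sum_(i <- k :: r) g i z) = fun z => g k z + \sum_(i <- r) g i z.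
    by apply/funext => z; rewrite big_cons.
  exact: strictD.
have -> : (fun z => (A *m M z *m B) i j) = fun z => \sum_l (\sum_k A i k * M z k l) * B l j.
  by apply/funext => z; rewrite mxE; apply: eq_bigr => l _; rewrite mxE.
apply: (sum) => l; apply: strictM; last exact: strict_cst.
by apply: (sum) => k; apply: strictM; [exact: strict_cst|exact: H].
Qed.

(** * Functions on the universal covering with zero derivative *)

Section LocallyConstant.
Variables (R : realType) (T : topologicalType).

Lemma locally_constant_path (V : Type) (u : T -> V) (c : R -> T) :
  (forall q, \forall q' \near q, u q' = u q) ->
  {within `[0, 1], continuous c} -> u (c 0) = u (c 1).
Proof.
move=> lc cc.
have op (w : V) : open [set q | u q = w].
  by rewrite openE => q /= qw; rewrite /interior; apply: filterS (lc q) => q' /= ->.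
have opn (w : V) : open [set q | u q <> w].
  by rewrite openE => q /= qw; rewrite /interior; apply: filterS (lc q) => q' /= ->.
have conn : connected (c @` `[0, 1]).
  by apply: connected_continuous_connected => //; exact: segment_connected.
have I0 : `[0, 1]%classic (0 : R) by rewrite /= in_itv /= lexx ler01.
have I1 : `[0, 1]%classic (1 : R) by rewrite /= in_itv /= lexx ler01.
have E : c @` `[0, 1] `&` [set q | u q = u (c 0)] = c @` `[0, 1].
  apply: conn.
  - by exists (c 0); split=> //; exists 0.
  - by exists [set q | u q = u (c 0)].
  - exists [set q | u q = u (c 0)] => //; rewrite -openC.
    exact: opn.
have : (c @` `[0, 1]) (c 1) by exists 1.
by rewrite -E => -[_ /= ->].
Qed.

Variable A : T -> chart T R[i]^o.
Hypothesis caA : complex_atlas A.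

(** The derivative at a point is known in the chart attached to that point only. The holomorphic
    transition carries its vanishing to a fixed chart, where [cdiff0_constant] can be applied on a
    disc. *)
Lemma chart_cdiff0 (u : T -> R[i]) (q q' : T) : dom (A q) q' ->
  cdiff (fun z => u (chinv (A q') z)) (A q' q') 0 ->
  cdiff (fun z => u (chinv (A q) z)) (A q q') 0.
Proof.
move=> qq' H; have [at_ hol] := caA.
have [[_ _ K _ ci] _] := at_ q; have [[oD _ K' _ _] q'q'] := at_ q'.
have ov : overlap (A q) (A q') (A q q') by exists q'.
have D := derivable_cdiff (hol q q' _ ov).
have H' : cdiff (fun z => u (chinv (A q') z)) (transition (A q) (A q') (A q q')) 0.
  by rewrite /transition K.
have := cdiff_comp H' D; rewrite mul0r; apply: cdiff_near_eq.
have h2 : nbhs (A q q') (chinv (A q) @^-1` dom (A q')).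
  by apply: ci; [exists q'|rewrite K//; exact: open_nbhs_nbhs].
by apply: filterS h2 => z /= hz; rewrite /transition K'.
Qed.

Lemma cdiff0_locally_constant (u : T -> R[i]) :
  (forall q, cdiff (fun z => u (chinv (A q) z)) (A q q) 0) ->
  forall q, \forall q' \near q, u q' = u q.
Proof.
move=> H q; have [at_ _] := caA; have [[oD oI K cA _] qq] := at_ q.
have : nbhs (A q q) (chart_image (A q)) by apply: open_nbhs_nbhs; split=> //; exists q.
move=> /nbhs_normcP[d d0 Hd].
have cst : forall z, normc (z - A q q) < d -> u (chinv (A q) z) = u (chinv (A q) (A q q)).
  apply: (@cdiff0_constant _ (fun z => u (chinv (A q) z))) => z /Hd[q' qq' <-].
  exact: chart_cdiff0.
have /continuous_normcP/(_ _ d0) cAq := cA _ qq.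
have nd : nbhs q (dom (A q)) by exact: open_nbhs_nbhs.
near=> q'.
have qq' : dom (A q) q' by near: q'.
by have := cst (A q q'); rewrite !K//; apply; near: q'.
Unshelve. all: by end_near.
Qed.

Lemma cdiff0_constant_on (u : T -> R[i]) : simply_connected R T ->
  (forall q, cdiff (fun z => u (chinv (A q) z)) (A q q) 0) ->
  forall q q', u q = u q'.
Proof.
move=> [_ path _] H q q'; have [c [cc <- <-]] := path q q'.
by apply: locally_constant_path cc; exact: cdiff0_locally_constant.
Qed.

End LocallyConstant.

Lemma covering_surj (T S : topologicalType) (pi : T -> S) : covering_map pi ->
  forall x, exists q, pi q = x.
Proof.
move=> [_ H] x; have [U [_ Ux [F [[V FV] _ _ HV]]]] := H x.
by have [_ [s [/(_ x Ux)[_ <-] _ _]]] := HV V FV; exists (s x).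
Qed.

(** * Reaching the end of a segment through a developing map *)

Section Developing.
Variables (R : realType) (S T : topologicalType).
Variables (J : S -> chart S R[i]^o) (A : T -> chart T R[i]^o) (pi : T -> S).
Variables (E : T -> 'M[R[i]]_2) (h : S -> R).
Hypothesis haus : hausdorff_space S.
Hypothesis caJ : complex_atlas J.
Hypothesis ucov : universal_covering J A pi.
Hypothesis ds : is_ds11 J A pi E h.
Hypothesis comp : complete_conformal J h.
Variables (G : S -> R[i]^o) (b : T -> R[i]) (lam : R[i]^o -> R).
Hypothesis G_strict : forall p x, dom (J p) x ->
  strict_at (fun z => G (chinv (J p) z)) (J p x).
Hypothesis G_cdiff : forall q, cdiff (fun z => G (pi (chinv (A q) z))) (A q q) (b q).
Hypothesis b_neq0 : forall q, b q != 0.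
Hypothesis lam_gt0 : forall p, 0 < lam (G p).
Hypothesis lam_cont : forall p, {for G p, continuous lam}.
Hypothesis b_ds : forall q, sqmod (omega A E q) + sqmod (theta A E q) =
  lam (G (pi q)) ^+ 2 * sqmod (b q).

Let pd p q := 'D_1 ((fun z => J p (pi (chinv (A q) z))) : R[i]^o -> R[i]^o) (A q q).

(** Strict differentiability on S is compared with complex differentiability of G o pi. The
    derivative of pi is a factor of b q, hence nonzero, so the conjugate-linear part of the
    differential of G must vanish. *)
Lemma developing_derivative p q : dom (J p) (pi q) ->
  exists2 a : R[i], sdiff (fun z => G (chinv (J p) z)) (J p (pi q)) a 0 & a * pd p q = b q.
Proof.
move=> pq; have [_ [atA _] [cpi _] hol] := ucov.
have [[_ _ KA _ ciA] qq] := atA q.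
have [atJ _] := caJ; have [[oJ _ KJ _ _] _] := atJ p.
have [a1 [b1 Ha]] := G_strict pq.
have D : cdiff (fun z => J p (pi (chinv (A q) z))) (A q q) (pd p q).
  by apply: derivable_cdiff; apply: hol; exists q.
have Ha' : sdiff (fun z => G (chinv (J p) z)) (J p (pi (chinv (A q) (A q q)))) a1 b1.
  by rewrite KA.
have E' : \forall z \near A q q, G (pi (chinv (A q) z)) =
    G (chinv (J p) (J p (pi (chinv (A q) z)))).
  have h1 : nbhs (A q q) (chinv (A q) @^-1` (pi @^-1` dom (J p))).
    by apply: ciA; [exists q|rewrite KA//; apply: cpi; exact: open_nbhs_nbhs].
  by apply: filterS h1 => z hz; rewrite KJ.
have [e1 e2] := sdiff_cdiff Ha' D (cdiff_near_eq E' (G_cdiff q)).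
have pd0 : pd p q != 0.
  by apply: contra (b_neq0 q) => /eqP pd0; rewrite -e1 pd0 mulr0.
exists a1 => //; suff <- : b1 = 0 by [].
by move/eqP: e2; rewrite mulf_eq0 conjc_eq0 (negbTE pd0) orbF => /eqP.
Qed.

Lemma developing_segment (v1 : R[i]) (p0 : S) (C : R) :
  (forall s : R, 0 <= s <= 1 -> lam (G p0 + s%:C * (v1 - G p0)) <= C) ->
  exists p, G p = v1.
Proof.
move=> HC; have [atJ _] := caJ; have [_ _ cov _] := ucov.
(* A section of pi without any continuity: it merely selects a point above x at which derivatives
   are compared. *)
have [sec secK] : {sec : S -> T & forall x, pi (sec x) = x}.
  by apply: (@choice _ _ (fun x q => pi q = x)); exact: covering_surj cov.
have [a aP] : {a : S * S -> R[i]^o & forall px, dom (J px.1) px.2 ->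
    sdiff (fun z => G (chinv (J px.1) z)) (J px.1 px.2) (a px) 0 /\
    a px * pd px.1 (sec px.2) = b (sec px.2)}.
  apply: (@choice _ _ (fun px a => dom (J px.1) px.2 ->
    sdiff (fun z => G (chinv (J px.1) z)) (J px.1 px.2) a 0 /\
    a * pd px.1 (sec px.2) = b (sec px.2))) => -[p x] /=.
  have [px|npx] := pselect (dom (J p) x); last by exists 0.
  rewrite -{1}(secK x) in px; have [a1 H1 E1] := developing_derivative px.
  by exists a1 => _; rewrite secK in H1.
have a0 p x : dom (J p) x -> a (p, x) != 0.
  move=> px; have [_ /= E1] := aP (p, x) px.
  by apply: contra (b_neq0 (sec x)) => /eqP a0; rewrite -E1 a0 mul0r.
have hE p : h p = lam (G p) ^+ 2 * sqmod (a (p, p)).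
  have [_ pp] := atJ p; have [_ /= E1] := aP (p, p) pp.
  have := ds (sec p); rewrite b_ds !secK -/(pd p (sec p)) -E1.
  have sq0 : sqmod (pd p (sec p)) != 0.
    rewrite -sqr_normc_sqmod expf_neq0// gt_eqF// normc_gt0//.
    by apply: contra (b_neq0 (sec p)) => /eqP pd0; rewrite -E1 pd0 mulr0.
  rewrite -(sqr_normc_sqmod (_ * _)) normcM exprMn !sqr_normc_sqmod mulrA.
  by move/(mulIf sq0) ->.
apply: (@segment_lifting R S J h G (fun p x => a (p, x)) lam haus atJ _ _ lam_gt0 lam_cont hE
  (G p0) v1 p0 C) => //.
by move=> p x /(aP (p, x))[].
Qed.

End Developing.

(** * Models in hyperbolic space *)

Section HyperbolicSpace.
Variable R : realType.
Implicit Types (X Y B : 'M[R[i]]_2) (z b : R[i]) (x y : R).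

Definition mx2 (p q r s : R[i]) : 'M[R[i]]_2 :=
  \matrix_(i < 2, j < 2) (if i == 0 then (if j == 0 then p else q)
                          else (if j == 0 then r else s)).

Lemma mx2E p q r s : [/\ mx2 p q r s 0 0 = p, mx2 p q r s 0 1 = q,
  mx2 p q r s 1 0 = r & mx2 p q r s 1 1 = s].
Proof. by split; rewrite mxE. Qed.

Lemma eq_mx2 X p q r s : X 0 0 = p -> X 0 1 = q -> X 1 0 = r -> X 1 1 = s ->
  X = mx2 p q r s.
Proof.
by move=> h1 h2 h3 h4; apply/matrixP; apply: ord2P; apply: ord2P; rewrite mxE.
Qed.

Lemma mulmx2E X Y i j : (X *m Y) i j = X i 0 * Y 0 j + X i 1 * Y 1 j.
Proof.
rewrite mxE big_ord_recl big_ord1; congr (_ + X i _ * Y _ j); exact: val_inj.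
Qed.

Lemma det2E X : \det X = X 0 0 * X 1 1 - X 0 1 * X 1 0.
Proof.
rewrite (expand_det_row X 0) big_ord_recl big_ord1 /cofactor !det_mx11 !mxE /=.
rewrite !expr0 !expr1 mul1r mulN1r mulrN.
by congr (X 0 _ * X _ _ - X 0 _ * X _ _); exact: val_inj.
Qed.

Lemma ctrE X i j : ctr X i j = conjc (X j i).
Proof. by rewrite !mxE. Qed.

Lemma ctrM X Y : ctr (X *m Y) = ctr Y *m ctr X.
Proof. by rewrite /ctr map_mxM trmx_mul. Qed.

Lemma det_ctr X : \det (ctr X) = conjc (\det X).
Proof. by rewrite /ctr det_tr det_map_mx. Qed.

Lemma ctr1 : ctr 1%:M = 1%:M :> 'M[R[i]]_2.
Proof. by rewrite /ctr map_mx1 trmx1. Qed.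

Lemma mulc_conj z : z * conjc z = (sqmod z)%:C.
Proof. by rewrite -sqr_normc normrE -rmorphXn sqr_normc_sqmod. Qed.

Lemma sqmod_ge0 z : 0 <= sqmod z.
Proof. by rewrite -sqr_normc_sqmod sqr_ge0. Qed.

Lemma sqmod_eq0 z : (sqmod z == 0) = (z == 0).
Proof.
rewrite -sqr_normc_sqmod sqrf_eq0; apply/eqP/eqP => [/eq0_normc//|->].
exact: normc0.
Qed.

(** The action of SL(2, C) preserves determinants, hence [lor] and [hdist], which are built from
    them; the inverse matrix gives surjectivity on H3. *)
Lemma isometry_conj B : \det B = 1 -> isometry_H3 (fun X => B *m X *m ctr B).
Proof.
move=> dB.
have conjH (D X : 'M[R[i]]_2) : \det D = 1 -> H3 X -> H3 (D *m X *m ctr D).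
  move=> dD [a da ->]; exists (D *m a); first by rewrite det_mulmx dD da mul1r.
  by rewrite ctrM !mulmxA.
have uB : B \in unitmx by rewrite unitmxE dB unitr1.
split.
  apply/seteqP; split=> [_ [X HX <-]|X HX]; first exact: conjH.
  exists (invmx B *m X *m ctr (invmx B)).
    by apply: conjH => //; rewrite det_inv dB invr1.
  rewrite !mulmxA mulmxV// mul1mx -mulmxA -ctrM mulmxV//.
  by rewrite ctr1 mulmx1.
move=> X Y _ _; rewrite /hdist /lor.
have detB Z : \det (B *m Z *m ctr B) = \det Z.
  by rewrite !det_mulmx det_ctr dB conjc1 mul1r mulr1.
by rewrite -mulmxDl -mulmxDr !detB.
Qed.

(** For the converse, a lower triangular Cholesky factor with diagonal sqrt x, 1 / sqrt x is
    exhibited. *)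
Lemma H3P X : H3 X <-> exists x y b,
  [/\ 0 < x, x * y = 1 + sqmod b & X = mx2 x%:C b (conjc b) y%:C].
Proof.
split=> [[a da XE]|[x [y [b [x0 xy ->]]]]].
  pose b := X 0 1.
  exists (sqmod (a 0 0) + sqmod (a 0 1)), (sqmod (a 1 0) + sqmod (a 1 1)), b.
  have X00 : X 0 0 = (sqmod (a 0 0) + sqmod (a 0 1))%:C.
    by rewrite XE mulmx2E !ctrE !mulc_conj realcD.
  have X11 : X 1 1 = (sqmod (a 1 0) + sqmod (a 1 1))%:C.
    by rewrite XE mulmx2E !ctrE !mulc_conj realcD.
  have X10 : X 1 0 = conjc b.
    by rewrite /b XE !mulmx2E !ctrE conjcD !conjcM !conjcK; ring.
  have dX : \det X = 1 by rewrite XE det_mulmx det_ctr da conjc1 mulr1.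
  split; last exact: eq_mx2.
  - rewrite lt0r addr_ge0 ?sqmod_ge0// andbT paddr_eq0 ?sqmod_ge0// !sqmod_eq0.
    apply/negP => /andP[/eqP a00 /eqP a01]; move/eqP: da.
    by rewrite det2E a00 a01 !mul0r subrr eq_sym oner_eq0.
  - apply: complexI; rewrite realcM (realcD 1) -X00 -X11 -mulc_conj -X10 /b.
    by move: dX; rewrite det2E => /eqP; rewrite subr_eq => /eqP.
pose s := Num.sqrt x; have s0 : 0 < s by rewrite sqrtr_gt0.
have ss : s ^+ 2 = x by rewrite sqr_sqrtr// ltW.
have sC : s%:C != 0 :> R[i] by rewrite -(rmorph0 (real_complex R)) (inj_eq (@complexI R)) gt_eqF.
have conjs : conjc s%:C = s%:C :> R[i] by exact: conjc_real.
exists (mx2 s%:C 0 (conjc b / s%:C) s%:C^-1).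
  by have [h1 h2 h3 h4] := mx2E s%:C 0 (conjc b / s%:C) s%:C^-1;
    rewrite det2E h1 h2 h3 h4 mul0r subr0 divff.
apply/esym; have [h1 h2 h3 h4] := mx2E s%:C 0 (conjc b / s%:C) s%:C^-1.
apply: eq_mx2; rewrite mulmx2E !ctrE ?h1 ?h2 ?h3 ?h4 ?conjcM ?conjc_inv ?conjs ?conjc0 ?conjcK.
- by rewrite mul0r addr0 -realcM -expr2 ss.
- by rewrite mul0r addr0; field.
- by rewrite mulr0 addr0; field.
- have -> : y%:C = (1 + b * conjc b) / s%:C ^+ 2.
    rewrite mulc_conj -(rmorphXn (real_complex R)) ss -(rmorph1 (real_complex R)) -realcD -xy.
    rewrite realcM mulrAC divff ?mul1r//.
    by rewrite -(rmorph0 (real_complex R)) (inj_eq (@complexI R)) gt_eqF.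
  by field.
Qed.

Lemma lor_diag x y b (p q : R) :
  lor (mx2 x%:C b (conjc b) y%:C) (mx2 p%:C 0 0 q%:C) = - (x * q + y * p) / 2.
Proof.
rewrite /lor; congr (- _ / 2).
have -> : mx2 x%:C b (conjc b) y%:C + mx2 p%:C 0 0 q%:C =
    mx2 (x%:C + p%:C) b (conjc b) (y%:C + q%:C).
  by apply: eq_mx2; rewrite !mxE ?addr0.
rewrite !det2E.
have [-> -> -> ->] := mx2E (x%:C + p%:C) b (conjc b) (y%:C + q%:C).
have [-> -> -> ->] := mx2E x%:C b (conjc b) y%:C.
have [-> -> -> ->] := mx2E p%:C 0 0 q%:C.
have -> : (x%:C + p%:C) * (y%:C + q%:C) - b * conjc b - (x%:C * y%:C - b * conjc b)
  - (p%:C * q%:C - 0 * 0) = (x * q + y * p)%:C.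
  by rewrite realcD !realcM; ring.
by [].
Qed.

Lemma standard_horosphere :
  horosphere (range (fun g : R[i] => mx2 1 (conjc g) g (1 + (sqmod g)%:C))).
Proof.
(* For this L the product <X, L> is minus the upper left entry of X, so the horosphere is the
   section where that entry equals 1. *)
exists (mx2 0%:C 0 0 2%:C).
have [d1 d2 d3 d4] := mx2E 0%:C 0 0 2%:C; split.
- by apply: eq_mx2; rewrite ctrE ?d1 ?d2 ?d3 ?d4 ?conjc0 ?conjc_real.
- by rewrite det2E d1 d2 d3 d4 !mul0r subrr.
- rewrite /mxtrace big_ord_recl big_ord1.
  have -> : lift ord0 ord0 = 1 :> 'I_2 by exact: val_inj.
  by rewrite d4 d1 add0r ltcR.
- apply/seteqP; split=> [_ [g _ <-]|X [/H3P[x [y [b [x0 xy ->]]]]]].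
    have -> : mx2 1 (conjc g) g (1 + (sqmod g)%:C) =
        mx2 1%:C (conjc g) (conjc (conjc g)) (1 + sqmod g)%:C.
      by rewrite conjcK (realcD 1).
    split; last by rewrite lor_diag; field.
    apply/H3P; exists 1, (1 + sqmod g), (conjc g); split=> //.
    by rewrite mul1r -!sqr_normc_sqmod normc_conj.
  rewrite lor_diag mulr0 addr0 => E; have x1 : x = 1 by lra.
  exists (conjc b) => //; rewrite conjcK x1; congr mx2.
  move: xy; rewrite x1 mul1r => ->.
  by rewrite (realcD 1) -!sqr_normc_sqmod normc_conj.
Qed.

Lemma arcosh_lt (s t : R) : 1 <= s -> s < t -> arcosh s < arcosh t.
Proof.
move=> s1 st; rewrite /arcosh ltr_ln ?posrE.
- apply: ltr_leD => //; rewrite ler_wsqrtr// lerD2r ler_sqr ?nnegrE; lra.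
- by have := sqrtr_ge0 (s ^+ 2 - 1); lra.
- by have := sqrtr_ge0 (t ^+ 2 - 1); lra.
Qed.

Lemma arcosh_inj (s t : R) : 1 <= s -> 1 <= t -> arcosh s = arcosh t -> s = t.
Proof.
move=> s1 t1 E; have [h|h|//] := ltgtP s t.
- by have := arcosh_lt s1 h; rewrite E ltxx.
- by have := arcosh_lt t1 h; rewrite E ltxx.
Qed.

Lemma arcosh_ge0 (s : R) : 1 <= s -> 0 <= arcosh s.
Proof. by move=> s1; apply: ln_ge0; have := sqrtr_ge0 (s ^+ 2 - 1); lra. Qed.

Lemma geodesic_diag (t : R) : geodesic_pt 1%:M (e3 R) t =
  mx2 (expR t)%:C 0 0 (expR (- t))%:C.
Proof.
rewrite /geodesic_pt; apply: eq_mx2; rewrite !mxE /= ?mulr1n ?mulr0n.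
- by rewrite !mulr1 -realcD; congr _%:C; rewrite /cosh /sinh; field.
- by rewrite !mulr0 addr0.
- by rewrite !mulr0 addr0.
- by rewrite mulr1 mulrN1 -realcB; congr _%:C; rewrite /cosh /sinh; field.
Qed.

Lemma geodesic_axis : geodesic (range (geodesic_pt 1%:M (e3 R))).
Proof.
have oneE : 1%:M = mx2 1%:C 0 (conjc 0) 1%:C by apply: eq_mx2; rewrite ?mxE ?conjc0.
have e3E : e3 R = mx2 1%:C 0 0 (-1)%:C.
  by apply: eq_mx2; rewrite mxE //= rmorphN.
exists 1%:M, (e3 R); split=> //.
  by exists 1%:M; [rewrite det1|rewrite ctr1 mulmx1].
split.
- rewrite e3E; have [d1 d2 d3 d4] := mx2E 1%:C 0 0 (-1)%:C.
  by apply: eq_mx2; rewrite ctrE ?d1 ?d2 ?d3 ?d4 ?conjc0 ?conjc_real.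
- by rewrite oneE e3E lor_diag; field.
- rewrite [X in lor X _](_ : e3 R = mx2 1%:C 0 (conjc 0) (-1)%:C); last by rewrite e3E conjc0.
  by rewrite e3E lor_diag; field.
Qed.

(** The hyperbolic cosine of the distance to diag(e^t, e^-t) is (x e^-t + y e^t) / 2. It is at least
    sqrt (x y) by the inequality of arithmetic and geometric means, with equality for e^(2t) = x /
    y. *)
Lemma inf_hdist_axis x y b : 0 < x -> x * y = 1 + sqmod b ->
  inf (hdist (mx2 x%:C b (conjc b) y%:C) @` range (geodesic_pt 1%:M (e3 R))) =
  arcosh (Num.sqrt (x * y)).
Proof.
move=> x0 xy; have xy1 : 1 <= x * y by rewrite xy lerDl sqmod_ge0.
have y0 : 0 < y by rewrite -(pmulr_rgt0 _ x0); lra.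
set m := Num.sqrt (x * y); have m0 : 0 <= m by exact: sqrtr_ge0.
have mm : m ^+ 2 = x * y by rewrite sqr_sqrtr//; lra.
have m1 : 1 <= m by rewrite -(ler_sqr (x:=1)) ?nnegrE ?ler01// expr1n mm.
have hE t : hdist (mx2 x%:C b (conjc b) y%:C) (geodesic_pt 1%:M (e3 R) t) =
    arcosh ((x * expR (- t) + y * expR t) / 2).
  by rewrite /hdist geodesic_diag lor_diag; congr arcosh; field.
have mono (s t : R) : 1 <= s -> s <= t -> arcosh s <= arcosh t.
  by move=> s1; rewrite le_eqVlt => /orP[/eqP->//|st]; apply: ltW; exact: arcosh_lt.
have lb : lbound (hdist (mx2 x%:C b (conjc b) y%:C) @` range (geodesic_pt 1%:M (e3 R))) (arcosh m).
  move=> _ [_ [t _ <-] <-]; rewrite hE; apply: (mono) => //.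
  rewrite ler_pdivlMr//; set p := x * _; set q := y * _.
  have pq : p * q = m ^+ 2.
    rewrite mm /p /q mulrACA -expRD addNr expR0 mulr1 //.
  have p0 : 0 < p by rewrite mulr_gt0// expR_gt0.
  have q0 : 0 < q by rewrite mulr_gt0// expR_gt0.
  rewrite -(ler_sqr (x:=m * 2)) ?nnegrE; [|lra|lra].
  have -> : (m * 2) ^+ 2 = 4 * (p * q) by rewrite pq; ring.
  by have := sqr_ge0 (p - q); rewrite sqrrB sqrrD; lra.
pose t0 := ln (x / y) / 2.
have E0 : hdist (mx2 x%:C b (conjc b) y%:C) (geodesic_pt 1%:M (e3 R) t0) = arcosh m.
  rewrite hE; congr arcosh.
  have t2 : expR t0 ^+ 2 = x / y.
    rewrite expr2 -expRD /t0 (_ : _ + _ = ln (x / y)); last by field.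
    by rewrite lnK// posrE divr_gt0.
  set tau := expR t0 in t2; have tau0 : 0 < tau by exact: expR_gt0.
  rewrite expRN -/tau.
  have xE : x = y * tau ^+ 2 by rewrite t2; field; rewrite gt_eqF.
  have -> : (x * tau^-1 + y * tau) / 2 = y * tau by rewrite xE; field; rewrite gt_eqF.
  apply/eqP; rewrite -(eqrXn2 (n:=2)) ?(ltW (mulr_gt0 _ _))//.
  by rewrite mm {1}xE; apply/eqP; ring.
apply/eqP; rewrite eq_le; apply/andP; split.
  rewrite -E0; apply: ge_inf; first by exists (arcosh m).
  by exists (geodesic_pt 1%:M (e3 R) t0) => //; exists t0.
apply: lb_le_inf => //.
by exists (arcosh m), (geodesic_pt 1%:M (e3 R) t0) => //; exists t0.
Qed.

(** By [inf_hdist_axis] the points at distance arcosh k from the axis satisfy x y = k^2, hence |b| =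
    |l|. The parameter v has modulus x / k and takes its direction from b / l. *)
Lemma standard_cylinder (k l : R) : 1 <= k -> k ^+ 2 = 1 + l ^+ 2 ->
  hyperbolic_cylinder [set mx2 (k * normc v)%:C ((l / normc v)%:C * v)
    ((l / normc v)%:C * conjc v) (k / normc v)%:C | v in [set v : R[i] | v != 0]].
Proof.
move=> k1 kl; have k0 : 0 < k by lra.
exists (range (geodesic_pt 1%:M (e3 R))), (arcosh k); split.
- exact: geodesic_axis.
- exact: arcosh_ge0.
have conjl (r : R) (v : R[i]) : conjc (r%:C * v) = r%:C * conjc v.
  by rewrite conjcM conjc_real.
apply/seteqP; split=> [_ [v /= v0 <-]|X [/H3P[x [y [b [x0 xy ->]]]]]].
  have nv := normc_gt0 v0; rewrite -conjl; set b := _ * v.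
  have x0 : 0 < k * normc v by rewrite mulr_gt0.
  have xyk : k * normc v * (k / normc v) = k ^+ 2 by field; rewrite gt_eqF.
  have xy : k * normc v * (k / normc v) = 1 + sqmod b.
    rewrite xyk kl -sqr_normc_sqmod /b normcM normc_real exprMn real_normK ?num_real//.
    by congr (1 + _); field; rewrite gt_eqF.
  split; first by apply/H3P; exists (k * normc v), (k / normc v), b.
  by rewrite inf_hdist_axis// xyk sqrtr_sqr gtr0_norm.
rewrite inf_hdist_axis// => E.
have xy1 : 1 <= x * y by rewrite xy lerDl sqmod_ge0.
have s1 : 1 <= Num.sqrt (x * y).
  by rewrite -(ler_sqr (x:=1)) ?nnegrE ?ler01 ?sqrtr_ge0// expr1n sqr_sqrtr//; lra.
have sk := arcosh_inj s1 k1 E.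
have xyk : x * y = k ^+ 2 by rewrite -sk sqr_sqrtr//; lra.
have bl : sqmod b = l ^+ 2 by lra.
(* For l = 0 the cylinder is the axis itself: b vanishes, and any direction of v gives the same
   point. *)
pose e : R[i] := if l == 0 then 1 else b / l%:C.
have lC : l != 0 -> l%:C != 0 :> R[i].
  by move=> l0; rewrite -(rmorph0 (real_complex R)) (inj_eq (@complexI R)).
have ne : normc e = 1.
  rewrite /e; have [l0|l0] := eqVneq l 0; first exact: normc1.
  rewrite normcM normcV normc_real -sqrt_sqmod bl sqrtr_sqr divff//.
  by rewrite normr_eq0.
have le : l%:C * e = b.
  rewrite /e; have [l0|l0] := eqVneq l 0; last by rewrite mulrC divfK// lC.
  rewrite l0 mul0r; apply/esym/eqP; rewrite -sqmod_eq0 bl l0 expr0n.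
  by [].
pose v := (x / k)%:C * e.
have xk0 : 0 < x / k by rewrite divr_gt0.
have nv : normc v = x / k by rewrite /v normcM ne mulr1 normc_real gtr0_norm.
exists v.
  by apply/eqP => v0; move: nv; rewrite v0 normc0 => h; rewrite -h ltxx in xk0.
have lv : (l / normc v)%:C * v = b.
  rewrite -le nv /v mulrA -realcM; congr (_%:C * _).
  by field; rewrite !gt_eqF.
rewrite -conjl lv nv; congr mx2; congr _%:C; first by field; rewrite gt_eqF.
by apply: (mulfI (lt0r_neq0 x0)); rewrite xyk; field; rewrite !gt_eqF.
Qed.

End HyperbolicSpace.

(** * Frames of the Legendrian lift *)

(** C minus the origin is not star-shaped about v0, but at most two segments avoiding 0 lead from v0
    to any of its points. *)
Lemma punctured_plane_segments (R : realType) (W : R[i] -> Prop) (v0 : R[i]) :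
  v0 != 0 -> W v0 ->
  (forall v v' : R[i], W v -> (forall s : R, 0 <= s <= 1 -> v + s%:C * (v' - v) != 0) -> W v') ->
  forall v, v != 0 -> W v.
Proof.
move=> v00 W0 step v vn0.
have [avoid|] := pselect (forall s : R, 0 <= s <= 1 -> v0 + s%:C * (v - v0) != 0).
  exact: step avoid.
move=> /existsNP[s /not_implyP[/andP[s0 s1] /negP]]; rewrite negbK => /eqP sE.
(* 0 lies on [v0, v], hence v is a negative multiple of v0: go through i v0. *)
have realC0 (r : R) : (r%:C == 0 :> R[i]) = (r == 0).
  by rewrite -(rmorph0 (real_complex R)) (inj_eq (@complexI R)).
have sn0 : s != 0.
  by apply: contra v00 => /eqP s_0; rewrite s_0 mul0r addr0 in sE; rewrite sE.
pose r := (1 - s) / s.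
have vE : v = - (r%:C * v0).
  apply: (mulfI (_ : s%:C != 0)); first by rewrite realC0.
  have -> : s%:C * - (r%:C * v0) = - ((s * r)%:C * v0) by rewrite realcM; ring.
  have -> : s * r = 1 - s by rewrite /r mulrC divfK.
  by apply/eqP; rewrite -subr_eq0 -sE realcB; apply/eqP; ring.
have rn0 : r != 0 by apply: contra vn0 => /eqP r0; rewrite vE r0 mul0r oppr0.
apply: (step ('i%C * v0)).
  apply: (step v0) => // t _.
  have -> : v0 + t%:C * ('i%C * v0 - v0) = ((1 - t) +i* t) * v0.
    have -> : (1 - t) +i* t = 1 - t%:C + t%:C * 'i%C by simpc.
    by ring.
  rewrite mulf_neq0// eq_complex /=; apply/negP => /andP[/eqP h1 /eqP h2].
  by rewrite h2 subr0 in h1; move/eqP: h1; rewrite oner_eq0.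
move=> t _; rewrite vE.
have -> : 'i%C * v0 + t%:C * (- (r%:C * v0) - 'i%C * v0) = ((- (t * r)) +i* (1 - t)) * v0.
  have -> : (- (t * r)) +i* (1 - t) = 'i%C - t%:C * 'i%C - t%:C * r%:C.
    by simpc.
  by ring.
rewrite mulf_neq0// eq_complex /=; apply/negP => /andP[/eqP h1 /eqP h2].
have t1 : t = 1 by lra.
by move/eqP: h1; rewrite t1 mul1r oppr_eq0 (negbTE rn0).
Qed.

Lemma conj_diag_mx2 (R : realType) (w : R[i]) (a b : R) : w != 0 ->
  mx2 w 0 0 w^-1 *m mx2 a%:C b%:C b%:C a%:C *m ctr (mx2 w 0 0 w^-1) =
  mx2 (a * normc (w ^+ 2))%:C ((b / normc (w ^+ 2))%:C * w ^+ 2)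
    ((b / normc (w ^+ 2))%:C * conjc (w ^+ 2)) (a / normc (w ^+ 2))%:C.
Proof.
move=> w0; have wb0 : conjc w != 0 by rewrite conjc_eq0.
have wwE : (normc (w ^+ 2))%:C = w * conjc w.
  by rewrite mulc_conj expr2 normcM -expr2 sqr_normc_sqmod.
have dvE (r : R) : (r / normc (w ^+ 2))%:C = r%:C / (w * conjc w).
  by rewrite realcM -wwE; congr (_ * _); exact: fmorphV.
have [X00 X01 X10 X11] := mx2E a%:C b%:C b%:C a%:C.
have [w00 w01 w10 w11] := mx2E w 0 0 w^-1.
apply: eq_mx2; rewrite mulmx2E !ctrE ?w00 ?w01 ?w10 ?w11 !mulmx2E ?w00 ?w01 ?w10 ?w11
  ?X00 ?X01 ?X10 ?X11 ?conjc0 ?conjc_inv ?dvE ?realcM ?wwE ?expr2 ?conjcM.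
- by ring.
- by field; rewrite w0 wb0.
- by field; rewrite w0 wb0.
- by field; rewrite w0 wb0.
Qed.

Section Frame.
Variables (R : realType) (S T : topologicalType).
Variables (P : S -> chart S 'rV[R]_2) (J : S -> chart S R[i]^o).
Variables (A : T -> chart T R[i]^o) (pi : T -> S).
Variables (f n : S -> 'M[R[i]]_2) (E : T -> 'M[R[i]]_2) (h : S -> R).
Hypothesis haus : hausdorff_space S.
Hypothesis atlasP : is_atlas P.
Hypothesis csJ : complex_structure P J.
Hypothesis sf : smooth_map P f.
Hypothesis sn : smooth_map P n.
Hypothesis ucov : universal_covering J A pi.
Hypothesis lift : legendrian_lift A pi f n E.
Hypothesis ds : is_ds11 J A pi E h.
Hypothesis comp : complete_conformal J h.

Lemma maurer_cartanE q : maurer_cartan A E q = mx2 0 (theta A E q) (omega A E q) 0.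
Proof. by apply: eq_mx2 => //; exact: lift_legendrian lift q _. Qed.

Lemma unit_E q : E q \in unitmx.
Proof. by rewrite unitmxE (lift_SL2 lift) unitr1. Qed.

Lemma dholoE q : dholo A E q = E q *m maurer_cartan A E q.
Proof. by rewrite /maurer_cartan mulKVmx// unit_E. Qed.

Lemma canonical_forms_neq0 q : omega A E q = 0 -> theta A E q != 0.
Proof.
move=> o0; apply: contra (lift_immersion lift q) => /eqP t0.
rewrite dholoE maurer_cartanE o0 t0; apply/eqP.
have -> : mx2 0 0 0 0 = 0 :> 'M[R[i]]_2 by apply/esym; apply: eq_mx2; rewrite mxE.
by rewrite mulmx0.
Qed.

Variables (Q Qi D : 'M[R[i]]_2) (eta : T -> R[i]) (q0 : T).
Hypothesis detQ : \det Q = 1.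
Hypothesis QiQ : Qi *m Q = 1%:M.
Hypothesis MCQ : forall q, maurer_cartan A E q *m Q = eta q *: (Q *m D).
Hypothesis eta_neq0 : forall q, eta q != 0.

(** Since Q is constant, H = B E Q solves dH = eta H D, and B normalises its value at q0 to the
    identity. The congruence of the theorem is the action of this same B. *)
Let B := invmx (E q0 *m Q).
Let H q := B *m E q *m Q.

Lemma QQi : Q *m Qi = 1%:M.
Proof. exact: mulmx1C. Qed.

Lemma unit_EQ : E q0 *m Q \in unitmx.
Proof. by rewrite unitmxE det_mulmx (lift_SL2 lift) detQ mul1r unitr1. Qed.

Lemma det_B : \det B = 1.
Proof. by rewrite det_inv det_mulmx (lift_SL2 lift) detQ mul1r invr1. Qed.

Lemma det_H q : \det (H q) = 1.
Proof. by rewrite !det_mulmx det_B (lift_SL2 lift) detQ !mul1r. Qed.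

Lemma frame_base : H q0 = 1%:M.
Proof. by rewrite /H -mulmxA mulVmx// unit_EQ. Qed.

Lemma frame_cdiff q i j :
  cdiff (fun z => H (chinv (A q) z) i j) (A q q) (eta q * (H q *m D) i j).
Proof.
have [_ [atA _] _ _] := ucov; have [_ qq] := atA q.
have d k l : cdiff (fun z => E (chinv (A q) z) k l) (A q q) (dholo A E q k l).
  by rewrite mxE; apply: derivable_cdiff; apply: (lift_holomorphic lift); exists q.
have := cdiff_mulmx B Q d i j.
suff -> : B *m dholo A E q *m Q = eta q *: (H q *m D) by rewrite mxE.
rewrite dholoE; move: (maurer_cartan A E q) (MCQ q) => M MQ.
by rewrite -!mulmxA MQ -!scalemxAr /H !mulmxA.
Qed.

Lemma frameE (X : 'M[R[i]]_2) q : B *m (E q *m X *m ctr (E q)) *m ctr B =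
  H q *m (Qi *m X *m ctr Qi) *m ctr (H q).
Proof.
have HQ : H q *m Qi = B *m E q by rewrite /H -mulmxA QQi mulmx1.
by rewrite !mulmxA HQ -!mulmxA -[ctr Qi *m _]ctrM HQ ctrM !mulmxA.
Qed.

Lemma frame_f q : B *m f (pi q) *m ctr B = H q *m (Qi *m ctr Qi) *m ctr (H q).
Proof.
by have := frameE 1%:M q; rewrite !mulmx1 (lift_front lift).
Qed.

Lemma frame_n q : B *m n (pi q) *m ctr B = H q *m (Qi *m e3 R *m ctr Qi) *m ctr (H q).
Proof. by rewrite (lift_normal lift) frameE. Qed.

Lemma frame_strict (g : S -> 'M[R[i]]_2) p x i j : smooth_map P g -> dom (J p) x ->
  strict_at (fun z => (B *m g (chinv (J p) z) *m ctr B) i j) (J p x).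
Proof.
move=> sg px.
by apply: (@strict_mulmx _ _ _ _ _ B (ctr B) (fun z => g (chinv (J p) z))) => k l;
   exact: smooth_map_strict.
Qed.

Lemma frame_constant (u : T -> R[i]) :
  (forall q, cdiff (fun z => u (chinv (A q) z)) (A q q) 0) -> forall q, u q = u q0.
Proof. by have [sc caA _ _] := ucov => hu q; exact: (cdiff0_constant_on caA). Qed.

Lemma chinv_base q : chinv (A q) (A q q) = q.
Proof. by have [_ [atA _] _ _] := ucov; have [[_ _ K _ _] qq] := atA q; exact: K. Qed.

(** The second column of H D vanishes, so the second column of H keeps its value at q0, and the
    determinant fixes the upper left entry. The remaining entry g of H is an entry of B f
    transformed by B, so it descends to S, and the metric |eta|^2 = |dg|^2 corresponds to lam =
    1. *)
Lemma horosphere_case : D = mx2 0 0 1 0 -> Qi *m ctr Qi = 1%:M ->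
  (forall q, sqmod (omega A E q) + sqmod (theta A E q) = sqmod (eta q)) ->
  horosphere ((fun X => B *m X *m ctr B) @` range f).
Proof.
move=> DE QQ dsE.
have [D00 D01 D10 D11] := mx2E (0 : R[i]) 0 1 0; rewrite -DE in D00 D01 D10 D11.
have HD1 q i : (H q *m D) i 1 = 0 by rewrite mulmx2E D01 D11 !mulr0 addr0.
have HD0 q i : (H q *m D) i 0 = H q i 1 by rewrite mulmx2E D00 D10 mulr0 mulr1 add0r.
have Hc i q : H q i 1 = H q0 i 1.
  apply: (frame_constant (u := fun q => H q i 1)) => {}q.
  by have := frame_cdiff q i 1; rewrite HD1 mulr0.
have H11 q : H q 1 1 = 1 by rewrite Hc frame_base mxE.
have H01 q : H q 0 1 = 0 by rewrite Hc frame_base mxE.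
have H00 q : H q 0 0 = 1.
  by have := det_H q; rewrite det2E H11 H01 mulr1 mul0r subr0.
pose G p : R[i]^o := (B *m f p *m ctr B) 1 0.
have XE q : B *m f (pi q) *m ctr B =
    mx2 1 (conjc (H q 1 0)) (H q 1 0) (1 + (sqmod (H q 1 0))%:C).
  rewrite frame_f QQ mulmx1; apply: eq_mx2; rewrite mulmx2E !ctrE ?H00 ?H01 ?H11 ?conjc1 ?conjc0.
  - by rewrite mulr0 addr0 mulr1.
  - by rewrite mul1r mul0r addr0.
  - by rewrite mulr1 mulr0 addr0.
  - by rewrite mulc_conj mulr1 addrC.
have GE q : G (pi q) = H q 1 0 by rewrite /G XE mxE.
have caJ : complex_atlas J by have [] := csJ.
have surjG v : exists p, G p = v.
  apply: (@developing_segment R S T J A pi E h haus caJ ucov ds comp G eta (fun=> 1)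
    _ _ eta_neq0 _ _ _ v (pi q0) 1) => //.
  - by move=> p x px; exact: frame_strict.
  - move=> q.
    have -> : (fun z => G (pi (chinv (A q) z))) = fun z => H (chinv (A q) z) 1 0.
      by apply/funext => z; rewrite GE.
    have d := frame_cdiff q 1 0; rewrite HD0 H11 mulr1 in d; exact: d.
  - by move=> p; exact: cst_continuous.
  - by move=> q; rewrite dsE expr1n mul1r.
have [_ _ cov _] := ucov.
have -> : (fun X => B *m X *m ctr B) @` range f =
    range (fun g : R[i] => mx2 1 (conjc g) g (1 + (sqmod g)%:C)).
  apply/seteqP; split=> [_ [_ [p _ <-] <-]|_ [g _ <-]].
    by have [q <-] := covering_surj cov p; exists (H q 1 0); rewrite ?XE.
  have [p pg] := surjG g; have [q qp] := covering_surj cov p; subst p.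
  by exists (f (pi q)); [exists (pi q)|rewrite XE -GE pg].
exact: standard_horosphere.
Qed.

(* v = w^2 descends to S: it is a polynomial in the entries of f and n. *)
Lemma cylinder_case (s : R[i]) (k l c : R) : s != 0 -> D = mx2 s 0 0 (- s) ->
  1 <= k -> k ^+ 2 = 1 + l ^+ 2 -> 0 < c ->
  Qi *m ctr Qi = mx2 k%:C l%:C l%:C k%:C ->
  Qi *m e3 R *m ctr Qi = mx2 (- l)%:C (- k)%:C (- k)%:C (- l)%:C ->
  (forall q, sqmod (omega A E q) + sqmod (theta A E q) = c * sqmod (eta q)) ->
  hyperbolic_cylinder ((fun X => B *m X *m ctr B) @` range f).
Proof.
move=> s0 DE k1 kl c0 NE N3E dsE.
have [D00 D01 D10 D11] := mx2E s 0 0 (- s); rewrite -DE in D00 D01 D10 D11.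
have HD1 q i : (H q *m D) i 1 = - s * H q i 1.
  by rewrite mulmx2E D01 D11 mulr0 add0r mulrC.
have HD0 q i : (H q *m D) i 0 = s * H q i 0.
  by rewrite mulmx2E D00 D10 mulr0 addr0 mulrC.
(* The columns of H have logarithmic derivatives s eta and - s eta, which cancel in a product of one
   entry from each. The values at q0 then make H diagonal. *)
have Hc i j q : H q i 0 * H q j 1 = H q0 i 0 * H q0 j 1.
  apply: (frame_constant (u := fun q => H q i 0 * H q j 1)) => {}q.
  have := cdiffM (frame_cdiff q i 0) (frame_cdiff q j 1).
  rewrite HD1 HD0 chinv_base.
  by have -> : H q i 0 * (eta q * (- s * H q j 1)) + H q j 1 * (eta q * (s * H q i 0)) = 0 by ring.
have w11 q : H q 0 0 * H q 1 1 = 1 by rewrite Hc frame_base !mxE mulr1.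
have w0 q : H q 0 0 != 0.
  by apply/eqP => w0; have := w11 q; rewrite w0 mul0r => /esym/eqP; rewrite oner_eq0.
have H11 q : H q 1 1 = (H q 0 0)^-1 by apply: (mulfI (w0 q)); rewrite w11 divff.
have H01 q : H q 0 1 = 0.
  by apply: (mulfI (w0 q)); rewrite Hc frame_base !mxE !mulr0.
have H10 q : H q 1 0 = 0.
  have h1 : H q 1 1 != 0 by rewrite H11 invr_neq0.
  by apply: (mulIf h1); rewrite Hc frame_base !mxE !mul0r.
pose w q := H q 0 0; pose v q := w q ^+ 2.
have v0 q : v q != 0 by rewrite expf_neq0// w0.
have nw q : 0 < normc (w q) by exact: normc_gt0 (w0 q).
have nvE q : normc (v q) = normc (w q) ^+ 2 by rewrite /v !expr2 normcM.
have HE q : H q = mx2 (w q) 0 0 (w q)^-1 by exact: eq_mx2.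
have conjE q (a b : R) (X : 'M[R[i]]_2) : X = mx2 a%:C b%:C b%:C a%:C ->
    H q *m X *m ctr (H q) = mx2 (a * normc (v q))%:C ((b / normc (v q))%:C * v q)
      ((b / normc (v q))%:C * conjc (v q)) (a / normc (v q))%:C.
  by move=> ->; rewrite HE; apply: conj_diag_mx2; exact: w0.
have XE q := etrans (frame_f q) (conjE q _ _ _ NE).
have YE q := etrans (frame_n q) (conjE q _ _ _ N3E).
pose X p := B *m f p *m ctr B; pose Y p := B *m n p *m ctr B.
(* The entries are X00 = k |v|, Y00 = - l |v|, X01 = l v / |v| and Y01 = - k v / |v|. Since k^2 -
   l^2 = 1, the first factor is |v| and the second is v / |v|, with no division by l, which may be
   zero. *)
pose G p : R[i]^o := (k%:C * X p 0 0 + l%:C * Y p 0 0) *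
  (- k%:C * Y p 0 1 + - l%:C * X p 0 1).
have GE q : G (pi q) = v q.
  have [X00 X01 _ _] := mx2E (k * normc (v q))%:C ((l / normc (v q))%:C * v q)
      ((l / normc (v q))%:C * conjc (v q)) (k / normc (v q))%:C.
  have [Y00 Y01 _ _] := mx2E (- l * normc (v q))%:C ((- k / normc (v q))%:C * v q)
      ((- k / normc (v q))%:C * conjc (v q)) (- l / normc (v q))%:C.
  rewrite /G /X /Y XE YE X00 X01 Y00 Y01.
  have -> : k%:C * (k * normc (v q))%:C + l%:C * (- l * normc (v q))%:C = (normc (v q))%:C.
    rewrite -!realcM -realcD; congr _%:C.
    have -> : k * (k * normc (v q)) + l * (- l * normc (v q)) = (k ^+ 2 - l ^+ 2) * normc (v q).
      by ring.
    by rewrite kl addrK mul1r.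
  have -> : - k%:C * ((- k / normc (v q))%:C * v q) + - l%:C * ((l / normc (v q))%:C * v q) =
      ((k ^+ 2 - l ^+ 2) / normc (v q))%:C * v q.
    have -> : (k ^+ 2 - l ^+ 2) / normc (v q) = - k * (- k / normc (v q)) + - l * (l / normc (v q)).
      by ring.
    rewrite realcD !(realcM (- _)) -!(rmorphN (real_complex R)).
    by ring.
  rewrite kl addrK mulrA -realcM mul1r divff ?mul1r//.
  by rewrite gt_eqF// nvE exprn_gt0.
have G0 p : G p != 0.
  by have [_ _ cov _] := ucov; have [q <-] := covering_surj cov p; rewrite GE.
(* From dv = 2 s eta v one gets c |eta|^2 = c |dv|^2 / (4 |s|^2 |v|^2). *)
pose lam (y : R[i]^o) : R := Num.sqrt c / (2 * normc s) / normc y.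
have ns := normc_gt0 s0.
have lc0 : 0 < Num.sqrt c / (2 * normc s) by rewrite divr_gt0 ?sqrtr_gt0// mulr_gt0.
have surjG y : y != 0 -> exists p, G p = y.
  apply: (@punctured_plane_segments R (fun y => exists p, G p = y) (G (pi q0))).
  - exact: G0.
  - by exists (pi q0).
  move=> _ y' [p <-] avoid.
  pose seg (t : R) : R[i]^o := G p + t%:C * (y' - G p).
  have cseg : continuous seg.
    move=> t; apply: vdiff_continuous; exact: (@seg_vdiff R (G p) y' id).
  pose m (t : R) : R := normc (seg t).
  have cm : {within `[0, 1], continuous m}.
    apply: continuous_subspaceT => t.
    by apply: (@continuous_comp _ _ _ seg (@normc R : R[i]^o -> R));
      [exact: cseg|exact: continuous_normc].
  (* A segment avoiding 0 keeps a positive distance from it, so lam is bounded along it. *)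
  have [t1 t1I mmin] := EVT_min ler01 cm.
  have m0 : 0 < m t1 by apply: normc_gt0; apply: avoid; rewrite in_itv in t1I.
  have caJ : complex_atlas J by have [] := csJ.
  apply: (@developing_segment R S T J A pi E h haus caJ ucov ds comp G
    (fun q => 2 * s * eta q * v q) lam _ _ _ _ _ _ y' p (Num.sqrt c / (2 * normc s) / m t1)).
  - move=> p' x px.
    by apply: strictM; apply: strictD; apply: strictM;
      (exact: strict_cst || exact: frame_strict).
  - move=> q.
    have -> : (fun z => G (pi (chinv (A q) z))) =
        fun z => H (chinv (A q) z) 0 0 * H (chinv (A q) z) 0 0.
      by apply/funext => z; rewrite GE /v expr2.
    have := cdiffM (frame_cdiff q 0 0) (frame_cdiff q 0 0); rewrite HD0 chinv_base.
    by congr (cdiff _ _ _); rewrite /v /w; ring.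
  - move=> q; have n2 : 2 != 0 :> R[i] by rewrite pnatr_eq0.
    exact: (mulf_neq0 (mulf_neq0 (mulf_neq0 n2 s0) (eta_neq0 q)) (v0 q)).
  - by move=> p'; rewrite divr_gt0// normc_gt0.
  - move=> p'; apply: (@continuousM R _ (fun=> Num.sqrt c / (2 * normc s))
      (fun y : R[i]^o => (normc y)^-1)); first exact: cst_continuous.
    apply: (@continuousV R _ (fun y : R[i]^o => normc y)); last exact: continuous_normc.
    by rewrite gt_eqF// normc_gt0.
  - move=> q; rewrite dsE GE /lam -!(sqr_normc_sqmod (_ * _)) !normcM normc2 -(sqr_normc_sqmod (eta q)).
    have nv : normc (v q) != 0 by rewrite gt_eqF// nvE exprn_gt0.
    rewrite -{1}(sqr_sqrtr (ltW c0)); field.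
    by rewrite !gt_eqF.
  move=> t tI; rewrite /lam ler_pM2l// lef_pV2 ?posrE//.
    exact: (mmin t).
  by apply: (lt_le_trans m0); exact: (mmin t).
have [_ _ cov _] := ucov.
have -> : (fun X => B *m X *m ctr B) @` range f =
    [set mx2 (k * normc v)%:C ((l / normc v)%:C * v)
    ((l / normc v)%:C * conjc v) (k / normc v)%:C | v in [set v : R[i] | v != 0]].
  apply/seteqP; split=> [_ [_ [p _ <-] <-]|_ [y /= y0 <-]].
    by have [q <-] := covering_surj cov p; exists (v q) => //=; rewrite XE.
  have [p pg] := surjG y y0; have [q qp] := covering_surj cov p; subst p.
  by exists (f (pi q)); [exists (pi q)|rewrite XE -GE pg].
exact: standard_cylinder.
Qed.

End Frame.

(** * Normal forms of the constant matrix, and the conclusion *)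

Theorem proposition4p4 (R : realType)
    (S : topologicalType) (P : S -> chart S 'rV[R]_2)
    (hS : oriented_surface P)
    (f n : S -> 'M[R[i]]_2) (hf : flat_front P f n)
    (J : S -> chart S R[i]^o) (hJ : complex_structure P J)
    (T : topologicalType) (A : T -> chart T R[i]^o) (pi : T -> S)
    (hpi : universal_covering J A pi)
    (E : T -> 'M[R[i]]_2) (hE : legendrian_lift A pi f n E)
    (hcomplete : weakly_complete J A pi E)
    (hrho : exists c : option R[i], forall q : T, rho A E q = c) :
  exists Phi : 'M[R[i]]_2 -> 'M[R[i]]_2, isometry_H3 Phi /\
    (horosphere (Phi @` range f) \/ hyperbolic_cylinder (Phi @` range f)).
Proof.
have [h ds comp] := hcomplete; have [hfr _] := hf.
have sf := front_smooth hfr; have sn := front_normal_smooth hfr.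
have haus := surf_hausdorff hS; have atP := surf_atlas hS.
have [[[q0 _] _ _] _ _ _] := hpi.
have MCE := maurer_cartanE hE.
have neq0 := canonical_forms_neq0 hE.
have sq0 : sqmod (0 : R[i]) = 0 by rewrite /sqmod /= expr0n addr0.
have [c cP] := hrho.
have [c0|[k [kE rhoE]]] : (c = None) \/ (exists k, c = Some k /\
    forall q, omega A E q != 0 /\ theta A E q = k * omega A E q).
  case: c cP => [k|] cP; [right|by left].
  exists k; split=> // q; have := cP q; rewrite /rho.
  by case: eqVneq => // o0 [<-]; rewrite divfK.
- have o0 q : omega A E q = 0.
    by have := cP q; rewrite c0 /rho; case: eqP.
  (* Here omega vanishes identically. Exchanging the basis vectors turns the upper nilpotent form
     into the lower one; the sign needed for determinant 1 is absorbed in eta = - theta. Since Q is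
     unitary, the expression of f is unaffected. *)
  pose Q : 'M[R[i]]_2 := mx2 0 1 (-1) 0; pose Qi : 'M[R[i]]_2 := mx2 0 (-1) 1 0.
  have [a1 a2 a3 a4] := mx2E (0 : R[i]) 1 (-1) 0; rewrite -/Q in a1 a2 a3 a4.
  have [b1 b2 b3 b4] := mx2E (0 : R[i]) (-1) 1 0; rewrite -/Qi in b1 b2 b3 b4.
  have oneE : 1%:M = mx2 1 0 0 1 :> 'M[R[i]]_2 by apply: eq_mx2; rewrite mxE.
  have detQ : \det Q = 1 by rewrite det2E a1 a2 a3 a4; ring.
  exists (fun X => invmx (E q0 *m Q) *m X *m ctr (invmx (E q0 *m Q))); split.
    apply: isometry_conj; exact: (det_B hE q0 detQ).
  left; apply: (@horosphere_case R S T P J A pi f n E h haus atP hJ sf hpi hE ds comp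
    Q Qi (mx2 0 0 1 0) (fun q => - theta A E q) q0 detQ) => //.
  + by rewrite oneE; apply: eq_mx2; rewrite mulmx2E ?a1 ?a2 ?a3 ?a4 ?b1 ?b2 ?b3 ?b4; ring.
  + move=> q; rewrite MCE o0.
    have [m1 m2 m3 m4] := mx2E 0 (theta A E q) 0 0.
    have [d1 d2 d3 d4] := mx2E (0 : R[i]) 0 1 0.
    apply/matrixP; apply: ord2P; apply: ord2P;
      rewrite [RHS]mxE !mulmx2E ?a1 ?a2 ?a3 ?a4 ?m1 ?m2 ?m3 ?m4 ?d1 ?d2 ?d3 ?d4; ring.
  + by move=> q; rewrite oppr_eq0 neq0.
  + by rewrite oneE; apply: eq_mx2;
      rewrite mulmx2E !ctrE ?b1 ?b2 ?b3 ?b4 ?rmorphN ?conjc1 ?conjc0; ring.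
  + by move=> q; rewrite o0 sq0 add0r -!sqr_normc_sqmod normc_opp.
have o0 q : omega A E q != 0 by have [] := rhoE q.
have tE q : theta A E q = k * omega A E q by have [] := rhoE q.
have [k0|k0] := eqVneq k 0.
- exists (fun X => invmx (E q0 *m 1%:M) *m X *m ctr (invmx (E q0 *m 1%:M))); split.
    by apply: isometry_conj; apply: (det_B hE q0); rewrite det1.
  left; apply: (@horosphere_case R S T P J A pi f n E h haus atP hJ sf hpi hE ds comp
    1%:M 1%:M (mx2 0 0 1 0) (omega A E) q0) => //.
  + by rewrite det1.
  + by rewrite mulmx1.
  + move=> q; rewrite MCE tE k0 mul0r mulmx1 mul1mx.
    by apply/esym; apply: eq_mx2; rewrite !mxE /= ?mulr0 ?mulr1.
  + by rewrite ctr1 mulmx1.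
  + by move=> q; rewrite tE k0 mul0r sq0 addr0.
(* The matrix with rows (0, k) and (1, 0) has eigenvalues s and - s, with eigenvectors (s, 1) and (-
   s, 1). Dividing both by mu, where mu^2 = 2 s, gives the matrix of eigenvectors determinant 1. *)
pose s := sqrtC k; pose mu := sqrtC (2 * s).
have ss : s ^+ 2 = k := sqrtCK k.
have s0 : s != 0 by rewrite sqrtC_eq0.
have n2 : 2 != 0 :> R[i] by rewrite pnatr_eq0.
have mumu : mu ^+ 2 = 2 * s := sqrtCK (2 * s).
have mu0 : mu != 0 by rewrite sqrtC_eq0 mulf_neq0.
pose sg := normc s; have sg0 : 0 < sg := normc_gt0 s0.
pose Q : 'M[R[i]]_2 := mx2 (s / mu) (- s / mu) mu^-1 mu^-1.
pose Qi : 'M[R[i]]_2 := mx2 mu^-1 (s / mu) (- mu^-1) (s / mu).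
have [a1 a2 a3 a4] := mx2E (s / mu) (- s / mu) mu^-1 mu^-1; rewrite -/Q in a1 a2 a3 a4.
have [b1 b2 b3 b4] := mx2E mu^-1 (s / mu) (- mu^-1) (s / mu); rewrite -/Qi in b1 b2 b3 b4.
have oneE : 1%:M = mx2 1 0 0 1 :> 'M[R[i]]_2 by apply: eq_mx2; rewrite mxE.
have twos : s / mu / mu = 2^-1.
  have -> : s / mu / mu = s / mu ^+ 2 by field.
  by rewrite mumu; field; rewrite s0.
have detQ : \det Q = 1.
  rewrite det2E a1 a2 a3 a4.
  have -> : s / mu / mu - - s / mu / mu = (s / mu / mu) * 2 by ring.
  by rewrite twos mulVf.
exists (fun X => invmx (E q0 *m Q) *m X *m ctr (invmx (E q0 *m Q))); split.
  apply: isometry_conj; exact: (det_B hE q0 detQ).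
(* The entries of [Qi *m ctr Qi]: cosh and sinh of ln |s|. The cylinder thus has radius the absolute
   value of ln |s|, that is, half the absolute value of ln |k|, and degenerates to its axis for |k|
   = 1. *)
pose kk := (1 + sg ^+ 2) / (2 * sg); pose ll := (sg ^+ 2 - 1) / (2 * sg).
have mubar : mu * conjc mu = (2 * sg)%:C.
  rewrite mulc_conj -sqr_normc_sqmod; congr _%:C.
  have -> : normc mu ^+ 2 = normc (mu ^+ 2) by rewrite !expr2 normcM.
  by rewrite mumu normcM normc2.
have muc0 : conjc mu != 0 by rewrite conjc_eq0.
have muV : mu^-1 * (conjc mu)^-1 = ((2 * sg)^-1)%:C.
  rewrite -invfM mubar; apply/esym; exact: fmorphV.
have sbar : s * conjc s = (sg ^+ 2)%:C by rewrite mulc_conj sqr_normc_sqmod.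
have kE' : kk%:C = (1 + s * conjc s) * (mu^-1 * (conjc mu)^-1).
  by rewrite sbar muV /kk realcM realcD.
have lE' : ll%:C = (s * conjc s - 1) * (mu^-1 * (conjc mu)^-1).
  by rewrite sbar muV /ll realcM realcB.
have e3E : e3 R = mx2 1 0 0 (-1) by apply: eq_mx2; rewrite mxE.
right; apply: (@cylinder_case R S T P J A pi f n E h haus atP hJ sf sn hpi hE ds comp
  Q Qi (mx2 s 0 0 (- s)) (omega A E) q0 detQ _ _ _ s kk ll (1 + sqmod k)) => //.
- rewrite oneE; apply: eq_mx2; rewrite mulmx2E ?a1 ?a2 ?a3 ?a4 ?b1 ?b2 ?b3 ?b4.
  + have -> : mu^-1 * (s / mu) + s / mu * mu^-1 = (s / mu / mu) * 2 by ring.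
    by rewrite twos mulVf.
  + by ring.
  + by ring.
  + have -> : - mu^-1 * (- s / mu) + s / mu * mu^-1 = (s / mu / mu) * 2 by ring.
    by rewrite twos mulVf.
- move=> q; rewrite MCE tE -ss.
  have [m1 m2 m3 m4] := mx2E 0 (s ^+ 2 * omega A E q) (omega A E q) 0.
  have [d1 d2 d3 d4] := mx2E s 0 0 (- s).
  apply/matrixP; apply: ord2P; apply: ord2P;
    rewrite [RHS]mxE !mulmx2E ?a1 ?a2 ?a3 ?a4 ?m1 ?m2 ?m3 ?m4 ?d1 ?d2 ?d3 ?d4; ring.
- rewrite /kk ler_pdivlMr ?mulr_gt0// mul1r.
  by have := sqr_ge0 (sg - 1); rewrite sqrrB expr1n; lra.
- by rewrite /kk /ll; field; rewrite gt_eqF.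
- by have := sqmod_ge0 k; lra.
- by apply: eq_mx2; rewrite mulmx2E !ctrE ?b1 ?b2 ?b3 ?b4 ?kE' ?lE'
    ?conjcN !conjcM ?conjc_inv; ring.
- have [g1 g2 g3 g4] := mx2E (1 : R[i]) 0 0 (-1); rewrite -e3E in g1 g2 g3 g4.
  by apply: eq_mx2; rewrite mulmx2E !mulmx2E !ctrE ?b1 ?b2 ?b3 ?b4 ?g1 ?g2 ?g3 ?g4
    realcN ?kE' ?lE' ?conjcN !conjcM ?conjc_inv; ring.
- by move=> q; rewrite tE -!sqr_normc_sqmod normcM; ring.
Qed.
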